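(* Let $\Omega=\bigcup_{i=1}^nJ_i$, $J_i=(\alpha_i,\beta_i)$, with $-\infty<\alpha_1<\beta_1<\alpha_2<\beta_2<\dots<\alpha_n<\beta_n<\infty$. Let $B$ be a unitary $n\times n$ matrix and let $A$, $Af=\frac1{2\pi i}f'$ on $\mathscr D_B$, be the self-adjoint extension of $f\mapsto\frac{1}{2\pi i}f'$ on $C_c^\infty(\Omega)$ with boundary matrix $B$. Let $U(t)=\exp(2\pi itA)$, $t\in\mathbb R$, be the associated one-parameter unitary group on $L^2(\Omega)$. (i) The domain $\mathscr D_B$ is invariant under $U(t)$ for all $t\in\mathbb R$, i.e. if $f\in\mathscr D_{\max}$ with $Bf(\vec\alpha)=f(\vec\beta)$, then $U(t)f\in\mathscr D_{\max}$ with $B(U(t)f)(\vec\alpha)=(U(t)f)(\vec\beta)$. (ii) Fix $i\in\{1,\dots,n\}$ and let $t\in\mathbb R$ be such that $J_i\cap(J_i-t)\neq\emptyset$. Then, for $f\in L^2(\Omega)$, $$(U(t)f)(x)=f(x+t)\quad\text{for a.e. }x\in J_i\cap(J_i-t).$$ In particular, $$(U(\beta_i-x)f)(x)=f(\beta_i),\quad (U(\alpha_i-x)f)(x)=f(\alpha_i),\quad\text{for }f\in\mathscr D_B,\ x\in J_i.$$ (iii) For $f\in\mathscr D_B$, if $x\in J_i$ and $t>\beta_i-x$, then $$[U(t)f](x)=\pi_i\left(B\,[U(t-(\beta_i-x))f](\vec\alpha)\right),$$ where $\pi_i:\mathbb C^n\to\mathbb C$, $\pi_i(x_1,\dots,x_n)=x_i$,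 is the projection onto the $i$-th component.
   Context: $\mathscr D_{\max}=\{f:\Omega\to\mathbb C: f$ is absolutely continuous on each $J_i$ and $f'\in L^2(\Omega)\}$. For $f\in\mathscr D_{\max}$ put $f(\alpha_i):=f(\alpha_i+)$, $f(\beta_i):=f(\beta_i-)$ (these limits exist), $f(\vec\alpha)=(f(\alpha_1),\dots,f(\alpha_n))$, $f(\vec\beta)=(f(\beta_1),\dots,f(\beta_n))$. For a unitary matrix $B$, $\mathscr D_B=\{f\in\mathscr D_{\max}:Bf(\vec\alpha)=f(\vec\beta)\}$, and the operator $f\mapsto\frac1{2\pi i}f'$ on $\mathscr D_B$ is self-adjoint in $L^2(\Omega)$. Pointwise values of elements of $\mathscr D_B$ (in particular of $U(t)f$ for $f\in\mathscr D_B$) refer to their absolutely continuous representatives. $J_i-t=\{y-t:y\in J_i\}$. $\exp(2\pi itA)=\int e^{2\pi itx}\,dE(x)$, with $E$ the spectral measure of $A$. *)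

(* Defs.v *)
From HB Require Import structures.
From mathcomp Require Import all_boot all_order all_algebra.
From mathcomp Require Import complex.
From mathcomp Require Import all_classical all_reals all_analysis.

Set Implicit Arguments.
Unset Strict Implicit.
Unset Printing Implicit Defensive.

Import Order.TTheory GRing.Theory Num.Theory.
Import numFieldNormedType.Exports.

Local Open Scope classical_set_scope.
Local Open Scope ring_scope.
Local Open Scope complex_scope.

Local Notation Re := complex.Re.
Local Notation Im := complex.Im.

(** The real numbers are an arbitrary [R : realType], the complex numbers are
    [R[i]].  Measurability, integrals, derivatives and one-sided limits of
    [R[i]]-valued functions are taken componentwise.  A function on a subset
    [W] of the line is a total function [R -> R[i]] whose values off [W] are
    irrelevant. *)

Section ComplexFunctions.
Context {R : realType}.

Definition cmeasurable (W : set R) (f : R -> R[i]) : Prop :=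
  measurable_fun W (fun x => Re (f x)) /\
  measurable_fun W (fun x => Im (f x)).

Definition cintegral (m : {measure set (measurableTypeR R) -> \bar R})
    (W : set R) (f : R -> R[i]) : R[i] :=
  (Rintegral m W (fun x => Re (f x))) +i* (Rintegral m W (fun x => Im (f x))).

(** Where one of the two components is not derivable this is a junk value; for
    an absolutely continuous [f] that happens only on a null set. *)
Definition cderive (f : R -> R[i]) (x : R) : R[i] :=
  (derive1 (fun y => Re (f y)) x) +i* (derive1 (fun y => Im (f y)) x).

Definition cright_lim (f : R -> R[i]) (a : R) : R[i] :=
  (lim (Re (f y) @[y --> a^'+])) +i* (lim (Im (f y) @[y --> a^'+])).

Definition cleft_lim (f : R -> R[i]) (a : R) : R[i] :=
  (lim (Re (f y) @[y --> a^'-])) +i* (lim (Im (f y) @[y --> a^'-])).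

Definition abs_continuous (J : set R) (f : R -> R[i]) : Prop :=
  forall e : R, 0 < e -> exists2 d : R, 0 < d &
    forall (k : nat) (a b : 'I_k -> R),
      (forall j, [/\ J (a j), J (b j) & a j <= b j]) ->
      trivIset setT (fun j => `]a j, b j[%classic) ->
      \sum_(j < k) (b j - a j) < d ->
      \sum_(j < k) Normc.normc (f (b j) - f (a j)) < e.

End ComplexFunctions.

(** Elements of [L^2(W)], [W] with Lebesgue measure, are represented by square
    integrable functions; equality in [L^2(W)] is [eqL2 W].  An operator on
    [L^2(W)] is a map on representatives compatible with [eqL2 W]. *)

Section L2.
Context {R : realType} (W : set R).
Local Notation mu := (@lebesgue_measure R).
Local Notation F := (R -> R[i]).

Definition sqnormL2 (f : F) : \bar R :=
  (\int[mu]_(x in W) (Normc.normc (f x) ^+ 2)%:E)%E.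

Definition L2 (f : F) : Prop :=
  cmeasurable W f /\ (sqnormL2 f < +oo)%E.

Definition eqL2 (f g : F) : Prop := ae_eq mu W f g.

(** Linear in the first argument. *)
Definition ipL2 (f g : F) : R[i] := cintegral mu W (fun x => f x * (g x)^*).

Definition bounded_operator (T : F -> F) : Prop :=
  [/\ forall f, L2 f -> L2 (T f),
      forall f g, L2 f -> L2 g -> eqL2 f g -> eqL2 (T f) (T g),
      forall (c : R[i]) f g, L2 f -> L2 g ->
        eqL2 (T (fun x => c * f x + g x)) (fun x => c * T f x + T g x)
    & exists M : R, forall f, L2 f -> (sqnormL2 (T f) <= M%:E * sqnormL2 f)%E].

Definition orthogonal_projection (P : F -> F) : Prop :=
  [/\ bounded_operator P,
      forall f, L2 f -> eqL2 (P (P f)) (P f)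
    & forall f g, L2 f -> L2 g -> ipL2 (P f) g = ipL2 f (P g)].

(** Projection-valued measures on the Borel sets of the line, countable
    additivity being meant in the strong operator topology. *)
Definition projection_valued_measure (E : set R -> F -> F) : Prop :=
  [/\ forall S, measurable S -> orthogonal_projection (E S),
      forall f, L2 f -> eqL2 (E set0 f) (cst 0),
      forall f, L2 f -> eqL2 (E setT f) f,
      forall S S' f, measurable S -> measurable S' -> L2 f ->
        eqL2 (E (S `&` S') f) (E S (E S' f))
    & forall (S : nat -> set R) f,
        (forall k, measurable (S k)) -> trivIset setT S -> L2 f ->
        sqnormL2 (fun x => E (\bigcup_k S k) f x - \sum_(k < N) E (S k) f x)
          @[N --> \oo] --> 0%E].

(** [m] is the Borel measure [S |-> <E(S) f, f>]. *)
Definition diagonal_measure (E : set R -> F -> F) (f : F)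
    (m : {measure set (measurableTypeR R) -> \bar R}) : Prop :=
  forall S : set R, measurable S -> m S = (Re (ipL2 (E S f) f))%:E.

(** [T] is the operator [\int phi dE], for a bounded Borel function [phi]; it is
    the bounded operator with [<T f, f> = \int phi(x) d<E(x) f, f>] for all
    [f]. *)
Definition spectral_integral (E : set R -> F -> F) (phi : R -> R[i])
    (T : F -> F) : Prop :=
  bounded_operator T /\
  forall f, L2 f -> exists m, diagonal_measure E f m /\
    ipL2 (T f) f = cintegral m setT phi.

(** [E] is the spectral measure of the operator [A] with domain [D]: one has
    [A = \int x dE(x)], that is, the domain is the set of those [f] for which
    [x] is square integrable with respect to [<E(x) f, f>], and on it
    [<A f, f> = \int x d<E(x) f, f>]. *)
Definition spectral_measure (D : F -> Prop) (A : F -> F)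
    (E : set R -> F -> F) : Prop :=
  projection_valued_measure E /\
  forall f, L2 f -> exists m, [/\ diagonal_measure E f m,
    (exists2 g, D g & eqL2 g f) <-> (\int[m]_x (x ^+ 2)%:E < +oo)%E
    & D f -> ipL2 (A f) f = cintegral m setT (fun x => x%:C)].

(** [U t = exp (2 pi i t A)], for [A] with spectral measure [E]. *)
Definition exp_group (E : set R -> F -> F) (U : R -> F -> F) : Prop :=
  forall t, spectral_integral E
    (fun x => (cos (2 * pi * t * x)) +i* (sin (2 * pi * t * x))) (U t).

End L2.

Section Momentum.
Context {R : realType} {n : nat} (alpha beta : 'I_n -> R).
Local Notation F := (R -> R[i]).

Definition J (i : 'I_n) : set R := `]alpha i, beta i[%classic.

Definition Omega : set R := \bigcup_(i in setT) J i.

Definition Dmax (f : F) : Prop :=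
  (forall i, abs_continuous (J i) f) /\ L2 Omega (cderive f).

Definition at_alpha (f : F) : 'cV[R[i]]_n := \col_i cright_lim f (alpha i).

Definition at_beta (f : F) : 'cV[R[i]]_n := \col_i cleft_lim f (beta i).

Definition DB (B : 'M[R[i]]_n) (f : F) : Prop :=
  Dmax f /\ B *m at_alpha f = at_beta f.

Definition momentum (f : F) : F :=
  fun x => (0 +i* (2 * pi))^-1 * cderive f x.

(** [g] is the absolutely continuous representative of the element [f] of
    [L^2(Omega)]; it is unique on [Omega]. *)
Definition ac_representative (f g : F) : Prop := Dmax g /\ eqL2 Omega g f.

End Momentum.

(* Main.v *)
Require Import Defs.
From HB Require Import structures.
From mathcomp Require Import all_boot all_order all_algebra.
From mathcomp Require Import complex.
From mathcomp Require Import all_classical all_reals all_analysis.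
From mathcomp Require Import measurable_realfun ring lra.

Set Implicit Arguments.
Unset Strict Implicit.
Unset Printing Implicit Defensive.

Import Order.TTheory GRing.Theory Num.Theory.
Import numFieldNormedType.Exports.

Local Open Scope classical_set_scope.
Local Open Scope ring_scope.
Local Open Scope complex_scope.

Local Notation Re := complex.Re.
Local Notation Im := complex.Im.

(** Only explicit test functions are ever differentiated.  A [C^{1,1}] spline
    [w] with compact support in [Omega] lies in [D_B] and [2 pi i A w = w'], so
    by polarization [<w', v> = 2 pi i int x d<E(x) w, v>] for all test
    functions [v]; as these are dense, [U(h) w - w - h w'] is weakly [o(h)].
    If [g] is a test function supported in [J_i], then
    [s |-> <g(. + s), U(s) k>] has therefore derivative zero as long as the
    translated support stays in [J_i], which means that [U(t)] acts as a
    translation inside [J_i].  The invariance of [D_B] is read off on the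
    spectral side: [U(t)] is unitary and commutes with [E], so it preserves the
    measure [<E(.) f, f>], whose second moment is finite exactly when [f] is in
    [D_B].  The pointwise statements follow by continuity of the absolutely
    continuous representatives, and (iii) from the group law and the boundary
    condition. *)

(** * Bounded measurable functions and elementary estimates *)

(** The hypotheses describe [E] and [U] through quadratic forms only: each vector comes with some
    measure [<E(.) f, f>], and [U t] is known by its diagonal values. The group law, unitarity and
    commutation with [E] are not given; they are recovered from polarization and from the fact that
    a sup-norm bounded linear functional vanishing on indicators is zero. About the generator one
    knows as little: the first moment gives [<A f, f>] on the domain, and the second moment decides
    membership. The bounds on [cos u - 1] and [sin u - u] are quadratic for this reason: a finite
    second moment then controls the diagonal Taylor error by a multiple of [h ^+ 2]. Polarizing that
    error needs both arguments to be test functions; against an arbitrary vector a norm bound of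
    order [h] absorbs the approximation error. Vectors are functions rather than classes, so their
    equality is tested against all vectors, and pointwise conclusions are drawn only where uniformly
    continuous representatives are compared. *)

Section BoundedMeasurable.
Context {d : measure_display} {T : measurableType d} {R : realType}.

Definition bounded_measurable (f : T -> R) : Prop :=
  measurable_fun setT f /\ exists M, forall x, `|f x| <= M.

Lemma bounded_measurable_cst (c : R) : bounded_measurable (cst c).
Proof. by split=> //; exists `|c|. Qed.

Lemma bounded_measurable_indic (A : set T) :
  measurable A -> bounded_measurable (\1_A).
Proof.
move=> mA; split; first exact: measurable_indic.
by exists 1 => x; rewrite indicE; case: (_ \in _); rewrite ?normr1 ?normr0.
Qed.

Lemma bounded_measurableD (f g : T -> R) :
  bounded_measurable f -> bounded_measurable g ->
  bounded_measurable (fun x => f x + g x).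
Proof.
move=> [mf [M hM]] [mg [N hN]]; split; first exact: measurable_funD.
by exists (M + N) => x; rewrite (le_trans (ler_normD _ _)) ?lerD.
Qed.

Lemma bounded_measurableM (f g : T -> R) :
  bounded_measurable f -> bounded_measurable g ->
  bounded_measurable (fun x => f x * g x).
Proof.
move=> [mf [M hM]] [mg [N hN]]; split; first exact: measurable_funM.
by exists (M * N) => x; rewrite normrM ler_pM.
Qed.

Lemma bounded_measurableZ (c : R) (f : T -> R) :
  bounded_measurable f -> bounded_measurable (fun x => c * f x).
Proof. exact: (bounded_measurableM (bounded_measurable_cst c)). Qed.

(** The sum counts the levels [e], [2 e], ..., [N e] that [v] reaches, so [e] times it rounds [v]
    down to a multiple of [e]. The error [e] itself occurs at [v = (N + 1) e], where no further
    level is counted. *)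
Lemma staircase_approx (e v : R) (N : nat) : 0 < e -> 0 <= v <= N.+1%:R * e ->
  0 <= v - e * \sum_(j < N) (j.+1%:R * e <= v)%R%:R <= e.
Proof.
move=> e0; elim: N => [|N IH] /andP[v0 vN].
  by rewrite big_ord0 mulr0 subr0 v0 /= (le_trans vN) ?mul1r.
rewrite big_ord_recr /=.
have [hv|hv] := leP (N.+1%:R * e) v; last first.
  by rewrite addr0 IH // v0 (ltW hv).
rewrite (eq_bigr (fun=> 1)); last first.
  move=> j _; rewrite (le_trans _ hv) ?ler_pM2r ?ler_nat //.
  by rewrite ltnS ltnW.
rewrite sumr_const card_ord natr1 mulrC subr_ge0 hv /= lerBlDr.
by rewrite (le_trans vN) // -addn1 natrD mulrDl mul1r addrC.
Qed.

(** A layer-cake sum of indicators of superlevel sets approximates a bounded function uniformly. *)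
Lemma bounded_measurable_ind (P : (T -> R) -> Prop) :
  (forall A, measurable A -> P (\1_A)) ->
  (forall c f g, bounded_measurable f -> bounded_measurable g ->
     P f -> P g -> P (fun x => c * f x + g x)) ->
  (forall f, bounded_measurable f ->
     (forall e, 0 < e -> exists2 g, bounded_measurable g /\ P g &
        forall x, `|f x - g x| <= e) -> P f) ->
  forall f, bounded_measurable f -> P f.
Proof.
move=> Pind Plin Plim f bf; apply: (Plim f bf) => e e0.
have [mf [M hM]] := bf.
(* Adding the bound [M] makes [f] nonnegative; the shift is undone below by the multiple [- M] of
   [\1_setT]. *)
pose A j := [set x | j.+1%:R * e <= f x + M].
have mA j : measurable (A j).
  rewrite -[A j]setTI; apply: (@measurable_fun_le _ T R) => //.
  exact: measurable_funD.
pose s N x := e * (\sum_(j < N) \1_(A j) x) + (- M) * \1_setT x.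
have bs N : bounded_measurable (fun x => \sum_(j < N) \1_(A j) x : R) /\
    P (fun x => \sum_(j < N) \1_(A j) x).
  elim: N => [|N [bN PN]].
    have -> : (fun x => \sum_(j < 0) \1_(A j) x) = \1_set0 :> (T -> R).
      by apply/funext => x; rewrite big_ord0 indic0.
    by split; [exact: bounded_measurable_indic|exact: Pind].
  have -> : (fun x => \sum_(j < N.+1) \1_(A j) x) =
      (fun x => 1 * \sum_(j < N) \1_(A j) x + \1_(A N) x) :> (T -> R).
    by apply/funext => x; rewrite big_ord_recr /= mul1r.
  split; last by apply: Plin => //; [exact: bounded_measurable_indic|exact: Pind].
  apply: bounded_measurableD; first exact: bounded_measurableZ.
  exact: bounded_measurable_indic.
have bT : bounded_measurable (fun x => (- M) * \1_setT x + \1_set0 x : R).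
  apply: bounded_measurableD; last exact: bounded_measurable_indic.
  by apply: bounded_measurableZ; exact: bounded_measurable_indic.
(* [f + M] takes values between [0] and [M + M], so [N] levels of height [e] exhaust it up to an
   error [e]. *)
have [N hN] : exists N : nat, M + M <= N.+1%:R * e.
  exists (Num.trunc ((M + M) / e)); rewrite -ler_pdivrMr //.
  by rewrite ltW // Num.Theory.truncnS_gt.
exists (fun x => e * (\sum_(j < N) \1_(A j) x) +
   ((- M) * \1_setT x + \1_set0 x)).
  split.
    apply: bounded_measurableD => //.
    by apply: bounded_measurableZ; have [] := bs N.
  have [bN PN] := bs N.
  apply: (Plin e) => //; apply: Plin.
  - exact: bounded_measurable_indic.
  - exact: bounded_measurable_indic.
  - exact: Pind.
  - exact: Pind.
move=> x; have := hM x; rewrite ler_norml => /andP[M1 M2].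
have := @staircase_approx e (f x + M) N e0.
rewrite -lerBlDr sub0r M1 (le_trans _ hN) ?lerD2r // => /(_ isT).
rewrite indicT indic0 /= mulr1 addr0 => /andP[h1 h2].
have -> : \sum_(j < N) \1_(A j) x = \sum_(j < N) (j.+1%:R * e <= f x + M)%R%:R :> R.
  apply: eq_bigr => j _; rewrite indicE; congr (_%:R); congr nat_of_bool.
  by apply/idP/idP; rewrite inE.
by rewrite ler_norml; apply/andP; split; lra.
Qed.

(** Continuity for the sup norm is phrased with an arbitrary pointwise bound [e], so no supremum is
    formed. *)
Definition bounded_functional (L : (T -> R) -> R) : Prop :=
  (forall c f g, bounded_measurable f -> bounded_measurable g ->
     L (fun x => c * f x + g x) = c * L f + L g) /\
  exists K, forall f e, bounded_measurable f -> 0 <= e ->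
    (forall x, `|f x| <= e) -> `|L f| <= K * e.

(** The zero set of [L] is closed under linear combinations and uniform limits. This serves as the
    uniqueness principle for signed combinations of measures: identities between integrals are
    checked on sets only. *)
Lemma bounded_functional_eq0 (L : (T -> R) -> R) : bounded_functional L ->
  (forall A, measurable A -> L (\1_A) = 0) ->
  forall f, bounded_measurable f -> L f = 0.
Proof.
move=> [Llin [K LK]] L1; apply: bounded_measurable_ind => //.
- by move=> c f g bf bg hf hg; rewrite Llin // hf hg mulr0 addr0.
move=> f bf hf; apply/eqP; rewrite -normr_le0; apply/ler_addgt0Pr => e e0.
rewrite add0r.
have K0 : 0 < `|K| + 1 by rewrite ltr_wpDl.
have [g [bg Lg] fg] := hf (e / (`|K| + 1)) (divr_gt0 e0 K0).
have bfg : bounded_measurable (fun x => -1 * g x + f x).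
  by apply: bounded_measurableD => //; exact: bounded_measurableZ.
have := LK _ (e / (`|K| + 1)) bfg; rewrite Llin // Lg mulr0 add0r.
move=> /(_ (ltW (divr_gt0 e0 K0))).
have hx x : `|-1 * g x + f x| <= e / (`|K| + 1) by rewrite mulN1r addrC.
move=> /(_ hx) /le_trans; apply.
rewrite mulrCA ler_piMr ?(ltW e0) // ler_pdivrMr // mul1r.
by rewrite (le_trans (ler_norm K)) // lerDl.
Qed.

Lemma bounded_functionalD (c : R) (L L' : (T -> R) -> R) :
  bounded_functional L -> bounded_functional L' ->
  bounded_functional (fun f => c * L f + L' f).
Proof.
move=> [Llin [K LK]] [Llin' [K' LK']]; split.
  by move=> a f g bf bg; rewrite Llin // Llin' //; ring.
exists (`|c| * K + K') => f e bf e0 fe.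
rewrite (le_trans (ler_normD _ _)) // normrM mulrDl -mulrA.
by apply: lerD; [apply: ler_wpM2l => //; exact: LK|exact: LK'].
Qed.

Variable m : {measure set T -> \bar R}.
Hypothesis finm : (m setT < +oo)%E.

Lemma bounded_measurable_integrable (f : T -> R) (A : set T) :
  measurable A -> bounded_measurable f -> m.-integrable A (EFin \o f).
Proof.
move=> mA [mf [M fM]]; apply: measurable_bounded_integrable => //.
- by rewrite (le_lt_trans _ finm) // le_measure // inE.
- exact: measurable_funS mf.
- exists M; split; first exact: num_real.
  by move=> M' /ltW MM' x _ /=; rewrite (le_trans (fM x)).
Qed.

Lemma bounded_functional_Rintegral (r : T -> R) : bounded_measurable r ->
  bounded_functional (fun f => \int[m]_x (f x * r x)).
Proof.
move=> br; have bi := bounded_measurable_integrable measurableT.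
split.
  move=> c f g bf bg.
  rewrite -RintegralZl //; last exact/bi/bounded_measurableM.
  rewrite -RintegralD //; last 2 first.
  - by apply: bi; apply: bounded_measurableZ; exact: bounded_measurableM.
  - exact/bi/bounded_measurableM.
  by apply: eq_Rintegral => x _; rewrite mulrDl mulrA.
have [_ [M rM]] := br; exists (M * fine (m setT)) => f e bf e0 fe.
have bfr : bounded_measurable (fun x => f x * r x) by exact: bounded_measurableM.
apply: (le_trans (le_normr_Rintegral measurableT (bi _ bfr))).
rewrite mulrAC [_ * e]mulrC -Rintegral_cst //; apply: le_Rintegral => //.
- apply: bi; split; last first.
    by case: bfr => _ [N hN]; exists N => x; rewrite normr_id.
  by apply: measurableT_comp => //; case: bfr.
- exact: bi (bounded_measurable_cst _).
by move=> x _; rewrite normrM ler_pM.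
Qed.

Lemma Rintegral_indicM (A : set T) (r : T -> R) : measurable A ->
  \int[m]_x (\1_A x * r x) = \int[m]_(x in A) r x.
Proof.
move=> mA; rewrite [RHS]Rintegral_mkcond; apply: eq_Rintegral => x _.
by rewrite /patch indicE; case: ifP => _; rewrite ?mul1r ?mul0r.
Qed.

Lemma Rintegral_indic (A : set T) : measurable A ->
  \int[m]_x (\1_A x) = fine (m A).
Proof.
move=> mA; rewrite -[RHS]mul1r -Rintegral_cst // -(@Rintegral_indicM A (cst 1)) //.
by apply: eq_Rintegral => x _; rewrite mulr1.
Qed.

End BoundedMeasurable.

Section RealIntegrable.
Context {d : measure_display} {T : measurableType d} {R : realType}.
Variables (m : {measure set T -> \bar R}) (D : set T).
Hypothesis mD : measurable D.
Implicit Types f g : T -> R.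

Lemma integrable_EFinZl (c : R) f : m.-integrable D (EFin \o f) ->
  m.-integrable D (EFin \o (fun x => c * f x)).
Proof.
move=> fi; have := integrableZl mD c fi; congr (_.-integrable _ _).
Qed.

Lemma integrable_EFinD f g : m.-integrable D (EFin \o f) ->
  m.-integrable D (EFin \o g) -> m.-integrable D (EFin \o (fun x => f x + g x)).
Proof.
move=> fi gi; have := integrableD mD fi gi; congr (_.-integrable _ _).
Qed.

Lemma integrable_EFinB f g : m.-integrable D (EFin \o f) ->
  m.-integrable D (EFin \o g) -> m.-integrable D (EFin \o (fun x => f x - g x)).
Proof.
move=> fi gi; have := integrableB mD fi gi; congr (_.-integrable _ _).
Qed.

End RealIntegrable.

(** * Constancy from small increments, and Taylor bounds for sine and cosine *)

Section RealDerivatives.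
Context {R : realType}.

Lemma is_derive_littleo (f : R -> R) (x l : R) :
  (forall e, 0 < e -> exists2 d, 0 < d &
     forall h, `|h| < d -> `|f (x + h) - f x - h * l| <= e * `|h|) ->
  is_derive x 1 f l.
Proof.
move=> H.
suff K : (fun h => h^-1 *: ((f \o shift x) (h *: (1 : R)) - f x)) @ 0^' --> l.
  by split; [apply/cvg_ex; exists l|exact: cvg_lim K].
apply/cvgrPdist_le => e e0; have [d d0 hd] := H e e0.
near=> h.
have h0 : h != 0 by near: h; exact: nbhs_dnbhs_neq.
have hlt : `|h| < d.
  near: h; apply: nbhs_dnbhs; near=> h; rewrite -[h]subr0 distrC.
  by near: h; exact: nbhsx_ballx.
have -> : l - h^-1 *: ((f \o shift x) (h *: (1 : R)) - f x) =
    - (h^-1 * (f (x + h) - f x - h * l)).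
  rewrite /= [h *: 1]mulr1 [h + x]addrC mulrBr mulrA mulVf // mul1r.
  by rewrite opprB.
rewrite normrN normrM normfV mulrC ler_pdivrMr ?normr_gt0 //.
exact: hd.
Unshelve. all: by end_near. Qed.

(** The derivative vanishes and the mean value theorem applies. Increments are tested only inside
    the interval, since a path of test functions is under control only there. *)
Lemma constant_of_littleo (a b : R) (f : R -> R) :
  (forall x e, a < x < b -> 0 < e -> exists2 d, 0 < d &
     forall h, `|h| < d -> a < x + h < b -> `|f (x + h) - f x| <= e * `|h|) ->
  forall x y, a < x < b -> a < y < b -> f x = f y.
Proof.
move=> H.
have D x : a < x < b -> is_derive x 1 f 0.
  move=> /andP[ax xb]; apply: is_derive_littleo => e e0.
  have [|d d0 hd] := H x e _ e0; first by rewrite ax.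
  exists (Num.min d (Num.min (x - a) (b - x))).
    by rewrite !lt_min d0 !subr_gt0 ax.
  move=> h; rewrite !lt_min ltrBrDr ltrBrDl => /andP[hd' /andP[h1 h2]].
  rewrite mulr0 subr0; apply: hd => //.
  move: h1 h2; rewrite -ltrBrDr -ltrBrDl !ltr_norml => /andP[h1 _] /andP[_ h2].
  by apply/andP; split; lra.
have W x y : a < x < b -> a < y < b -> x <= y -> f x = f y.
  move=> /andP[ax xb] /andP[ay yb] xy.
  have [z||c _ /eqP] := @MVT_segment R f (cst 0) x y xy.
  - by rewrite in_itv /= => /andP[xz zy]; apply: D; apply/andP; split; lra.
  - apply: derivable_within_continuous => z; rewrite in_itv /= => /andP[xz zy].
    by have [] : is_derive z 1 f 0 by apply: D; apply/andP; split; lra.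
  by rewrite mul0r subr_eq0 => /eqP.
move=> x y hx hy; have [xy|/ltW xy] := leP x y; first exact: W.
by rewrite (W y x).
Qed.

Lemma norm_sin_le (u : R) : `|sin u| <= `|u|.
Proof.
wlog u0 : u / 0 <= u => [hw|].
  have [u0|/ltW u0] := leP 0 u; first exact: hw.
  by rewrite -normrN -sinN -[leRHS]normrN; apply: hw; rewrite oppr_ge0.
have [|c _] := @MVT_segment R sin cos 0 u u0.
  exact/continuous_subspaceT/continuous_sin.
by rewrite sin0 !subr0 => ->; rewrite normrM ler_piMl // cos_max.
Qed.

Lemma norm_cosB1_le (u : R) : `|cos u - 1| <= u ^+ 2.
Proof.
wlog u0 : u / 0 <= u => [hw|].
  have [u0|/ltW u0] := leP 0 u; first exact: hw.
  by rewrite -cosN -sqrrN; apply: hw; rewrite oppr_ge0.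
have [|c] := @MVT_segment R cos (fun x => - sin x) 0 u u0.
  exact/continuous_subspaceT/continuous_cos.
rewrite in_itv /= => /andP[c0 cu]; rewrite cos0 subr0 => ->.
rewrite normrM normrN (ger0_norm u0) expr2 ler_wpM2r //.
by rewrite (le_trans (norm_sin_le _)) // ger0_norm.
Qed.

(** Near [0] the error is cubic, but a quadratic bound holds for all [u] and is what a finite second
    moment can integrate. *)
Lemma norm_sinB_le (u : R) : `|sin u - u| <= u ^+ 2.
Proof.
wlog u0 : u / 0 <= u => [hw|].
  have [u0|/ltW u0] := leP 0 u; first exact: hw.
  have := hw (- u); rewrite oppr_ge0 sinN sqrrN => /(_ u0).
  by rewrite -opprD normrN.
have [|c] := @MVT_segment R sin cos 0 u u0.
  exact/continuous_subspaceT/continuous_sin.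
rewrite in_itv /= => /andP[c0 cu]; rewrite sin0 !subr0 => ->.
have -> : cos c * u - u = (cos c - 1) * u by ring.
rewrite normrM (ger0_norm u0) expr2 ler_wpM2r //.
have [|e] := @MVT_segment R cos (fun x => - sin x) 0 c c0.
  exact/continuous_subspaceT/continuous_cos.
rewrite in_itv /= => /andP[e0 ec]; rewrite cos0 subr0 => ->.
by rewrite normrM normrN (ger0_norm c0) (le_trans _ cu) // ler_piMl // sin_max.
Qed.

End RealDerivatives.

(** * Pre-Hilbert spaces and spectral calculus *)

Section PreHilbert.
Context {R : realType} {H : lmodType R[i]}.

Definition inner_product (ip : H -> H -> R[i]) : Prop :=
  [/\ forall c x y z, ip (c *: x + y) z = c * ip x z + ip y z,
      forall x y, ip y x = conjc (ip x y)
    & forall x, 0 <= Re (ip x x)].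

Definition sesquilinear (a : H -> H -> R[i]) : Prop :=
  (forall c x y z, a (c *: x + y) z = c * a x z + a y z) /\
  (forall c x y z, a z (c *: x + y) = conjc c * a z x + a z y).

(** The first bracket is [a x y + a y x]; replacing [y] by ['i *: y] and multiplying by ['i] turns
    it into [a x y - a y x]. *)
Lemma polarization (a : H -> H -> R[i]) (x y : H) : sesquilinear a ->
  2 * a x y = (a (x + y) (x + y) - a x x - a y y)
    + 'i * (a (x + 'i *: y) (x + 'i *: y) - a x x - a y y).
Proof.
move=> [al ar].
have e1 u v w : a (u + v) w = a u w + a v w by rewrite -{1}[u]scale1r al mul1r.
have e2 u v w : a w (u + v) = a w u + a w v.
  rewrite -{1}[u]scale1r ar; congr (_ + _).
  by rewrite rmorph1 mul1r.
rewrite [x + 'i *: y]addrC !(al, ar, e1, e2).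
have -> : conjc 'i = - 'i :> R[i] by simpc.
have i2 : 'i * 'i = -1 :> R[i] by rewrite -expr2 sqr_i.
(* [ring] does not know that ['i * 'i] is [-1]; the products are kept visible so that [i2] can
   rewrite them. *)
transitivity ((a x y + a y x) + (- ('i * 'i) * a x y + 'i * 'i * a y x) +
   'i * (- ('i * 'i) * a y y - a y y)); last by ring.
by rewrite !i2; ring.
Qed.

(** Spectral integrals are given by their diagonal values alone; this is the passage from those
    values to the operators. *)
Lemma sesquilinear_eq (a b : H -> H -> R[i]) :
  sesquilinear a -> sesquilinear b -> (forall x, a x x = b x x) ->
  forall x y, a x y = b x y.
Proof.
move=> ha hb ab x y.
have two : (2 : R[i]) != 0 by rewrite pnatr_eq0.
by apply: (mulfI two); rewrite !polarization // !ab.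
Qed.

Variable ip : H -> H -> R[i].
Hypothesis hip : inner_product ip.

Lemma ipDZl c x y z : ip (c *: x + y) z = c * ip x z + ip y z.
Proof. by have [+ _ _] := hip; apply. Qed.

Lemma ip_conj x y : ip y x = conjc (ip x y).
Proof. by have [_ + _] := hip; apply. Qed.

Lemma ipDl x y z : ip (x + y) z = ip x z + ip y z.
Proof. by rewrite -{1}[x]scale1r ipDZl mul1r. Qed.

Lemma ip0l z : ip 0 z = 0.
Proof. by apply: (@addrI _ (ip 0 z)); rewrite -ipDl !addr0. Qed.

Lemma ipZl c x z : ip (c *: x) z = c * ip x z.
Proof. by rewrite -[c *: x]addr0 ipDZl ip0l addr0. Qed.

Lemma ipNl x z : ip (- x) z = - ip x z.
Proof. by rewrite -scaleN1r ipZl mulN1r. Qed.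

Lemma ipBl x y z : ip (x - y) z = ip x z - ip y z.
Proof. by rewrite ipDl ipNl. Qed.

Lemma ipDZr c x y z : ip z (c *: x + y) = conjc c * ip z x + ip z y.
Proof. by rewrite ip_conj ipDZl rmorphD rmorphM /= -!ip_conj. Qed.

Lemma ipDr x y z : ip z (x + y) = ip z x + ip z y.
Proof. by rewrite ip_conj ipDl rmorphD /= -!ip_conj. Qed.

Lemma ipZr c x z : ip z (c *: x) = conjc c * ip z x.
Proof. by rewrite ip_conj ipZl rmorphM /= -!ip_conj. Qed.

Lemma ipNr x z : ip z (- x) = - ip z x.
Proof. by rewrite ip_conj ipNl rmorphN /= -!ip_conj. Qed.

Lemma ipBr x y z : ip z (x - y) = ip z x - ip z y.
Proof. by rewrite ipDr ipNr. Qed.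

Definition nrm (x : H) : R := Num.sqrt (Re (ip x x)).

Lemma nrm_ge0 x : 0 <= nrm x. Proof. exact: sqrtr_ge0. Qed.

Lemma sqr_nrm x : nrm x ^+ 2 = Re (ip x x).
Proof. by rewrite sqr_sqrtr //; have [_ _ +] := hip; apply. Qed.

Lemma Re_ipC x y : Re (ip x y) = Re (ip y x).
Proof. by rewrite (ip_conj y x); case: (ip y x). Qed.

Lemma ReD (u v : R[i]) : Re (u + v) = Re u + Re v.
Proof. by case: u; case: v. Qed.

Lemma ReN (u : R[i]) : Re (- u) = - Re u.
Proof. by case: u. Qed.

Lemma ReB (u v : R[i]) : Re (u - v) = Re u - Re v.
Proof. by rewrite ReD ReN. Qed.

Lemma ImB (u v : R[i]) : Im (u - v) = Im u - Im v.
Proof. by case: u; case: v. Qed.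

Lemma ReZ (c : R) (u : R[i]) : Re (c%:C * u) = c * Re u.
Proof. by case: u => a b; simpc. Qed.

Lemma ReZc (c : R) (u : R[i]) : Re (conjc c%:C * u) = c * Re u.
Proof. by case: u => a b; simpc. Qed.

Definition Re_ipE := (ipDl, ipBl, ipNl, ipZl, ipDr, ipBr, ipNr, ipZr,
  ReD, ReB, ReN, ReZ, ReZc).

Lemma sqr_nrmD x y :
  nrm (x + y) ^+ 2 = nrm x ^+ 2 + 2 * Re (ip x y) + nrm y ^+ 2.
Proof. by rewrite !sqr_nrm !Re_ipE (Re_ipC y x); ring. Qed.

Lemma sqr_nrmB x y :
  nrm (x - y) ^+ 2 = nrm x ^+ 2 - 2 * Re (ip x y) + nrm y ^+ 2.
Proof. by rewrite !sqr_nrm !Re_ipE (Re_ipC y x); ring. Qed.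

Lemma nrmZ (c : R) x : nrm (c%:C *: x) = `|c| * nrm x.
Proof.
rewrite /nrm !Re_ipE mulrA -expr2 sqrtrM ?sqr_ge0 //.
by rewrite sqrtr_sqr.
Qed.

(** The argument has to survive a degenerate form: if [nrm y = 0], the polynomial in [t] is affine
    and nonnegative, hence constant. *)
Lemma cauchy_schwarz x y : `|Re (ip x y)| <= nrm x * nrm y.
Proof.
set b := Re (ip x y).
have key : b ^+ 2 <= nrm x ^+ 2 * nrm y ^+ 2.
  have h (t : R) : 0 <= nrm x ^+ 2 - 2 * t * b + t ^+ 2 * nrm y ^+ 2.
    have := sqr_ge0 (nrm (x - t%:C *: y)).
    rewrite sqr_nrmB nrmZ !Re_ipE exprMn real_normK ?num_real //.
    by rewrite !mulrA.
  have [y0|y0] := eqVneq (nrm y) 0; last first.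
    have yp : 0 < nrm y ^+ 2 by rewrite exprn_even_gt0.
    (* This [t] minimises the quadratic polynomial. *)
    have := h (b / nrm y ^+ 2); rewrite -(ler_pM2r yp) mul0r.
    have -> : (nrm x ^+ 2 - 2 * (b / nrm y ^+ 2) * b +
        (b / nrm y ^+ 2) ^+ 2 * nrm y ^+ 2) * nrm y ^+ 2 =
        nrm x ^+ 2 * nrm y ^+ 2 - b ^+ 2 by field.
    by rewrite subr_ge0.
  rewrite y0 expr0n /= mulr0 in h *.
  have [->|b0] := eqVneq b 0; first by rewrite expr0n.
  (* At this [t] the affine polynomial takes the value [-1]. *)
  have := h ((nrm x ^+ 2 + 1) / (2 * b)).
  have -> : nrm x ^+ 2 - 2 * ((nrm x ^+ 2 + 1) / (2 * b)) * b +
    ((nrm x ^+ 2 + 1) / (2 * b)) ^+ 2 * 0 = - 1 by field.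
  by rewrite oppr_ge0 ler10.
rewrite -(@ler_pXn2r _ 2) ?nnegrE ?mulr_ge0 ?nrm_ge0 //.
by rewrite real_normK ?num_real // exprMn.
Qed.

Lemma nrmD x y : nrm (x + y) <= nrm x + nrm y.
Proof.
rewrite -(@ler_pXn2r _ 2) ?nnegrE ?addr_ge0 ?nrm_ge0 //.
have := le_trans (ler_norm _) (cauchy_schwarz x y).
by rewrite sqr_nrmD; lra.
Qed.

Lemma nrmN x : nrm (- x) = nrm x.
Proof. by rewrite /nrm !Re_ipE opprK. Qed.

Lemma nrmB x y : nrm (x - y) <= nrm x + nrm y.
Proof. by rewrite (le_trans (nrmD _ _)) // nrmN. Qed.

(* [ip] may be degenerate: vectors are representatives of classes, and weak
   equality is equality of the classes. *)
Definition weakly_equal (x y : H) : Prop := forall z, ip x z = ip y z.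

Lemma nrm_weakly_equal x y : weakly_equal x y -> nrm (x - y) = 0.
Proof.
by move=> h; rewrite /nrm ipBl h -ipBl subrr ip0l /= sqrtr0.
Qed.

Definition weakly_linear (T : H -> H) : Prop :=
  forall c x y, weakly_equal (T (c *: x + y)) (c *: T x + T y).

Definition weakly_compatible (T : H -> H) : Prop :=
  forall x y, weakly_equal x y -> weakly_equal (T x) (T y).

Lemma weakly_linear_sesqui (S T : H -> H) :
  weakly_linear S -> weakly_linear T ->
  sesquilinear (fun x y => ip (S x) (T y)).
Proof.
move=> hS hT; split=> c x y z; first by rewrite hS ipDZl.
by rewrite ip_conj hT ipDZl rmorphD rmorphM /= -!ip_conj.
Qed.

Lemma weakly_linear_id : weakly_linear id.
Proof. by move=> c x y z. Qed.

Lemma weakly_linear_comp S T : weakly_linear S -> weakly_linear T ->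
  weakly_compatible S -> weakly_linear (S \o T).
Proof. by move=> lS lT cS c x y z /=; rewrite (cS _ _ (lT c x y)) lS. Qed.

Lemma weakly_linear0 T : weakly_linear T -> weakly_equal (T 0) 0.
Proof.
move=> lT z; have := lT (-1) 0 0 z.
by rewrite scaler0 addr0 ipDZl mulN1r addNr => ->; rewrite ip0l.
Qed.

End PreHilbert.

(** * Bounded functional calculus from diagonal measures *)

Section SpectralCalculus.
Context {R : realType} {H : lmodType R[i]}.
Variable ip : H -> H -> R[i].
Hypothesis hip : inner_product ip.
Variable E : set R -> H -> H.
Hypothesis E_linear : forall S : set (measurableTypeR R),
  measurable S -> weakly_linear ip (E S).
Hypothesis E_adj : forall (S : set (measurableTypeR R)) x y,
  measurable S -> ip (E S x) y = ip x (E S y).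
Hypothesis E_setI : forall (S S' : set (measurableTypeR R)) x,
  measurable S -> measurable S' ->
  weakly_equal ip (E S (E S' x)) (E (S `&` S') x).
Hypothesis E_setT : forall x, weakly_equal ip (E setT x) x.
Hypothesis E_set0 : forall x, weakly_equal ip (E set0 x) 0.
Variable m : H -> {measure set (measurableTypeR R) -> \bar R}.
Hypothesis mE : forall x S, measurable S -> m x S = (Re (ip (E S x) x))%:E.

Local Notation mT := (measurableTypeR R).
Implicit Types (x y z : H) (A : set mT).

Lemma diag_fin x : (m x setT < +oo)%E.
Proof. by rewrite mE // ltry. Qed.

(** [mE] gives the real part only; the imaginary part vanishes because [E A] is symmetric. *)
Lemma ip_Ediag x A : measurable A -> ip (E A x) x = (fine (m x A))%:C.
Proof.
move=> mA; rewrite mE //=; have := ip_conj hip (E A x) x.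
rewrite -E_adj //; case: (ip (E A x) x) => a b /= [] /eqP.
by rewrite -subr_eq0 opprK -mulr2n mulrn_eq0 /= => /eqP ->.
Qed.

Lemma diag_setT x : fine (m x setT) = nrm ip x ^+ 2.
Proof. by rewrite sqr_nrm // mE //= E_setT. Qed.

Lemma diag_E x (S A : set mT) : measurable S -> measurable A ->
  m (E S x) A = m x (A `&` S).
Proof.
move=> mS mA; have mAS : measurable (A `&` S) by exact: measurableI.
rewrite !mE //; congr (_%:E).
rewrite E_setI // -E_adj // E_setI //.
by congr (Re (ip (E _ _) _)); rewrite setIC -setIA setIid.
Qed.

Definition bounded_cmeasurable (phi : R -> R[i]) : Prop :=
  bounded_measurable (fun x : mT => Re (phi x)) /\
  bounded_measurable (fun x : mT => Im (phi x)).

(** One fixed family [m] replaces the measures that [spectral_integral] supplies separately for each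
    operator and vector. *)
Definition spectral_op (phi : R -> R[i]) (T : H -> H) : Prop :=
  [/\ weakly_linear ip T, weakly_compatible ip T, bounded_cmeasurable phi &
      forall x, ip (T x) x = cintegral (m x) setT phi].

(** On sets this is [diag_E]; the uniqueness principle carries it over to bounded functions. *)
Lemma Rintegral_E x (S : set mT) (f : mT -> R) : measurable S -> bounded_measurable f ->
  \int[m (E S x)]_y f y = \int[m x]_(y in S) f y.
Proof.
move=> mS bf; rewrite -[RHS]Rintegral_indicM //.
have b1 : bounded_measurable (cst 1 : mT -> R) by exact: bounded_measurable_cst.
have bS : bounded_measurable (\1_S : mT -> R) by exact: bounded_measurable_indic.
have L1 := bounded_functional_Rintegral (diag_fin (E S x)) b1.
have L2 := bounded_functional_Rintegral (diag_fin x) bS.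
have e1 (g : mT -> R) : \int[m (E S x)]_y (g y * cst 1 y) = \int[m (E S x)]_y g y.
  by apply: eq_Rintegral => y _; rewrite mulr1.
have e2 (g : mT -> R) : \int[m x]_y (g y * \1_S y) = \int[m x]_y (\1_S y * g y).
  by apply: eq_Rintegral => y _; rewrite mulrC.
have h := bounded_functional_eq0 (bounded_functionalD (-1) L2 L1).
have {h} : -1 * \int[m x]_y (f y * \1_S y) + \int[m (E S x)]_y (f y * cst 1 y) = 0.
  apply: h => // A mA; rewrite e1 Rintegral_indic // diag_E //.
  rewrite -Rintegral_indic; last exact: measurableI.
  by rewrite indicI mulN1r addNr.
by rewrite e1 e2 mulN1r addrC => /eqP; rewrite subr_eq0 => /eqP.
Qed.

Lemma spectral_op_split phi T x (S : set mT) : spectral_op phi T -> measurable S ->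
  ip (T x) x = ip (T (E S x)) (E S x) + ip (T (E (~` S) x)) (E (~` S) x).
Proof.
move=> [_ _ [bR bI] hT] mS; have mC := measurableC mS.
have key (f : mT -> R) : bounded_measurable f -> \int[m x]_y f y =
    \int[m (E S x)]_y f y + \int[m (E (~` S) x)]_y f y.
  move=> bf; rewrite !Rintegral_E // -Rintegral_setU ?setUv //.
    by apply: bounded_measurable_integrable bf => //; exact: diag_fin.
  by apply/disj_set2P; rewrite setICr.
by rewrite !hT /cintegral !key.
Qed.

(* The diagonal measure splits as the sum of those of [E S x] and [E (~` S) x];
   polarizing the resulting splitting of the quadratic form shows that [T] is
   block diagonal. *)
Lemma spectral_op_comm phi T (S : set mT) x y : spectral_op phi T -> measurable S ->
  ip (T (E S x)) y = ip (T x) (E S y).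
Proof.
move=> sT mS; have [lT cT _ _] := sT; have mC := measurableC mS.
have lE := E_linear mS; have lC := E_linear mC.
have key u v : ip (T u) v =
    ip (T (E S u)) (E S v) + ip (T (E (~` S) u)) (E (~` S) v).
  apply: (sesquilinear_eq (a := fun u v => ip (T u) v)
    (b := fun u v => ip (T (E S u)) (E S v) + ip (T (E (~` S) u)) (E (~` S) v))).
  - exact: weakly_linear_sesqui lT (weakly_linear_id _).
  - have [a1 a2] := weakly_linear_sesqui hip (weakly_linear_comp lT lE cT) lE.
    have [b1 b2] := weakly_linear_sesqui hip (weakly_linear_comp lT lC cT) lC.
    split=> c p q r /=.
      by have /= -> := a1 c p q r; have /= -> := b1 c p q r; ring.
    by have /= -> := a2 c p q r; have /= -> := b2 c p q r; ring.
  - by move=> w /=; rewrite (spectral_op_split _ sT mS).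
have T0 u : weakly_equal ip u 0 -> weakly_equal ip (T u) 0.
  by move=> u0 z; rewrite (cT _ _ u0) weakly_linear0.
have CE u : weakly_equal ip (E (~` S) (E S u)) 0.
  by move=> z; rewrite E_setI // setICl E_set0.
have EE u : weakly_equal ip (E S (E S u)) (E S u).
  by move=> z; rewrite E_setI // setIid.
(* On both sides the term of the complement contains a projection of [E S x] or [E S y] onto it and
   vanishes; what remains is [ip (T (E S x)) (E S y)] twice. *)
rewrite key (T0 _ (CE x)) ip0l // addr0 (cT _ _ (EE x)).
rewrite [RHS]key [X in _ = _ + X](ip_conj hip) CE ip0l // rmorph0 addr0.
by rewrite [RHS](ip_conj hip) EE -(ip_conj hip).
Qed.

(* By polarization and [spectral_op_comm], [psi] is the density with respect to
   [m x] of a linear combination of the positive measures attached to [T x],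
   [x], [T x + x] and [T x + 'i *: x]; then [phi] is integrated against it. *)
Lemma spectral_op_mul phi psi (S T : H -> H) x : spectral_op phi S -> spectral_op psi T ->
  ip (S (T x)) x = cintegral (m x) setT (fun r => phi r * psi r).
Proof.
move=> sS sT; have [lS cS [pR pI] hS] := sS; have [lT cT [qR qI] hT] := sT.
set g := T x.
(* The complex measure [A |-> ip (E A g) x] has density [psi] with respect to [m x], since [E A] can
   be moved through [T]. *)
have ET A : measurable A -> ip (E A g) x =
    (\int[m x]_(y in A) Re (psi y)) +i* (\int[m x]_(y in A) Im (psi y)).
  move=> mA; rewrite E_adj // -(spectral_op_comm _ _ sT mA).
  have EE : weakly_equal ip (E A (E A x)) (E A x).
    by move=> z; rewrite E_setI // setIid.
  rewrite -(cT _ _ EE) (spectral_op_comm _ _ sT mA) hT /cintegral.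
  by rewrite !Rintegral_E.
(* Carries a density [2 r] of the signed measure [m u - m g - m x] over from sets to bounded
   functions. It is used with [u = g + x] for the real part of [psi] and [u = g + 'i *: x] for the
   imaginary part. *)
have key (u : H) (r : mT -> R) : bounded_measurable r ->
    (forall A, measurable A -> fine (m u A) - fine (m g A) - fine (m x A) =
       2 * \int[m x]_(y in A) r y) ->
    forall f : mT -> R, bounded_measurable f ->
    \int[m u]_y f y - \int[m g]_y f y - \int[m x]_y f y =
      2 * \int[m x]_y (f y * r y).
  move=> br hA f bf.
  have b1 : bounded_measurable (cst 1 : mT -> R) by exact: bounded_measurable_cst.
  have bF v := bounded_functional_Rintegral (diag_fin v) b1.
  have bG := bounded_functional_Rintegral (diag_fin x) br.
  have := bounded_functional_eq0
     (bounded_functionalD (-2) bG (bounded_functionalD (-1) (bF x)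
     (bounded_functionalD (-1) (bF g) (bF u)))) _ bf.
  have e v (p : mT -> R) : \int[m v]_y (p y * cst 1 y) = \int[m v]_y p y.
    by apply: eq_Rintegral => y _; rewrite mulr1.
  rewrite !e => h; apply/eqP; rewrite -subr_eq0 -[X in _ == X]h.
    by apply/eqP; ring.
  move=> A mA; rewrite !e !Rintegral_indic // Rintegral_indicM //.
  by have := hA A mA; lra.
have pol A : measurable A -> 2 * ip (E A g) x =
    (fine (m (g + x) A) - fine (m g A) - fine (m x A))%:C +
    'i * (fine (m (g + 'i *: x) A) - fine (m g A) - fine (m x A))%:C.
  move=> mA; rewrite (@polarization _ _ (fun u v => ip (E A u) v)).
    by rewrite !ip_Ediag // !rmorphB.
  exact: weakly_linear_sesqui (E_linear mA) (weakly_linear_id _).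
have two : (2 : R[i]) != 0 by rewrite pnatr_eq0.
apply: (mulfI two).
rewrite (@polarization _ _ (fun u v => ip (S u) v)); last first.
  exact: weakly_linear_sesqui lS (weakly_linear_id _).
rewrite !hS /cintegral.
have twoE : (2 : R[i]) = (2 : R)%:C by rewrite rmorph_nat.
have kR := key (g + x) _ qR; have kI := key (g + 'i *: x) _ qI.
have aR A : measurable A -> fine (m (g + x) A) - fine (m g A) - fine (m x A) =
    2 * \int[m x]_(y in A) Re (psi y).
  move=> mA; have := congr1 (@Re R) (pol A mA); rewrite ET // twoE ReZ /= => ->.
  ring.
have aI A : measurable A ->
    fine (m (g + 'i *: x) A) - fine (m g A) - fine (m x A) =
    2 * \int[m x]_(y in A) Im (psi y).
  move=> mA; have := congr1 (@Im R) (pol A mA); rewrite ET // twoE.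
  by simpc => /= ->.
have kR1 := kR aR _ pR; have kR2 := kR aR _ pI.
have kI1 := kI aI _ pR; have kI2 := kI aI _ pI.
have bi f : bounded_measurable f -> (m x).-integrable setT (EFin \o f).
  by apply: bounded_measurable_integrable => //; exact: diag_fin.
have -> : \int[m x]_y Re (phi y * psi y) =
    \int[m x]_y (Re (phi y) * Re (psi y)) - \int[m x]_y (Im (phi y) * Im (psi y)).
  rewrite -RintegralB //; [|exact/bi/bounded_measurableM..].
  by apply: eq_Rintegral => y _; case: (phi y) => a b; case: (psi y).
have -> : \int[m x]_y Im (phi y * psi y) =
    \int[m x]_y (Re (phi y) * Im (psi y)) + \int[m x]_y (Im (phi y) * Re (psi y)).
  rewrite -RintegralD //; [|exact/bi/bounded_measurableM..].
  by apply: eq_Rintegral => y _; case: (phi y) => a b; case: (psi y).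
rewrite twoE; simpc; apply/eqP; rewrite eq_complex /=; apply/andP; split; apply/eqP.
  by move: kR1 kI2; lra.
by move: kR2 kI1; lra.
Qed.

(** * The unitary group and its first-order expansion *)

Definition unit_exp (t x : R) : R[i] :=
  (cos (2 * pi * t * x)) +i* (sin (2 * pi * t * x)).

Lemma bounded_cmeasurable_exp t : bounded_cmeasurable (unit_exp t).
Proof.
have lin : measurable_fun setT (fun x : mT => 2 * pi * t * x).
  exact: measurable_funM.
split; split.
- apply: (@measurableT_comp _ _ _ _ _ _ (@cos R)) => //.
  by apply: continuous_measurable_fun; exact: continuous_cos.
- by exists 1 => x; exact: cos_max.
- apply: (@measurableT_comp _ _ _ _ _ _ (@sin R)) => //.
  by apply: continuous_measurable_fun; exact: continuous_sin.
- by exists 1 => x; exact: sin_max.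
Qed.

Variable U : R -> H -> H.
Hypothesis hU : forall t, spectral_op (unit_exp t) (U t).

Lemma U_linear t : weakly_linear ip (U t).
Proof. by have [] := hU t. Qed.

Lemma U_compat t : weakly_compatible ip (U t).
Proof. by have [] := hU t. Qed.

Lemma U_diag t x : ip (U t x) x = cintegral (m x) setT (unit_exp t).
Proof. by have [] := hU t. Qed.

(** [spectral_op_mul] makes the diagonal of the composition the integral of
    [unit_exp s * unit_exp t]; the addition formulas identify the product. *)
Lemma U_add s t x : weakly_equal ip (U s (U t x)) (U (s + t) x).
Proof.
move=> y.
apply: (sesquilinear_eq (a := fun x y => ip (U s (U t x)) y)
  (b := fun x y => ip (U (s + t) x) y)) => [||z].
- apply: (weakly_linear_sesqui hip (S := U s \o U t)).
    exact: weakly_linear_comp (U_linear s) (U_linear t) (U_compat s).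
  exact: weakly_linear_id.
- exact: weakly_linear_sesqui (U_linear _) (weakly_linear_id _).
rewrite (spectral_op_mul _ (hU s) (hU t)) U_diag; congr cintegral.
apply/funext => r; rewrite /unit_exp.
have -> : 2 * pi * (s + t) * r = 2 * pi * s * r + 2 * pi * t * r by ring.
by rewrite cosD sinD; simpc; congr (_ +i* _); ring.
Qed.

Lemma U_0 x : weakly_equal ip (U 0 x) x.
Proof.
move=> y.
apply: (sesquilinear_eq (a := fun x y => ip (U 0 x) y)
  (b := fun x y => ip x y)) => [||z].
- exact: weakly_linear_sesqui (U_linear _) (weakly_linear_id _).
- exact: weakly_linear_sesqui (weakly_linear_id _) (weakly_linear_id _).
rewrite U_diag -[RHS]E_setT ip_Ediag // /cintegral.
have -> : (fun r => Re (unit_exp 0 r)) = cst 1.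
  by apply/funext => r; rewrite /= mulr0 mul0r cos0.
have -> : (fun r => Im (unit_exp 0 r)) = cst 0.
  by apply/funext => r; rewrite /= mulr0 mul0r sin0.
by rewrite !Rintegral_cst // mul1r mul0r.
Qed.

Lemma diag_integrable x (f : mT -> R) :
  bounded_measurable f -> (m x).-integrable setT (EFin \o f).
Proof. by apply: bounded_measurable_integrable => //; exact: diag_fin. Qed.

(** Conjugating a diagonal value replaces [unit_exp t] by [unit_exp (- t)]. *)
Lemma U_adj t x y : ip (U t x) y = ip x (U (- t) y).
Proof.
apply: (sesquilinear_eq (a := fun x y => ip (U t x) y)
  (b := fun x y => ip x (U (- t) y))) => [||z].
- exact: weakly_linear_sesqui (U_linear _) (weakly_linear_id _).
- exact: weakly_linear_sesqui (weakly_linear_id _) (U_linear _).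
rewrite [RHS](ip_conj hip) !U_diag /cintegral /=; apply/eqP.
rewrite eq_complex /=; apply/andP; split; apply/eqP.
  by apply: eq_Rintegral => r _; rewrite mulrN mulNr cosN.
have [_ bI] := bounded_cmeasurable_exp (- t).
rewrite -mulN1r -RintegralZl //; last exact: diag_integrable bI.
by apply: eq_Rintegral => r _; rewrite mulN1r mulrN mulNr sinN opprK.
Qed.

Lemma U_iso t x y : ip (U t x) (U t y) = ip x y.
Proof.
rewrite U_adj (ip_conj hip) (U_add (- t) t y) addNr U_0.
by rewrite -(ip_conj hip).
Qed.

Lemma diag_U t x A : measurable A -> m (U t x) A = m x A.
Proof.
move=> mA; rewrite !mE // E_adj // -(spectral_op_comm _ _ (hU t) mA) U_iso.
by [].
Qed.

Lemma nrm_U t x : nrm ip (U t x) = nrm ip x.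
Proof. by rewrite /nrm U_iso. Qed.

(** An infinite integral yields the default value [0], so this number is meaningful only together
    with [finite_second_moment]. *)
Definition second_moment x : R := \int[m x]_r (r ^+ 2).

Definition finite_second_moment x : Prop :=
  (\int[m x]_r (r ^+ 2)%:E < +oo)%E.

Lemma second_moment_ge0 x : 0 <= second_moment x.
Proof. by apply: Rintegral_ge0 => r _; exact: sqr_ge0. Qed.

Lemma integrable_sqr x : finite_second_moment x ->
  (m x).-integrable setT (EFin \o (fun r : mT => r ^+ 2)).
Proof.
move=> fx; apply/integrableP; split.
  by apply/measurable_EFinP; exact: measurable_funX.
by under eq_integral do rewrite /= ger0_norm ?sqr_ge0 //.
Qed.

Lemma integrable_lin x : finite_second_moment x ->
  (m x).-integrable setT (EFin \o (fun r : mT => r)).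
Proof.
move=> fx; have i2 := integrable_sqr fx.
have i1 : (m x).-integrable setT (EFin \o (cst 1 : mT -> R)).
  exact: diag_integrable (bounded_measurable_cst _).
apply: le_integrable (integrableD measurableT i1 i2) => //.
  exact/measurable_EFinP.
move=> r _; rewrite /= lee_fin [leRHS]ger0_norm ?addr_ge0 ?sqr_ge0 //.
by rewrite ler_norml; apply/andP; split; nra.
Qed.

Lemma le_Rintegral_sqr x c (f : mT -> R) : finite_second_moment x ->
  (m x).-integrable setT (EFin \o f) ->
  (forall r, `|f r| <= (c * r) ^+ 2) ->
  `|\int[m x]_r f r| <= c ^+ 2 * second_moment x.
Proof.
move=> fx fi hf; have i2 := integrable_sqr fx.
rewrite -RintegralZl // (le_trans (le_normr_Rintegral _ fi)) //.
apply: le_Rintegral => //.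
- exact: integrable_norm.
- exact: integrable_EFinZl.
by move=> r _; rewrite -exprMn.
Qed.

(** By unitarity the squared norm is the integral of [2 * (1 - cos (2 * pi * h * r))] against
    [m x]. *)
Lemma U_sub_nrm h x : finite_second_moment x ->
  nrm ip (U h x - x) <= 2 * pi * `|h| * Num.sqrt (2 * second_moment x).
Proof.
move=> fx.
have c0 : 0 <= 2 * pi * `|h| by rewrite !mulr_ge0 ?pi_ge0.
rewrite -(@ler_pXn2r _ 2) ?nnegrE ?mulr_ge0 ?nrm_ge0 ?sqrtr_ge0 ?pi_ge0 //.
rewrite exprMn [in leRHS]sqr_sqrtr ?mulr_ge0 ?second_moment_ge0 //.
rewrite (sqr_nrmB hip) nrm_U U_diag /= -diag_setT.
have [[mC bC] _] := bounded_cmeasurable_exp h.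
have := @le_Rintegral_sqr x (2 * pi * h) (fun r => cos (2 * pi * h * r) - 1) fx.
have i1 : (m x).-integrable setT (EFin \o (cst 1 : mT -> R)).
  exact: diag_integrable (bounded_measurable_cst _).
have iC : (m x).-integrable setT (EFin \o (fun r : mT => cos (2 * pi * h * r))).
  exact: diag_integrable (conj mC bC).
rewrite RintegralB // Rintegral_cst // mul1r.
have ii : (m x).-integrable setT (EFin \o (fun r : mT => cos (2 * pi * h * r) - 1)).
  exact: integrable_EFinB.
move=> /(_ ii (fun r => norm_cosB1_le _)); rewrite ler_norml => /andP[h1 _].
rewrite exprMn real_normK ?num_real // -exprMn.
by move: h1; lra.
Qed.

Lemma U_taylor_diag h x : finite_second_moment x ->
  `|Re (ip (U h x) x) - nrm ip x ^+ 2| <= (2 * pi * h) ^+ 2 * second_moment x /\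
  `|Im (ip (U h x) x) - h * (2 * pi * \int[m x]_r r)| <=
      (2 * pi * h) ^+ 2 * second_moment x.
Proof.
move=> fx; have [bC bS] := bounded_cmeasurable_exp h.
have iC := diag_integrable x bC; have iS := diag_integrable x bS.
have i1 : (m x).-integrable setT (EFin \o (cst 1 : mT -> R)).
  exact: diag_integrable (bounded_measurable_cst _).
have iL := integrable_lin fx.
rewrite U_diag /= -diag_setT.
split.
  rewrite -[fine _]mul1r -Rintegral_cst // -RintegralB //.
  apply: le_Rintegral_sqr => //; first exact: integrable_EFinB.
  by move=> r; exact: norm_cosB1_le.
have iZ : (m x).-integrable setT (EFin \o (fun r : mT => (2 * pi * h) * r)).
  exact: integrable_EFinZl.
have -> : h * (2 * pi * \int[m x]_r r) = \int[m x]_r ((2 * pi * h) * r).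
  by rewrite RintegralZl //; ring.
rewrite -RintegralB //.
apply: le_Rintegral_sqr => //; first exact: integrable_EFinB.
by move=> r; exact: norm_sinB_le.
Qed.

(** [G] abstracts the pairs of a test function and its derivative. [G_form] expresses on the
    diagonal that [dx] is [2 pi i] times the generator at [x]. *)
Variable G : H -> H -> Prop.
Hypothesis G_linear : forall c x dx y dy,
  G x dx -> G y dy -> G (c *: x + y) (c *: dx + dy).
Hypothesis G_moment : forall x dx, G x dx -> finite_second_moment x.
Hypothesis G_form : forall x dx, G x dx ->
  ip dx x = 'i * (2 * pi * \int[m x]_r r)%:C.
Hypothesis G_dense : forall z e, 0 < e ->
  exists x dx, G x dx /\ nrm ip (z - x) <= e.

(** By [G_form] the number [ip dx x] is purely imaginary: it cancels the linear term of the sine,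
    while [ip x x] cancels the constant term of the cosine. *)
Lemma U_taylor_form h x dx : G x dx ->
  `|Re (ip (U h x - x - h%:C *: dx) x)| <= (2 * pi * h) ^+ 2 * second_moment x /\
  `|Im (ip (U h x - x - h%:C *: dx) x)| <= (2 * pi * h) ^+ 2 * second_moment x.
Proof.
move=> Gx; have [] := U_taylor_diag h (G_moment Gx).
rewrite !(ipBl hip) !(ipZl hip) (G_form Gx) sqr_nrm //.
have -> : ip x x = (Re (ip x x))%:C.
  apply/eqP; rewrite eq_complex /= eqxx /=.
  have := ip_conj hip x x; case: (ip x x) => a b [] /= /eqP.
  by rewrite -subr_eq0 opprK -mulr2n mulrn_eq0.
case: (ip (U h x) x) => a b /= h1 h2; split.
  by move: h1; rewrite !(mul0r, mulr0, subr0, addr0, oppr0).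
by move: h2; rewrite !(mul0r, mulr0, subr0, addr0, add0r, oppr0, mul1r).
Qed.

(* The error form is sesquilinear in pairs (x, dx), so it can be polarized
   although dx need not depend on x through a globally defined operator. *)
Lemma U_taylor_weak x dx y dy : G x dx -> G y dy ->
  exists2 C, 0 <= C & forall h,
    `|Re (ip (U h x - x - h%:C *: dx) y)| <= C * h ^+ 2.
Proof.
move=> Gx Gy.
have Gxy : G (x + y) (dx + dy).
  by have := G_linear 1 Gx Gy; rewrite !scale1r.
have Gxiy : G (x + 'i *: y) (dx + 'i *: dy).
  by rewrite addrC [dx + _]addrC; exact: G_linear.
pose V := second_moment.
(* The moments of [x] and [y] count twice because both brackets of the polarization identity contain
   them. *)
exists ((2 * pi) ^+ 2 * (V (x + y) + V (x + 'i *: y) + 2 * V x + 2 * V y)).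
  rewrite mulr_ge0 ?sqr_ge0 // !addr_ge0 ?second_moment_ge0 //;
    by rewrite mulr_ge0 // second_moment_ge0.
move=> h.
pose b (p q : (H * H)%type) := ip (U h p.1 - p.1 - h%:C *: p.2) q.1.
have sb : sesquilinear b.
  split=> c p q r; rewrite /b /=; last by rewrite ipDZr.
  rewrite !(ipBl hip) !(ipZl hip) !(ipDl hip) !(ipZl hip) (U_linear h c _ _ _).
  by rewrite (ipDZl hip); ring.
have := polarization (x, dx) (y, dy) sb; rewrite /b /=.
have [r1 _] := U_taylor_form h Gxy.
have [_ r2] := U_taylor_form h Gxiy.
have [r3 i3] := U_taylor_form h Gx.
have [r4 i4] := U_taylor_form h Gy.
(* The bracket multiplied by ['i] contributes minus its imaginary part, hence the mixture of real
   and imaginary estimates. *)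
move/(congr1 (@Re R)).
have -> : (2 : R[i]) = (2 : R)%:C by rewrite rmorph_nat.
rewrite ReZ ReD 2!ReB ['i * _]mulrC ReiNIm.
move: r1 r2 r3 i3 r4 i4.
rewrite -/(V (x + y)) -/(V (x + 'i *: y)) -/(V x) -/(V y) !exprMn.
have Imsub (u v : R[i]) : Im (u - v) = Im u - Im v by case: u; case: v.
rewrite 2!Imsub !ler_norml.
set a1 := Re (ip _ (x + y)); set a2 := Im (ip _ (x + 'i *: y)).
set a3 := Re (ip _ x); set a4 := Im (ip _ x); set a5 := Re (ip (U h y - _ - _) y).
set a6 := Im (ip (U h y - _ - _) y).
set a7 := Re (ip _ y).
set c := 2 ^+ 2 * pi ^+ 2; set k := h ^+ 2.
move=> /andP[? ?] /andP[? ?] /andP[? ?] /andP[? ?] /andP[? ?] /andP[? ?] ?.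
have kc : 0 <= c * k * V x /\ 0 <= c * k * V y /\ 0 <= c * k * V (x + y) /\
   0 <= c * k * V (x + 'i *: y).
  by rewrite /c /k -!exprMn; do ?split; rewrite mulr_ge0 ?sqr_ge0 ?second_moment_ge0.
by apply/andP; split; lra.
Qed.

(** Only of order [h], but independent of the vector paired with; it pays for replacing an arbitrary
    vector by a nearby test vector. *)
Lemma U_sub_nrm_form h x dx : G x dx -> nrm ip (U h x - x - h%:C *: dx) <=
  (2 * pi * Num.sqrt (2 * second_moment x) + nrm ip dx) * `|h|.
Proof.
move=> Gx; rewrite (le_trans (nrmB hip _ _)) // nrmZ // mulrDl lerD //.
  by rewrite (le_trans (U_sub_nrm _ (G_moment Gx))) // -!mulrA (mulrC `|h|).
by rewrite mulrC.
Qed.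

Lemma U_derivative x dx z e : G x dx -> 0 < e ->
  exists2 d, 0 < d & forall h, `|h| < d ->
    `|Re (ip (U h x - x - h%:C *: dx) z)| <= e * `|h|.
Proof.
move=> Gx e0.
set L := 2 * pi * Num.sqrt (2 * second_moment x) + nrm ip dx.
have L0 : 0 <= L.
  by rewrite addr_ge0 ?nrm_ge0 // !mulr_ge0 ?pi_ge0 ?sqrtr_ge0.
have L1 : 0 < L + 1 by lra.
(* With this accuracy the bound [L * |h|] for the error contributes at most half of [e * |h|]. *)
have [y [dy [Gy hy]]] := G_dense z (divr_gt0 (divr_gt0 e0 (ltr0Sn _ 1)) L1).
have [C C0 hC] := U_taylor_weak Gx Gy.
have C1 : 0 < C + 1 by lra.
(* Below this radius [C * h ^+ 2] is at most the other half. *)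
exists (e / 2 / (C + 1)); first by rewrite !divr_gt0.
move=> h; rewrite ltr_pdivlMr // => hh.
have -> : z = y + (z - y) by rewrite addrC subrK.
rewrite (ipDr hip) ReD (le_trans (ler_normD _ _)) //.
have -> : e * `|h| = e / 2 * `|h| + e / 2 * `|h| by field.
apply: lerD.
  rewrite (le_trans (hC h)) // -real_normK ?num_real // expr2 mulrA.
  apply: ler_wpM2r => //; rewrite mulrC (le_trans _ (ltW hh)) //.
  by apply: ler_wpM2l => //; lra.
rewrite (le_trans (cauchy_schwarz hip _ _)) //.
rewrite (le_trans (ler_pM (nrm_ge0 _ _) (nrm_ge0 _ _) (U_sub_nrm_form h Gx) hy)) //.
rewrite -/L mulrAC; apply: ler_wpM2r => //.
rewrite mulrA ler_pdivrMr // mulrC.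
by apply: ler_wpM2l; [lra|lra].
Qed.

Lemma nrm_U_sub s h x : nrm ip (U (s + h) x - U s x) = nrm ip (U h x - x).
Proof.
have /eqP := nrm_U s (U h x - x); rewrite eq_sym => /eqP ->.
have e : weakly_equal ip (U s (U h x - x)) (U (s + h) x - U s x).
  move=> z; have := U_linear s (-1) x (U h x) z.
  rewrite scaleN1r addrC => ->.
  by rewrite !(ipDl hip, ipNl hip, ipZl hip) U_add mulN1r addrC.
by rewrite /nrm [in RHS]e [in RHS](ip_conj hip) [in RHS]e -(ip_conj hip).
Qed.

Section Path.
(** The same [dg s] is the velocity of the path ([g_taylor]) and the image of [g s] under [2 pi i]
    times the generator ([G_path]), as for the translates of a test function. *)
Variables (g dg : R -> H) (a b K : R).
Hypothesis G_path : forall s, a < s < b -> G (g s) (dg s).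
Hypothesis dg_bounded : forall s, a < s < b -> nrm ip (dg s) <= K.
Hypothesis g_taylor : forall s h, a < s < b -> a < s + h < b ->
  nrm ip (g (s + h) - g s - h%:C *: dg s) <= K * h ^+ 2.

(** For [k] with a finite second moment [U s k] is Lipschitz in [s], which controls the term in
    which both factors move. *)
Lemma path_pairing_constant_form s t k dk : G k dk ->
  a < s < b -> a < t < b ->
  Re (ip (g s) (U s k)) = Re (ip (g t) (U t k)).
Proof.
move=> Gk; apply: (constant_of_littleo (f := fun s => Re (ip (g s) (U s k)))).
move=> {}s e sab e0.
have K0 : 0 <= K by rewrite (le_trans (nrm_ge0 _ _) (dg_bounded sab)).
have [d d0 hd] := U_derivative (U s k) (G_path sab) (divr_gt0 e0 (ltr0Sn _ 1)).
set M := nrm ip k; set N := 2 * pi * Num.sqrt (2 * second_moment k).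
have M0 : 0 <= M by exact: nrm_ge0.
have N0 : 0 <= N by rewrite !mulr_ge0 ?pi_ge0 ?sqrtr_ge0.
have P0 : 0 < K * M + K * N + 1.
  by rewrite ltr_wpDl // addr_ge0 // mulr_ge0.
exists (Num.min d (e / 2 / (K * M + K * N + 1))).
  by rewrite lt_min d0 /= !divr_gt0.
move=> h; rewrite lt_min => /andP[hd1]; rewrite ltr_pdivlMr // => hd2 shab.
(* The increment of time is moved to the first factor, where the generator acts at time [- h]. *)
have Uadj : Re (ip (g s) (U (s + h) k)) = Re (ip (U (- h) (g s)) (U s k)).
  by rewrite U_adj opprK [RHS]Re_ipC // U_add addrC Re_ipC.
(* The first-order term of the path and that of the generator cancel; the first two summands are
   quadratic in [h], the third is [o(h)]. *)
have split3 : Re (ip (g (s + h)) (U (s + h) k)) - Re (ip (g s) (U s k)) =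
    Re (ip (g (s + h) - g s - h%:C *: dg s) (U (s + h) k)) +
    h * Re (ip (dg s) (U (s + h) k - U s k)) +
    Re (ip (U (- h) (g s) - g s - (- h)%:C *: dg s) (U s k)).
  rewrite !(ipBl hip, ipZl hip, ipBr hip) !ReB !ReZ.
  by rewrite -Uadj; ring.
have b1 : `|Re (ip (g (s + h) - g s - h%:C *: dg s) (U (s + h) k))| <=
    K * M * h ^+ 2.
  rewrite (le_trans (cauchy_schwarz hip _ _)) // nrm_U mulrAC.
  by rewrite ler_wpM2r // g_taylor.
have b2 : `|h * Re (ip (dg s) (U (s + h) k - U s k))| <= K * N * h ^+ 2.
  rewrite normrM -[h ^+ 2]real_normK ?num_real // mulrC expr2 mulrA.
  rewrite ler_wpM2r // (le_trans (cauchy_schwarz hip _ _)) //.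
  rewrite nrm_U_sub -mulrA ler_pM ?nrm_ge0 ?dg_bounded //.
  by rewrite (le_trans (U_sub_nrm _ (G_moment Gk))) // /N -!mulrA (mulrC `|h|).
have b3 : `|Re (ip (U (- h) (g s) - g s - (- h)%:C *: dg s) (U s k))| <=
    e / 2 * `|h|.
  by rewrite -[`|h|]normrN; apply: hd; rewrite normrN.
have b4 : (K * M + K * N) * h ^+ 2 <= e / 2 * `|h|.
  rewrite -real_normK ?num_real // expr2 mulrA ler_wpM2r //.
  rewrite mulrC (le_trans _ (ltW hd2)) //.
  by apply: ler_wpM2l => //; lra.
rewrite split3 (le_trans (ler_normD _ _)) //.
rewrite (le_trans (lerD (ler_normD _ _) (lexx _))) //.
by move: b1 b2 b3 b4; lra.
Qed.

(** [U s] is isometric, so the pairing at both times is continuous in [k], and density removes the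
    restriction on [k]. *)
Lemma path_pairing_constant s t k : a < s < b -> a < t < b ->
  ip (g s) (U s k) = ip (g t) (U t k).
Proof.
move=> sab tab.
have key z : Re (ip (g s) (U s z)) = Re (ip (g t) (U t z)).
  apply/eqP; rewrite -subr_eq0 -normr_le0; apply/ler_addgt0Pr => e e0.
  rewrite add0r; set M := nrm ip (g s) + nrm ip (g t).
  have M1 : 0 < M + 1 by rewrite ltr_wpDl // addr_ge0 // nrm_ge0.
  have [y [dy [Gy hy]]] := G_dense z (divr_gt0 e0 M1).
  have H1 r : Re (ip (g r) (U r z)) =
      Re (ip (g r) (U r y)) + Re (ip (g r) (U r (z - y))).
    rewrite !(Re_ipC hip (g r)) -ReD -(ipDl hip).
    have := U_linear r 1 y (z - y) (g r).
    by rewrite !scale1r addrC subrK => ->.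
  rewrite (H1 s) (H1 t) (path_pairing_constant_form Gy sab tab).
  rewrite opprD addrACA subrr add0r (le_trans (ler_normB _ _)) //.
  have H2 r : `|Re (ip (g r) (U r (z - y)))| <= nrm ip (g r) * (e / (M + 1)).
    rewrite (le_trans (cauchy_schwarz hip _ _)) // nrm_U.
    by rewrite ler_wpM2l // nrm_ge0.
  rewrite (le_trans (lerD (H2 _) (H2 _))) // -mulrDl -/M mulrA.
  by rewrite ler_pdivrMr // mulrC ler_wpM2l ?(ltW e0) //; lra.
(* The identity of real parts for ['i *: k] is the identity of imaginary parts for [k]. *)
apply/eqP; rewrite eq_complex key eqxx /=.
have := key ('i *: k).
have e r : ip (g r) (U r ('i *: k)) = - 'i * ip (g r) (U r k).
  rewrite (ip_conj hip); have := U_linear r 'i k 0 (g r).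
  rewrite addr0 => ->; rewrite (ipDl hip) (weakly_linear0 hip (U_linear r)).
  rewrite (ip0l hip) addr0 (ipZl hip) rmorphM /= -(ip_conj hip).
  by congr (_ * _); simpc.
rewrite !e; case: (ip (g s) _) => p q; case: (ip (g t) _) => p' q' /=.
by rewrite !(mul0r, oppr0, mulN1r, mulNr, opprK, add0r, mul1r) => ->.
Qed.

End Path.

End SpectralCalculus.

(** * The space of square integrable functions *)

Section RealL2.
Context {R : realType}.
Local Notation mT := (measurableTypeR R).
Local Notation mu := (@lebesgue_measure R).
Variable W : set mT.
Hypothesis mW : measurable W.
Implicit Types u v w : mT -> R.

Definition square_integrable u : Prop :=
  measurable_fun W u /\ mu.-integrable W (EFin \o (fun x => u x ^+ 2)).

Lemma square_integrable_le u v : measurable_fun W u -> square_integrable v ->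
  (forall x, W x -> `|u x| <= `|v x|) -> square_integrable u.
Proof.
move=> mu_ [mv iv] uv; split=> //.
apply: (le_integrable mW _ _ iv).
  by apply/measurable_EFinP; exact: measurable_funX.
move=> x Wx; rewrite /= lee_fin !normrX.
by rewrite lerXn2r ?nnegrE ?normr_ge0 // uv.
Qed.

Lemma integrableM_square_integrable u v :
  square_integrable u -> square_integrable v ->
  mu.-integrable W (EFin \o (fun x => u x * v x)).
Proof.
move=> [mu_ iu] [mv iv].
apply: (le_integrable mW _ _ (integrable_EFinD mW iu iv)).
  by apply/measurable_EFinP; exact: measurable_funM.
move=> x Wx; rewrite /= lee_fin [leRHS]ger0_norm ?addr_ge0 ?sqr_ge0 //.
by rewrite ler_norml; apply/andP; split; nra.
Qed.

Lemma square_integrableD u v : square_integrable u -> square_integrable v ->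
  square_integrable (fun x => u x + v x).
Proof.
move=> hu hv; have iuv := integrableM_square_integrable hu hv.
have [mu_ iu] := hu; have [mv iv] := hv; split; first exact: measurable_funD.
have := integrable_EFinD mW (integrable_EFinD mW iu iv) (integrable_EFinZl mW 2 iuv).
by apply: eq_integrable => // x _ /=; congr (_%:E); ring.
Qed.

Lemma square_integrableZ c u : square_integrable u ->
  square_integrable (fun x => c * u x).
Proof.
move=> [mu_ iu]; split; first exact: measurable_funM.
have := integrable_EFinZl mW (c ^+ 2) iu.
by apply: eq_integrable => // x _ /=; rewrite exprMn.
Qed.

Lemma square_integrable0 : square_integrable (fun=> 0).
Proof.
split; first exact: measurable_cst.
have -> : EFin \o (fun x : mT => (0 : R) ^+ 2) = cst 0%E.
  by apply/funext => x /=; rewrite expr0n.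
exact: integrable0.
Qed.

Definition pairing u v : R := \int[mu]_(x in W) (u x * v x).

Lemma pairingC u v : pairing u v = pairing v u.
Proof. by apply: eq_Rintegral => x _; rewrite mulrC. Qed.

Lemma pairingDl c u v w : square_integrable u -> square_integrable v ->
  square_integrable w ->
  pairing (fun x => c * u x + v x) w = c * pairing u w + pairing v w.
Proof.
move=> hu hv hw; have iu := integrableM_square_integrable hu hw.
have iv := integrableM_square_integrable hv hw.
rewrite /pairing -RintegralZl // -RintegralD //; last exact: integrable_EFinZl.
by apply: eq_Rintegral => x _; ring.
Qed.

Lemma pairing_ge0 u : 0 <= pairing u u.
Proof. by apply: Rintegral_ge0 => x _; rewrite -expr2 sqr_ge0. Qed.

Lemma pairing_ae u v w : square_integrable u -> square_integrable v ->
  square_integrable w -> ae_eq mu W u v -> pairing u w = pairing v w.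
Proof.
move=> hu hv hw uv; rewrite /pairing /Rintegral; congr fine.
apply: ae_eq_integral => //.
- by apply/measurable_EFinP/measurable_funM; [case: hu|case: hw].
- by apply/measurable_EFinP/measurable_funM; [case: hv|case: hw].
- by apply: filterS uv => x /[apply] ->.
Qed.

Lemma pairing_eq0 u : square_integrable u -> pairing u u = 0 ->
  ae_eq mu W u (cst 0).
Proof.
move=> hu; have [mu_ iu] := hu; rewrite /pairing /Rintegral.
have iuu := integrableM_square_integrable hu hu.
move=> h; have h0 : (\int[mu]_(x in W) (u x * u x)%:E = 0)%E.
  by rewrite -[LHS]fineK ?h //; exact: integrable_fin_num.
have : ae_eq mu W (EFin \o (fun x => u x * u x)) (cst 0).
  apply/ae_eq_integral_abs => //; first by case/integrableP: iuu.
  rewrite -[RHS]h0; apply: eq_integral => x _ /=.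
  by rewrite ger0_norm // -expr2 sqr_ge0.
apply: filterS => x /[apply] /= [[]] /eqP.
by rewrite mulf_eq0 orbb => /eqP.
Qed.

End RealL2.

Section ComplexL2.
Context {R : realType}.
Local Notation mT := (measurableTypeR R).
Local Notation mu := (@lebesgue_measure R).
Variable W : set mT.
Hypothesis mW : measurable W.
Implicit Types f g h : R -> R[i].

Lemma sqr_normc (z : R[i]) : Normc.normc z ^+ 2 = Re z ^+ 2 + Im z ^+ 2.
Proof. by case: z => a b /=; rewrite sqr_sqrtr // addr_ge0 ?sqr_ge0. Qed.

Lemma L2P f : L2 W f <-> square_integrable W (fun x : mT => Re (f x)) /\
   square_integrable W (fun x : mT => Im (f x)).
Proof.
split=> [[[mR mI] fin]|[[mR iR] [mI iI]]].
  have i2 : mu.-integrable W (EFin \o (fun x : mT => Normc.normc (f x) ^+ 2)).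
    apply/integrableP; split.
      have -> : (fun x : mT => Normc.normc (f x) ^+ 2) =
          (fun x : mT => Re (f x) ^+ 2 + Im (f x) ^+ 2).
        by apply/funext => x; exact: sqr_normc.
      by apply/measurable_EFinP/measurable_funD; exact: measurable_funX.
    by under eq_integral do rewrite /= ger0_norm ?sqr_ge0 //.
  split; split=> //; apply: (le_integrable mW _ _ i2);
    do ?by apply/measurable_EFinP; exact: measurable_funX.
    move=> x _; rewrite /= lee_fin !ger0_norm ?sqr_ge0 // sqr_normc.
    by rewrite lerDl sqr_ge0.
  move=> x _; rewrite /= lee_fin !ger0_norm ?sqr_ge0 // sqr_normc.
  by rewrite lerDr sqr_ge0.
split=> //; rewrite /sqnormL2.
have /integrableP[_] := integrable_EFinD mW iR iI.
under eq_integral do rewrite /= ger0_norm ?addr_ge0 ?sqr_ge0 //.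
by under [in X in _ -> X]eq_integral do rewrite sqr_normc.
Qed.

Lemma L2Z c f : L2 W f -> L2 W (fun x => c * f x).
Proof.
move=> /L2P[hR hI]; apply/L2P; case: c => a b.
have e1 : (fun x : mT => Re ((a +i* b) * f x)) =
    (fun x : mT => a * Re (f x) + (- b) * Im (f x)).
  by apply/funext => x; case: (f x) => p q /=; rewrite mulNr.
have e2 : (fun x : mT => Im ((a +i* b) * f x)) =
    (fun x : mT => a * Im (f x) + b * Re (f x)).
  by apply/funext => x; case: (f x) => p q /=.
by rewrite e1 e2; split; apply: square_integrableD => //;
  exact: square_integrableZ.
Qed.

Lemma L2D f g : L2 W f -> L2 W g -> L2 W (fun x => f x + g x).
Proof.
move=> /L2P[fR fI] /L2P[gR gI]; apply/L2P.
have e1 : (fun x : mT => Re (f x + g x)) = (fun x : mT => Re (f x) + Re (g x)).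
  by apply/funext => x; rewrite ReD.
have e2 : (fun x : mT => Im (f x + g x)) = (fun x : mT => Im (f x) + Im (g x)).
  by apply/funext => x; case: (f x); case: (g x).
by rewrite e1 e2; split; exact: square_integrableD.
Qed.

Lemma L2_0 : L2 W (fun=> 0).
Proof. by apply/L2P; split; exact: square_integrable0. Qed.

Lemma ipL2E f g : L2 W f -> L2 W g ->
  ipL2 W f g =
   (pairing W (fun x : mT => Re (f x)) (fun x : mT => Re (g x)) +
    pairing W (fun x : mT => Im (f x)) (fun x : mT => Im (g x))) +i*
   (pairing W (fun x : mT => Im (f x)) (fun x : mT => Re (g x)) -
    pairing W (fun x : mT => Re (f x)) (fun x : mT => Im (g x))).
Proof.
move=> /L2P[fR fI] /L2P[gR gI]; rewrite /ipL2 /cintegral /pairing.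
have iM := integrableM_square_integrable mW.
congr (_ +i* _).
  rewrite -RintegralD //; [|exact: iM..].
  apply: eq_Rintegral => x _.
  by case: (f x) => a b; case: (g x) => c e /=; ring.
rewrite -RintegralB //; [|exact: iM..].
apply: eq_Rintegral => x _.
by case: (f x) => a b; case: (g x) => c e /=; ring.
Qed.

Definition L2_pred : {pred (R -> R[i])} := fun f => `[< L2 W f >].

Lemma L2_predP f : reflect (L2 W f) (f \in L2_pred).
Proof. exact: asboolP. Qed.

Lemma L2_submod_closed : submod_closed L2_pred.
Proof.
split; first by apply/L2_predP; exact: L2_0.
move=> c f g /L2_predP Lf /L2_predP Lg; apply/L2_predP.
by apply: L2D => //; exact: L2Z.
Qed.

End ComplexL2.

Section L2Space.
Context {R : realType}.
Local Notation mT := (measurableTypeR R).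
Local Notation mu := (@lebesgue_measure R).
Variables (W : set mT) (mW : measurable W).

(* The phantom argument lets canonical structure inference find the proof that
   W is measurable, on which the linear structure depends. *)
Record L2_space (mW0 : measurable W) :=
  L2Space { L2val :> R -> R[i]; L2valP : L2val \in L2_pred W }.
Local Notation H := (L2_space mW).

HB.instance Definition _ := [isSub for @L2val mW].
HB.instance Definition _ := [Choice of H by <:].
HB.instance Definition _ :=
  GRing.isSubmodClosed.Build _ _ (L2_pred W) (L2_submod_closed mW).
HB.instance Definition _ := [SubChoice_isSubLmodule of H by <:].

Implicit Types x y z : H.

Lemma L2_space_L2 x : L2 W x.
Proof. by have /L2_predP := L2valP x. Qed.

Definition mkL2 f (Lf : L2 W f) : H :=
  L2Space mW (introT (L2_predP W f) Lf).

Definition L2_ip x y : R[i] := ipL2 W x y.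

Lemma ip_inner_product : inner_product L2_ip.
Proof.
split=> [c x y z|x y|x].
- have Lx := L2_space_L2 x; have Ly := L2_space_L2 y; have Lz := L2_space_L2 z.
  have -> : L2_ip (c *: x + y) z = ipL2 W (fun r => c * x r + y r) z by [].
  rewrite /L2_ip !ipL2E //; last by apply: L2D => //; exact: L2Z.
  have [xR xI] := (L2P mW x).1 Lx; have [yR yI] := (L2P mW y).1 Ly.
  have [zR zI] := (L2P mW z).1 Lz.
  case: c => a b.
  have zl w (Lw : square_integrable W w) : pairing W (fun=> 0) w = 0.
    rewrite /pairing (_ : (fun _ => _) = cst 0) ?Rintegral_cst ?mul0r //.
    by apply/funext => r; rewrite mul0r.
  have e1 : (fun r : mT => Re ((a +i* b) * x r + y r)) =
    (fun r => a * Re (x r) + ((- b) * Im (x r) + Re (y r))).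
    by apply/funext => r; case: (x r) => p q; case: (y r) => ? ? /=; ring.
  have e2 : (fun r : mT => Im ((a +i* b) * x r + y r)) =
    (fun r => a * Im (x r) + (b * Re (x r) + Im (y r))).
    by apply/funext => r; case: (x r) => p q; case: (y r) => ? ? /=; ring.
  have sb u v k : square_integrable W u -> square_integrable W v ->
      square_integrable W (fun r => k * u r + v r).
    by move=> hu hv; apply: square_integrableD => //; exact: square_integrableZ.
  rewrite e1 e2 !pairingDl //; do ?[exact: sb].
  by simpc; congr (_ +i* _); ring.
- have Lx := L2_space_L2 x; have Ly := L2_space_L2 y.
  rewrite /L2_ip !ipL2E //= !(pairingC _ (fun r : mT => _ (y r))).
  by rewrite opprB.
- have Lx := L2_space_L2 x.
  by rewrite /L2_ip ipL2E //= addr_ge0 // pairing_ge0.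
Qed.

(** Testing against [x - y] itself shows that its norm is zero, hence both of its components vanish
    almost everywhere. *)
Lemma ip_eqL2 x y : weakly_equal L2_ip x y <-> eqL2 W x y.
Proof.
have [xR xI] := (L2P mW x).1 (L2_space_L2 x).
have [yR yI] := (L2P mW y).1 (L2_space_L2 y).
split=> [xy|xy z].
  have := nrm_weakly_equal ip_inner_product xy.
  set w := x - y; have Lw := L2_space_L2 w.
  have [wR wI] := (L2P mW w).1 Lw.
  move=> /eqP; rewrite sqrtr_eq0 /L2_ip ipL2E //= => h.
  have p1 := pairing_ge0 W (fun r : mT => Re (w r)).
  have p2 := pairing_ge0 W (fun r : mT => Im (w r)).
  have h1 : pairing W (fun r : mT => Re (w r)) (fun r : mT => Re (w r)) = 0 by lra.
  have h2 : pairing W (fun r : mT => Im (w r)) (fun r : mT => Im (w r)) = 0 by lra.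
  have a1 := pairing_eq0 mW wR h1; have a2 := pairing_eq0 mW wI h2.
  apply: filterS2 a1 a2 => r k1 k2 Wr.
  have {}k1 : Re (x r - y r) = 0 := k1 Wr.
  have {}k2 : Im (x r - y r) = 0 := k2 Wr.
  by apply/eqP; rewrite -subr_eq0 eq_complex k1 k2 !eqxx.
have [zR zI] := (L2P mW z).1 (L2_space_L2 z).
have aR : ae_eq mu W (fun r : mT => Re (x r)) (fun r : mT => Re (y r)).
  by apply: filterS xy => r /[apply] ->.
have aI : ae_eq mu W (fun r : mT => Im (x r)) (fun r : mT => Im (y r)).
  by apply: filterS xy => r /[apply] ->.
rewrite /L2_ip !ipL2E //; do ?[exact: L2_space_L2].
by rewrite (pairing_ae mW xR yR zR aR) (pairing_ae mW xR yR zI aR)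
  (pairing_ae mW xI yI zR aI) (pairing_ae mW xI yI zI aI).
Qed.

(** Outside [L2] the value defaults to [0]; a bounded operator never meets this case. *)
Definition lift_op (T : (R -> R[i]) -> R -> R[i]) x : H :=
  insubd (0 : H) (T x).

Lemma lift_opE (T : (R -> R[i]) -> R -> R[i]) x :
  L2 W (T x) -> lift_op T x = T x :> (R -> R[i]).
Proof.
move=> LT; rewrite /lift_op insubdK //; exact/(L2_predP W).
Qed.

Variable T : (R -> R[i]) -> R -> R[i].
Hypothesis bT : bounded_operator W T.

Lemma bounded_operator_lift x : lift_op T x = T x :> (R -> R[i]).
Proof. by have [h _ _ _] := bT; apply/lift_opE/h/L2_space_L2. Qed.

Lemma lift_op_linear : weakly_linear L2_ip (lift_op T).
Proof.
have [hL _ hlin _] := bT.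
move=> c x y; apply/ip_eqL2; rewrite bounded_operator_lift.
have := hlin c x y (L2_space_L2 x) (L2_space_L2 y).
by apply: filterS => r /[apply] /= ->; rewrite -!bounded_operator_lift.
Qed.

Lemma lift_op_compat : weakly_compatible L2_ip (lift_op T).
Proof.
have [hL hc _ _] := bT.
move=> x y /ip_eqL2 xy; apply/ip_eqL2; rewrite !bounded_operator_lift.
by apply: hc => //; exact: L2_space_L2.
Qed.

End L2Space.

(** * Splines and their density *)

Section SplineFunctions.
Context {R : realType}.
Implicit Types (u du v dv : R -> R) (a b x h K : R).

(** Taylor's inequality stands for a Lipschitz derivative. A single [K], shared by all translates,
    gives estimates uniform along a translation path. *)
Definition C11 K u du : Prop := forall x,
  [/\ `|u x| <= K, `|du x| <= K &
      forall h, `|u (x + h) - u x - h * du x| <= K * h ^+ 2].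

Lemma C11_linear c K K' u du v dv : C11 K u du -> C11 K' v dv ->
  C11 (`|c| * K + K') (fun x => c * u x + v x) (fun x => c * du x + dv x).
Proof.
move=> hu hv x; have [u1 u2 u3] := hu x; have [v1 v2 v3] := hv x.
have le p q : `|p| <= K -> `|q| <= K' -> `|c * p + q| <= `|c| * K + K'.
  move=> hp hq; rewrite (le_trans (ler_normD _ _)) // normrM.
  by rewrite lerD // ler_wpM2l.
split; [exact: le|exact: le|move=> h].
have -> : c * u (x + h) + v (x + h) - (c * u x + v x) - h * (c * du x + dv x) =
  c * (u (x + h) - u x - h * du x) + (v (x + h) - v x - h * dv x) by ring.
rewrite (le_trans (ler_normD _ _)) // normrM mulrDl -mulrA.
by rewrite lerD // ler_wpM2l.
Qed.

Lemma C11_0 : C11 0 (fun=> 0) (fun=> 0).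
Proof. by move=> x; split=> [||h]; rewrite ?normr0 // mulr0 !subrr normr0 mul0r. Qed.

Lemma C11_ge0 K u du : C11 K u du -> 0 <= K.
Proof. by move=> /(_ 0)[h _ _]; rewrite (le_trans _ h). Qed.

Lemma C11_shift K u du s : C11 K u du ->
  C11 K (fun x => u (x + s)) (fun x => du (x + s)).
Proof. by move=> hu x; have [u1 u2 u3] := hu (x + s); split=> // h; rewrite [x + h + s]addrAC. Qed.

Lemma C11_is_derive K u du x : C11 K u du -> is_derive x 1 u (du x).
Proof.
move=> hu; have [_ _ u3] := hu x; have K0 := C11_ge0 hu.
apply: is_derive_littleo => e e0; exists (e / (K + 1)); first by rewrite divr_gt0 // ltr_wpDl.
move=> h; rewrite ltr_pdivlMr ?ltr_wpDl // => hh.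
rewrite (le_trans (u3 h)) // -real_normK ?num_real // expr2 mulrA.
by apply: ler_wpM2r => //; nra.
Qed.

(** Taylor's inequality serves for increments up to [1]; beyond that the sup bound [2 * K] is
    enough. *)
Lemma C11_lipschitz K u du x y : C11 K u du ->
  `|u y - u x| <= 2 * K * `|y - x|.
Proof.
move=> hu; have K0 := C11_ge0 hu; have [u1 u2 u3] := hu x; have [v1 _ _] := hu y.
have [h1|h1] := leP `|y - x| 1; last first.
  by rewrite (le_trans (ler_normB _ _)) //; nra.
have -> : u y - u x = (u (x + (y - x)) - u x - (y - x) * du x) + (y - x) * du x.
  by rewrite [x + _]addrC subrK subrK.
rewrite (le_trans (ler_normD _ _)) // normrM.
have := u3 (y - x); rewrite -[(y - x) ^+ 2]real_normK ?num_real // => k.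
have k2 : `|y - x| * `|du x| <= `|y - x| * K by rewrite ler_wpM2l.
have k3 : K * `|y - x| ^+ 2 <= K * `|y - x|.
  by rewrite ler_wpM2l // expr2 ler_piMl.
by lra.
Qed.

Lemma C11_continuous K u du : C11 K u du -> continuous u.
Proof.
move=> hu x; apply: differentiable_continuous; apply/derivable1_diffP.
by have [] := C11_is_derive x hu.
Qed.

(** Adding the Taylor inequalities from [x] to [x + h] and back bounds [h] times the increment of
    [du] by [2 * K * h ^+ 2]. *)
Lemma C11_deriv_lipschitz K u du x h : C11 K u du ->
  `|du (x + h) - du x| <= 2 * K * `|h|.
Proof.
move=> hu; have K0 := C11_ge0 hu; have [_ _ u3] := hu x; have [_ _ v3] := hu (x + h).
have [->|h0] := eqVneq h 0; first by rewrite addr0 subrr !normr0 mulr0.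
rewrite -(@ler_pM2r _ `|h|) ?normr_gt0 // -normrM.
have := u3 h; have := v3 (- h); rewrite addrK sqrrN => a1 a2.
have -> : (du (x + h) - du x) * h = (u x - u (x + h) - - h * du (x + h)) +
   (u (x + h) - u x - h * du x) by ring.
rewrite (le_trans (ler_normD _ _)) //.
have -> : 2 * K * `|h| * `|h| = 2 * (K * h ^+ 2).
  by rewrite -[h ^+ 2]real_normK ?num_real //; ring.
by lra.
Qed.

Lemma C11_deriv_continuous K u du : C11 K u du -> continuous du.
Proof.
move=> hu x; have K0 := C11_ge0 hu; apply/cvgrPdist_le => e e0.
have d0 : 0 < e / (2 * K + 1) by rewrite divr_gt0 // ltr_wpDl // mulr_ge0.
near=> y; have -> : y = x + (y - x) by rewrite addrC subrK.
rewrite distrC (le_trans (C11_deriv_lipschitz _ _ hu)) //.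
have : `|y - x| < e / (2 * K + 1).
  near: y; exists (e / (2 * K + 1)) => //= y.
  by rewrite distrC.
rewrite ltr_pdivlMr ?ltr_wpDl ?mulr_ge0 // => hh.
have := normr_ge0 (y - x).
by nra.
Unshelve. all: by end_near. Qed.

Definition ramp x : R := Num.max 0 x.

Lemma ramp_cases x : (0 <= x /\ ramp x = x) \/ (x <= 0 /\ ramp x = 0).
Proof.
rewrite /ramp; have [x0|x0] := leP 0 x; [left|right]; split=> //.
exact: ltW.
Qed.

Lemma ramp_taylor x h :
  `|ramp (x + h) ^+ 2 - ramp x ^+ 2 - h * (2 * ramp x)| <= h ^+ 2.
Proof.
have [[p1 ->]|[p1 ->]] := ramp_cases (x + h);
have [[p2 ->]|[p2 ->]] := ramp_cases x;
  rewrite ler_norml; apply/andP; split; nra.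
Qed.

(* The quadratic B-spline primitive: a C^{1,1} transition from 0 to 1 over
   [0, 2d]. *)
Definition smoothstep (d x : R) : R :=
  (ramp x ^+ 2 - 2 * ramp (x - d) ^+ 2 + ramp (x - 2 * d) ^+ 2) / (2 * d ^+ 2).

Definition smoothstep' (d x : R) : R :=
  (ramp x - 2 * ramp (x - d) + ramp (x - 2 * d)) / d ^+ 2.

Lemma smoothstep_le0 d x : 0 < d -> x <= 0 -> smoothstep d x = 0.
Proof.
move=> d0 x0; rewrite /smoothstep.
have [[p1 ->]|[p1 ->]] := ramp_cases x;
have [[p2 ->]|[p2 ->]] := ramp_cases (x - d);
have [[p3 ->]|[p3 ->]] := ramp_cases (x - 2 * d); try lra.
  have -> : x = 0 by lra.
  by rewrite expr0n /= mulr0 !subr0 addr0 mul0r.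
Qed.

Lemma smoothstep_ge d x : 0 < d -> 2 * d <= x -> smoothstep d x = 1.
Proof.
move=> d0 x0; rewrite /smoothstep.
have [[p1 ->]|[p1 ->]] := ramp_cases x;
have [[p2 ->]|[p2 ->]] := ramp_cases (x - d);
have [[p3 ->]|[p3 ->]] := ramp_cases (x - 2 * d); try lra.
  by field; lra.
have -> : x = 2 * d by lra.
by field; lra.
Qed.

Lemma smoothstep_itv d x : 0 < d -> 0 <= smoothstep d x <= 1.
Proof.
move=> d0; rewrite /smoothstep.
have dd : 0 < 2 * d ^+ 2 by rewrite mulr_gt0 // exprn_gt0.
rewrite divr_ge0 ?(ltW dd) ?ler_pdivrMr ?mul1r //=.
  have [[p1 ->]|[p1 ->]] := ramp_cases x;
  have [[p2 ->]|[p2 ->]] := ramp_cases (x - d);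
  have [[p3 ->]|[p3 ->]] := ramp_cases (x - 2 * d); nra.
have [[p1 ->]|[p1 ->]] := ramp_cases x;
have [[p2 ->]|[p2 ->]] := ramp_cases (x - d);
have [[p3 ->]|[p3 ->]] := ramp_cases (x - 2 * d); nra.
Qed.

Lemma smoothstep'_itv d x : 0 < d -> `|smoothstep' d x| <= d^-1.
Proof.
move=> d0; rewrite /smoothstep' normrM normfV.
have dd : 0 < d ^+ 2 by rewrite exprn_gt0.
rewrite (gtr0_norm dd) ler_pdivrMr // expr2 mulrA mulVf ?gt_eqF // mul1r.
have [[p1 ->]|[p1 ->]] := ramp_cases x;
have [[p2 ->]|[p2 ->]] := ramp_cases (x - d);
have [[p3 ->]|[p3 ->]] := ramp_cases (x - 2 * d);
  rewrite ler_norml; apply/andP; split; lra.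
Qed.

Lemma smoothstep_C11 d : 0 < d ->
  exists K, C11 K (smoothstep d) (smoothstep' d).
Proof.
move=> d0; have dd : 0 < 2 * d ^+ 2 by rewrite mulr_gt0 // exprn_gt0.
(* The summands bound the function, its derivative and the Taylor remainder; [4 = 1 + 2 + 1] adds
   the coefficients of the three ramps. *)
exists (1 + d^-1 + 4 / (2 * d ^+ 2)) => x.
have i0 : 0 < d^-1 by rewrite invr_gt0.
have i1 : 0 <= 4 / (2 * d ^+ 2) by rewrite divr_ge0 // ltW.
split.
- have /andP[s0 s1] := smoothstep_itv x d0.
  by rewrite ger0_norm //; lra.
- by rewrite (le_trans (smoothstep'_itv x d0)) //; lra.
move=> h; rewrite /smoothstep /smoothstep'.
set r0 := ramp (x + h); set r1 := ramp (x + h - d); set r2 := ramp (x + h - 2 * d).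
have t0 := ramp_taylor x h; rewrite -/r0 in t0.
have t1 := ramp_taylor (x - d) h; rewrite [x - d + h]addrAC -/r1 in t1.
have t2 := ramp_taylor (x - 2 * d) h; rewrite [x - 2 * d + h]addrAC -/r2 in t2.
set q0 := ramp x in t0 *; set q1 := ramp (x - d) in t1 *.
set q2 := ramp (x - 2 * d) in t2 *.
have -> : (r0 ^+ 2 - 2 * r1 ^+ 2 + r2 ^+ 2) / (2 * d ^+ 2) -
    (q0 ^+ 2 - 2 * q1 ^+ 2 + q2 ^+ 2) / (2 * d ^+ 2) -
    h * ((q0 - 2 * q1 + q2) / d ^+ 2) =
  ((r0 ^+ 2 - q0 ^+ 2 - h * (2 * q0)) - 2 * (r1 ^+ 2 - q1 ^+ 2 - h * (2 * q1)) +
   (r2 ^+ 2 - q2 ^+ 2 - h * (2 * q2))) / (2 * d ^+ 2).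
  by field; rewrite gt_eqF.
rewrite normrM normfV (gtr0_norm dd).
have T : `|(r0 ^+ 2 - q0 ^+ 2 - h * (2 * q0)) -
    2 * (r1 ^+ 2 - q1 ^+ 2 - h * (2 * q1)) +
    (r2 ^+ 2 - q2 ^+ 2 - h * (2 * q2))| <= 4 * h ^+ 2.
  move: t0 t1 t2; rewrite !ler_norml.
  by move=> /andP[? ?] /andP[? ?] /andP[? ?]; apply/andP; split; lra.
apply: (@le_trans _ _ (4 / (2 * d ^+ 2) * h ^+ 2)).
  by rewrite mulrAC ler_wpM2r // invr_ge0 ltW.
by rewrite ler_wpM2r ?sqr_ge0 //; lra.
Qed.

(** The margin [e] keeps the support away from the end points, so that the translations which keep
    it inside form an open set. *)
Definition bump_function a b v dv : Prop :=
  (exists K, C11 K v dv) /\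
  exists2 e, 0 < e & forall x, x < a + e \/ b - e < x -> v x = 0.

Lemma bump_function_linear c a b u du v dv :
  bump_function a b u du -> bump_function a b v dv ->
  bump_function a b (fun x => c * u x + v x) (fun x => c * du x + dv x).
Proof.
move=> [[K uK] [e e0 ue]] [[K' vK] [e' e'0 ve]]; split.
  by exists (`|c| * K + K'); exact: C11_linear.
exists (Num.min e e'); first by rewrite lt_min e0.
have m1 : Num.min e e' <= e by rewrite ge_min lexx.
have m2 : Num.min e e' <= e' by rewrite ge_min lexx orbT.
move=> x hx; rewrite ue ?ve ?mulr0 ?addr0 //.
  by case: hx => hx; [left|right]; lra.
by case: hx => hx; [left|right]; lra.
Qed.

Lemma bump_function0 a b : bump_function a b (fun=> 0) (fun=> 0).
Proof. by split; [exists 0; exact: C11_0|exists 1]. Qed.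

Lemma bump_function_sub a b a' b' v dv : a <= a' -> b' <= b ->
  bump_function a' b' v dv -> bump_function a b v dv.
Proof.
move=> aa bb [Kv [e e0 ve]]; split=> //; exists e => // x hx; apply: ve.
by case: hx => hx; [left|right]; lra.
Qed.

(** Two steps of width [2 * d]: up on [[a + d, a + 3 * d]], down on [[b - 3 * d, b - d]]. They do
    not overlap when [6 * d <= b - a], and a margin [d] is left at both ends. *)
Definition bump d a b x : R :=
  smoothstep d (x - (a + d)) - smoothstep d (x - (b - 3 * d)).

Definition bump' d a b x : R :=
  smoothstep' d (x - (a + d)) - smoothstep' d (x - (b - 3 * d)).

Lemma bump_functionP d a b : 0 < d -> 6 * d <= b - a ->
  bump_function a b (bump d a b) (bump' d a b).
Proof.
move=> d0 dab; have [K hK] := smoothstep_C11 d0; split.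
  exists (`|-1| * K + K).
  have := C11_linear (-1) (C11_shift (- (b - 3 * d)) hK) (C11_shift (- (a + d)) hK).
  have -> : bump d a b = (fun x => -1 * smoothstep d (x - (b - 3 * d)) +
      smoothstep d (x - (a + d))).
    by apply/funext => x; rewrite mulN1r addrC.
  have -> : bump' d a b = (fun x => -1 * smoothstep' d (x - (b - 3 * d)) +
      smoothstep' d (x - (a + d))).
    by apply/funext => x; rewrite mulN1r addrC.
  by [].
exists d => // x [hx|hx]; rewrite /bump.
  by rewrite !smoothstep_le0 ?subrr //; lra.
by rewrite !smoothstep_ge ?subrr //; lra.
Qed.

Lemma bump_inside d a b x : 0 < d -> a + 3 * d <= x <= b - 3 * d ->
  bump d a b x = 1.
Proof.
move=> d0 /andP[h1 h2]; rewrite /bump smoothstep_ge ?smoothstep_le0 ?subr0 //; lra.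
Qed.

Lemma bump_itv d a b x : 0 < d -> 6 * d <= b - a -> 0 <= bump d a b x <= 1.
Proof.
move=> d0 dab; rewrite /bump.
have /andP[p1 p2] := smoothstep_itv (x - (a + d)) d0.
have [hx|hx] := leP x (b - 3 * d).
  by rewrite [X in _ - X]smoothstep_le0 ?subr0 ?p1 //; lra.
rewrite [X in X - _]smoothstep_ge //; last by lra.
have /andP[q1 q2] := smoothstep_itv (x - (b - 3 * d)) d0.
by apply/andP; split; lra.
Qed.

End SplineFunctions.

Section SquareNorm.
Context {R : realType}.
Local Notation mT := (measurableTypeR R).
Local Notation mu := (@lebesgue_measure R).
Variable W : set mT.
Hypothesis mW : measurable W.
Implicit Types u v p q r : mT -> R.

Definition sqnorm p : R := \int[mu]_(x in W) (p x ^+ 2).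

Lemma sqnorm_ge0 p : 0 <= sqnorm p.
Proof. by apply: Rintegral_ge0 => x _; exact: sqr_ge0. Qed.

(** Takes the place of the triangle inequality: with pointwise quadratic estimates the square root
    of the norm is avoided. *)
Lemma sqnorm_le (j k : R) p q r : square_integrable W p ->
  square_integrable W q -> square_integrable W r ->
  (forall x, W x -> p x ^+ 2 <= j * q x ^+ 2 + k * r x ^+ 2) ->
  sqnorm p <= j * sqnorm q + k * sqnorm r.
Proof.
move=> [_ ip] [_ iq] [_ ir] h.
rewrite /sqnorm -!RintegralZl // -RintegralD //; [|exact: integrable_EFinZl..].
apply: le_Rintegral => //.
by apply: integrable_EFinD => //; exact: integrable_EFinZl.
Qed.

Lemma square_integrableB u v : square_integrable W u -> square_integrable W v ->
  square_integrable W (fun x => u x - v x).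
Proof.
move=> hu hv.
have -> : (fun x => u x - v x) = (fun x => u x + (-1) * v x).
  by apply/funext => x; rewrite mulN1r.
by apply: square_integrableD => //; exact: square_integrableZ.
Qed.

Lemma bounded_square_integrable u : (mu W < +oo)%E -> bounded_measurable u ->
  square_integrable W u.
Proof.
move=> fW [mu_ [M uM]]; split; first exact: measurable_funS mu_.
apply: measurable_bounded_integrable => //.
  by apply: measurable_funX; exact: measurable_funS mu_.
exists (M ^+ 2); split; first exact: num_real.
move=> M' /ltW MM x _ /=; rewrite normrX (le_trans _ MM) //.
by rewrite lerXn2r ?nnegrE ?normr_ge0 // (le_trans _ (uM x)).
Qed.

Lemma square_integrableS (A C : set mT) (u : mT -> R) : measurable A ->
  measurable C -> A `<=` C -> square_integrable C u -> square_integrable A u.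
Proof.
move=> mA mC AC [mu_ iu]; split; first exact: measurable_funS mu_.
exact: integrableS iu.
Qed.

Lemma pairing_support (A C : set mT) (u v : mT -> R) : A `<=` C ->
  (forall x : mT, ~ A x -> u x = 0) -> pairing C u v = pairing A u v.
Proof.
move=> AC u0; rewrite /pairing Rintegral_mkcond [RHS]Rintegral_mkcond.
apply: eq_Rintegral => x _; rewrite /patch.
have [xA|xA] := boolP (x \in A).
  have xC : x \in C by rewrite inE; apply: AC; rewrite -in_setE.
  by rewrite xC.
rewrite u0 ?mul0r; first by case: ifP.
by move: xA; rewrite notin_setE.
Qed.

End SquareNorm.

(** * Approximation in square norm *)

Section Approximation.
Context {R : realType}.
Local Notation mT := (measurableTypeR R).
Local Notation mu := (@lebesgue_measure R).
Variables (W : set mT) (G : (mT -> R) -> Prop).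
Hypothesis mW : measurable W.
Hypothesis G_linear : forall c u v, G u -> G v -> G (fun x => c * u x + v x).
Hypothesis G_square_integrable : forall u, G u -> square_integrable W u.
Implicit Types u v p q : mT -> R.

Definition approximable u : Prop := forall e, 0 < e ->
  exists2 v, G v & sqnorm W (fun x => u x - v x) <= e.

Lemma approximable_lim u : square_integrable W u ->
  (forall e, 0 < e -> exists v, [/\ square_integrable W v, approximable v &
     sqnorm W (fun x => u x - v x) <= e]) -> approximable u.
Proof.
(* The square of a sum is at most twice the sum of the squares, so two errors [e / 4] add up to
   [e]. *)
move=> hu H e e0; have e4 : 0 < e / 4 by rewrite divr_gt0.
have [v [hv bv uv]] := H _ e4; have [w bw vw] := bv _ e4.
exists w => //; have hw := G_square_integrable bw.
have := @sqnorm_le _ _ mW 2 2 _ _ _ (square_integrableB mW hu hw)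
  (square_integrableB mW hu hv) (square_integrableB mW hv hw).
have h x : (u x - w x) ^+ 2 <= 2 * (u x - v x) ^+ 2 + 2 * (v x - w x) ^+ 2.
  have := sqr_ge0 (u x - v x - (v x - w x)); nra.
by move=> /(_ (fun x _ => h x)); lra.
Qed.

Lemma approximable_linear c u v : square_integrable W u -> square_integrable W v ->
  approximable u -> approximable v -> approximable (fun x => c * u x + v x).
Proof.
move=> hu hv bu bv e e0.
(* The weights [2 * c ^+ 2] and [2] of the two errors add up to half of this factor. *)
have c0 : 0 < 4 * (c ^+ 2 + 1) by rewrite mulr_gt0 // ltr_wpDl // sqr_ge0.
have e4 : 0 < e / (4 * (c ^+ 2 + 1)) by rewrite divr_gt0.
have [u' bu' uu] := bu _ e4; have [v' bv' vv] := bv _ e4.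
exists (fun x => c * u' x + v' x); first exact: G_linear.
have hu' := G_square_integrable bu'; have hv' := G_square_integrable bv'.
have L p q : square_integrable W p -> square_integrable W q ->
    square_integrable W (fun x => c * p x + q x).
  by move=> hp hq; apply: square_integrableD => //; exact: square_integrableZ.
have := @sqnorm_le _ _ mW (2 * c ^+ 2) 2 _ _ _
  (square_integrableB mW (L _ _ hu hv) (L _ _ hu' hv'))
  (square_integrableB mW hu hu') (square_integrableB mW hv hv').
have h x : (c * u x + v x - (c * u' x + v' x)) ^+ 2 <=
    2 * c ^+ 2 * (u x - u' x) ^+ 2 + 2 * (v x - v' x) ^+ 2.
  rewrite -subr_ge0; have := sqr_ge0 (c * (u x - u' x) - (v x - v' x)).
  by congr (0 <= _); ring.
move=> /(_ (fun x _ => h x)) /le_trans; apply.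
move: uu vv; rewrite !ler_pdivlMr //.
have := sqnorm_ge0 W (fun x => u x - u' x).
have := sqnorm_ge0 W (fun x => v x - v' x).
have := sqr_ge0 c.
set A := sqnorm _ _; set B := sqnorm _ _; set k := c ^+ 2.
by nra.
Qed.

Lemma approximable_ae u v : square_integrable W u -> square_integrable W v ->
  (forall x, W x -> u x = v x) -> approximable v -> approximable u.
Proof.
move=> hu hv uv bv; apply: approximable_lim => // e e0; exists v; split=> //.
rewrite /sqnorm (@eq_Rintegral _ _ _ _ _ (cst 0)).
  by rewrite Rintegral_cst // mul0r ltW.
by move=> x; rewrite inE => /uv ->; rewrite subrr expr0n.
Qed.

End Approximation.

(** * Density of bumps in the square integrable functions of an interval *)

Section BumpDensity.
Context {R : realType}.
Local Notation mT := (measurableTypeR R).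
Local Notation mu := (@lebesgue_measure R).
Variables a b : R.
Local Notation I := (`]a, b[%classic : set mT).
Implicit Types u v dv p q r : mT -> R.

Lemma measurable_oo : measurable I.
Proof. exact: measurable_itv. Qed.

Lemma lebesgue_oo_fin : (mu I < +oo)%E.
Proof. by rewrite lebesgue_measure_itv /=; case: ifP => // _; rewrite -EFinB ltry. Qed.

Let mI := measurable_oo.
Let finI := lebesgue_oo_fin.

Lemma C11_bounded_measurable K v dv : C11 K v dv ->
  bounded_measurable v /\ bounded_measurable dv.
Proof.
move=> hv; split; split.
- by apply: continuous_measurable_fun; exact: C11_continuous hv.
- by exists K => x; have [] := hv x.
- by apply: continuous_measurable_fun; exact: C11_deriv_continuous hv.
- by exists K => x; have [] := hv x.
Qed.

Lemma bump_square_integrable v dv : bump_function a b v dv ->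
  square_integrable I v.
Proof.
move=> [[K hv] _]; apply: bounded_square_integrable => //.
by have [] := C11_bounded_measurable hv.
Qed.

Local Notation bump_approx :=
  (approximable I (fun v => exists dv, bump_function a b v dv)).

Let bump_linear c u v : (exists du, bump_function a b u du) ->
  (exists dv, bump_function a b v dv) ->
  exists dw, bump_function a b (fun x => c * u x + v x) dw.
Proof.
by move=> [du hu] [dv hv]; exists (fun x => c * du x + dv x);
  exact: bump_function_linear.
Qed.

Let bump_sq u : (exists du, bump_function a b u du) -> square_integrable I u.
Proof. by move=> [du]; exact: bump_square_integrable. Qed.

Let bump_approx_lim u := @approximable_lim _ _ _ mI bump_sq u.
Let bump_approx_linear c u v := @approximable_linear _ _ _ mI bump_linear bump_sq c u v.
Let bump_approx_ae u v := @approximable_ae _ _ _ mI bump_sq u v.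

Lemma sqnorm_indic (A : set mT) : measurable A ->
  sqnorm I \1_A = fine (mu (A `&` I)).
Proof.
move=> mA; rewrite /sqnorm.
rewrite -[RHS]mul1r -Rintegral_cst; last exact: measurableI.
rewrite [RHS]Rintegral_mkcondl; apply: eq_Rintegral => x _.
by rewrite /patch indicE; case: ifP => _; rewrite ?expr0n ?expr1n.
Qed.

Lemma indic_square_integrable (A : set mT) : measurable A ->
  square_integrable I \1_A.
Proof.
move=> mA; apply: bounded_square_integrable => //.
exact: bounded_measurable_indic.
Qed.

Lemma fine_lebesgue_oo_le (c d : R) (A : set mT) : measurable A ->
  A `<=` `]c, d]%classic -> c <= d -> fine (mu A) <= d - c.
Proof.
move=> mA Acd cd.
have h : (mu A <= (d - c)%:E)%E.
  have mcd : measurable (`]c, d]%classic : set mT) by exact: measurable_itv.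
  have Acd' : (mu A <= mu (`]c, d]%classic : set mT))%E.
    by apply: le_measure => //; rewrite inE.
  rewrite (le_trans Acd') // [leLHS]lebesgue_measure_itv /= lte_fin.
  by case: ifP => _; rewrite -?EFinB ?lee_fin // subr_ge0.
rewrite -lee_fin fineK // ge0_fin_numE ?measure_ge0 //.
by rewrite (le_lt_trans h) ?ltry.
Qed.

(** Inside []a, b[] the indicator is that of []c, d]]. A bump on []c, d[] differs from it by at most
    [1], and only on two strips of length [3 * s]. *)
Lemma bump_approx_itv (x y : R) : bump_approx \1_(`]x, y]%classic).
Proof.
have mxy : measurable (`]x, y]%classic : set mT) by exact: measurable_itv.
pose c := Num.max x a; pose d := Num.min y b.
move=> e e0; have [cd|cd] := ltP c d; last first.
  exists (fun=> 0); first by exists (fun=> 0); exact: bump_function0.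
  rewrite (_ : (fun _ => _) = \1_(`]x, y]%classic)); last first.
    by apply/funext => z; rewrite subr0.
  rewrite sqnorm_indic // (_ : _ `&` _ = set0) ?measure0 ?ltW //.
  apply/seteqP; split=> // z /= []; rewrite !in_itv /= => /andP[h1 h2] /andP[h3 h4].
  by move: cd; rewrite leNgt => /negP; apply; rewrite gt_max !lt_min; lra.
(* The first entry makes room for the bump, the second keeps the total length [6 * s] of the strips
   below [e]. *)
pose s := Num.min ((d - c) / 6) (e / 6).
have s0 : 0 < s by rewrite lt_min !divr_gt0 // subr_gt0.
have s1 : 6 * s <= d - c by rewrite -ler_pdivlMl // mulrC ge_min lexx.
have s2 : 6 * s <= e by rewrite -ler_pdivlMl // mulrC ge_min lexx orbT.
have bP := bump_functionP s0 s1.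
have ca : a <= c by rewrite le_max lexx orbT.
have cx : x <= c by rewrite le_max lexx.
have db : d <= b by rewrite ge_min lexx orbT.
have dy : d <= y by rewrite ge_min lexx.
have bP' := bump_function_sub ca db bP.
exists (bump s c d); first by exists (bump' s c d).
pose A := (`]c, (c + 3 * s)%R]%classic : set mT).
pose B := (`](d - 3 * s)%R, d]%classic : set mT).
have mA : measurable A by exact: measurable_itv.
have mB : measurable B by exact: measurable_itv.
have iA := indic_square_integrable mA; have iB := indic_square_integrable mB.
have := @sqnorm_le _ _ mI 1 1 _ _ _
  (square_integrableB mI (indic_square_integrable mxy) (bump_square_integrable bP')) iA iB.
rewrite !sqnorm_indic // !mul1r => h; apply: (le_trans (h _)).
  move=> z; rewrite /= in_itv /= => /andP[az zb].
  have zA : (z \in A) = (c < z <= c + 3 * s).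
    by apply/idP/idP; rewrite inE /A /= in_itv.
  have zB : (z \in B) = (d - 3 * s < z <= d).
    by apply/idP/idP; rewrite inE /B /= in_itv.
  have zxy : (z \in (`]x, y]%classic : set mT)) = (x < z <= y).
    by apply/idP/idP; rewrite inE /= in_itv.
  have /andP[v0 v1] := bump_itv z s0 s1.
  rewrite !mul1r !indicE zA zB zxy !expr2.
  have [cz|cz] := ltP c z; last first.
    have -> : bump s c d z = 0.
      by rewrite /bump !smoothstep_le0 ?subrr //; lra.
    have -> : (x < z) = false.
      apply/negP => xz; move: cz; rewrite leNgt => /negP; apply.
      by rewrite gt_max xz az.
    by rewrite /= !subr0 mul0r addr_ge0 // mulr_ge0 // ler0n.
  have [zd|zd] := leP z d; last first.
    have -> : bump s c d z = 0.
      by rewrite /bump !smoothstep_ge ?subrr //; lra.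
    have -> : (z <= y) = false.
      apply/negP => zy; move: zd; rewrite ltNge => /negP; apply.
      by rewrite le_min zy ltW.
    by rewrite andbF /= !subr0 mul0r addr_ge0 // mulr_ge0 // ler0n.
  have -> : x < z <= y by rewrite (le_lt_trans cx cz) (le_trans zd dy).
  have [z1|z1] := leP z (c + 3 * s) => /=.
    by case: (d - 3 * s < z); nra.
  have [z2|z2] := ltP (d - 3 * s) z => /=; first by nra.
  rewrite bump_inside ?subrr ?mul0r ?addr0 //; lra.
apply: (le_trans _ s2).
have h1 : fine (mu (A `&` I)) <= c + 3 * s - c.
  apply: fine_lebesgue_oo_le; [exact: measurableI|by move=> z []|lra].
have h2 : fine (mu (B `&` I)) <= d - (d - 3 * s).
  apply: fine_lebesgue_oo_le; [exact: measurableI|by move=> z []|lra].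
by lra.
Qed.

(** Half-open intervals form a pi-system generating the Borel sets, and the sets with approximable
    indicator are closed under complement and disjoint countable union, the latter by continuity of
    the measure from below. *)
Lemma bump_approx_indic (A : set mT) : measurable A -> bump_approx \1_A.
Proof.
have fin (B : set mT) : measurable B -> (mu (B `&` I)) \is a fin_num.
  move=> mB; rewrite ge0_fin_numE ?measure_ge0 //.
  by rewrite (le_lt_trans _ finI) // le_measure ?inE //; exact: measurableI.
have bT : bump_approx \1_setT.
  apply: (@bump_approx_ae _ \1_(`]a, b]%classic)).
  + exact: indic_square_integrable.
  + by apply: indic_square_integrable; exact: measurable_itv.
  + move=> x /=; rewrite in_itv /= => /andP[ax xb].
    by rewrite indicT indicE mem_set //= in_itv /= ax ltW.
  + exact: bump_approx_itv.
move=> mA; apply: (@dynkin_induction _ mT (@ocitv R) (fun A => bump_approx \1_A)) => //.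
- exact: ocitvI.
- by move=> _ [[x y] _ <-]; exact: bump_approx_itv.
- move=> S mS bS; have iS := indic_square_integrable mS.
  have iT := indic_square_integrable (measurableT : measurable (setT : set mT)).
  apply: (@bump_approx_ae _ (fun x => -1 * \1_S x + \1_setT x)).
  + by apply: indic_square_integrable; exact: measurableC.
  + by apply: square_integrableD => //; exact: square_integrableZ.
  + move=> x _; rewrite indicT mulN1r !indicE in_setC.
    by case: (x \in S); rewrite /= ?oppr0 ?add0r // addNr.
  + exact: bump_approx_linear.
move=> F mF tF bF.
have mUF : measurable (\bigcup_k F k) by exact: bigcup_measurable.
pose V N := \big[setU/set0]_(k < N) F k.
have mV N : measurable (V N) by exact: bigsetU_measurable.
have bV N : bump_approx \1_(V N).
  elim: N => [|N IH].
    move=> e e0; exists (fun=> 0); first by exists (fun=> 0); exact: bump_function0.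
    rewrite /V big_ord0 indic0 /sqnorm (@eq_Rintegral _ _ _ _ _ (cst 0)).
      by rewrite Rintegral_cst // mul0r ltW.
    by move=> x _; rewrite subr0 expr0n.
  have iV := indic_square_integrable (mV N).
  have iF := indic_square_integrable (mF N).
  apply: (@bump_approx_ae _ (fun x => 1 * \1_(V N) x + \1_(F N) x)).
  + exact: indic_square_integrable.
  + by apply: square_integrableD => //; exact: square_integrableZ.
  + move=> x _; rewrite mul1r /V big_ord_recr /= -/(V N) !indicE in_setU.
    have [xF|xF] := boolP (x \in F N); last by rewrite orbF addr0.
    rewrite orbT (_ : (x \in V N) = false) ?add0r //; apply/negP.
    rewrite inE /V -bigcup_mkord => -[k /= kN xk].
    move: tF => /trivIsetP /(_ k N Logic.I Logic.I).
    rewrite ltn_eqF // => /(_ isT) /seteqP[h _]; move: xF; rewrite inE => xF.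
    exact: (h x).
  + exact: bump_approx_linear.
apply: bump_approx_lim; first exact: indic_square_integrable.
move=> e e0.
have cv : mu (V N `&` I) @[N --> \oo] --> mu ((\bigcup_k F k) `&` I).
  have -> : (\bigcup_k F k) `&` I = \bigcup_N (V N `&` I).
    rewrite -setI_bigcupl; congr (_ `&` _).
    apply/seteqP; split=> x; last first.
      by move=> [N _]; rewrite /V; exact: bigsetU_bigcup.
    by move=> [k _ Fx]; exists k.+1 => //; exact: (bigsetU_sup (ltnSn k)).
  apply: nondecreasing_cvg_mu.
  - by move=> N; exact: measurableI.
  - by apply: bigcup_measurable => N _; exact: measurableI.
  - move=> N N' NN; apply/subsetPset; apply: setSI.
    rewrite /V -!bigcup_mkord => x [k /= kN Fx]; exists k => //=.
    exact: leq_trans kN NN.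
have fU := fin _ mUF.
move: cv; rewrite -(fineK fU) => /fine_cvgP[_ /cvgrPdist_le /(_ e e0)[N _ /(_ N (leqnn N))] hN].
have VU : V N `<=` \bigcup_k F k.
  by rewrite /V -bigcup_mkord; apply: bigcup_sub => k _; exact: bigcup_sup.
exists \1_(V N); split; [exact: indic_square_integrable|exact: bV|].
have -> : (fun x => \1_(\bigcup_k F k) x - \1_(V N) x) =
    \1_((\bigcup_k F k) `\` V N) :> (mT -> R).
  apply/funext => x; rewrite !indicE in_setD.
  have [xV|xV] := boolP (x \in V N).
    by rewrite (_ : _ \in \bigcup_k F k) ?subrr //= inE; apply: VU; rewrite -in_setE.
  by rewrite andbT subr0.
rewrite sqnorm_indic; last exact: measurableD.
have VI : (V N `&` I) `<=` ((\bigcup_k F k) `&` I) by exact: setSI.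
rewrite (_ : _ `&` I = ((\bigcup_k F k) `&` I) `\` (V N `&` I)); last first.
  apply/seteqP; split=> x [[Fx nV] Ix]; first by split=> // -[].
  by split=> //; split=> // Vx; apply: Ix.
rewrite measureD; [|exact: measurableI|exact: measurableI|]; last first.
  by rewrite -ge0_fin_numE ?measure_ge0.
rewrite (setIidr VI) fineB //; last exact: fin.
exact: le_trans (ler_norm _) hN.
Qed.

(** Uniform approximation is approximation in square norm because the interval has finite length. *)
Lemma bump_approx_bounded u : bounded_measurable u -> bump_approx u.
Proof.
move: u; apply: bounded_measurable_ind => [A mA|c f g bf bg hf hg|f bf H].
- exact: bump_approx_indic.
- by apply: bump_approx_linear => //; exact: bounded_square_integrable.
apply: bump_approx_lim; first exact: bounded_square_integrable.
move=> e e0; set l := fine (mu I).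
have l0 : 0 <= l by rewrite fine_ge0.
have s0 : 0 < Num.sqrt (e / (l + 1)) by rewrite sqrtr_gt0 divr_gt0 // ltr_wpDl.
have [g [bg ag] fg] := H _ s0; have ig := bounded_square_integrable mI finI bg.
have i_f := bounded_square_integrable mI finI bf.
exists g; split=> //.
have i1 : square_integrable I (cst (Num.sqrt (e / (l + 1)))).
  by apply: bounded_square_integrable => //; exact: bounded_measurable_cst.
have := sqnorm_le (j := 1) (k := 0) mI (square_integrableB mI i_f ig) i1 i1.
rewrite mul0r addr0 mul1r => h; apply: (le_trans (h _)).
  move=> x _; rewrite mul0r addr0 mul1r -real_normK ?num_real //.
  by rewrite lerXn2r ?nnegrE ?sqrtr_ge0.
have l1 : 0 < l + 1 by rewrite ltr_wpDl.
have e1 : 0 <= e / (l + 1) by rewrite divr_ge0 ?(ltW e0) ?(ltW l1).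
rewrite /sqnorm /= Rintegral_cst // sqr_sqrtr // -/l mulrAC ler_pdivrMr //.
by rewrite ler_wpM2l ?(ltW e0) //; lra.
Qed.

(** Setting [u] to [0] where [|u|] exceeds [N] gives bounded functions, and [u ^+ 2] dominates the
    squared errors. *)
Lemma bump_dense u : square_integrable I u -> bump_approx u.
Proof.
move=> hu; have [mu_ iu] := hu.
pose T (N : nat) := I `&` [set x | `|u x| <= N%:R].
have mT_ N : measurable (T N).
  by apply: measurable_fun_le => //; exact: measurableT_comp.
pose t N : mT -> R := u \_ (T N).
have bt N : bounded_measurable (t N).
  split.
    apply/(measurable_restrictT u (mT_ N)).
    by apply: (measurable_funS mI _ mu_) => x [].
  exists N%:R => x; rewrite /t /patch; case: ifP; last by rewrite normr0 ler0n.
  by rewrite inE => -[].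
have it N := bounded_square_integrable mI finI (bt N).
apply: bump_approx_lim => // e e0.
have cv : (\int[mu]_(x in I) ((u x - t N x) ^+ 2)%:E)%E @[N --> \oo] -->
    (\int[mu]_(x in I) (0 : \bar R))%E.
  apply: (@dominated_cvg _ _ _ mu I mI (fun N x => ((u x - t N x) ^+ 2)%:E)
    (fun=> 0%E) (fun x => (u x ^+ 2)%:E)) => //.
  - move=> N; apply/measurable_EFinP; apply: measurable_funX.
    by apply: measurable_funB => //; have [] := it N.
  - move=> x Ix; apply: cvg_near_cst; exists (Num.trunc `|u x|).+1 => // N /= hN.
    rewrite /t /patch mem_set ?subrr ?expr0n //; split=> //=.
    rewrite (le_trans (ltW (Num.Theory.truncnS_gt `|u x|))) // ler_nat.
    exact: leq_trans hN.
  - move=> N x Ix; rewrite /t /patch; case: ifP => _ /=.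
      by rewrite subrr expr0n normr0 lee_fin sqr_ge0.
    by rewrite subr0 ger0_norm ?sqr_ge0.
rewrite integral0 in cv.
move: cv => /fine_cvgP[_ /cvgrPdist_le /(_ e e0)[N _ /(_ N (leqnn N))] hN].
exists (t N); split=> //; first exact: bump_approx_bounded.
move: hN => /=; rewrite sub0r normrN => /(le_trans (ler_norm _)).
by [].
Qed.

End BumpDensity.

(** * Translation of Lebesgue integrals *)

Section Translation.
Context {R : realType}.
Local Notation mT := (measurableTypeR R).
Local Notation mu := (@lebesgue_measure R).
Variable t : R.

Lemma measurable_shift : measurable_fun setT (fun x : mT => (x + t : mT)).
Proof. exact: measurable_funD. Qed.

(** The pushforward under the shift agrees with the measure on half-open intervals, which determine
    it. *)
Lemma lebesgue_measure_shift (A : set mT) : measurable A ->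
  mu ((fun x : mT => (x + t : mT)) @^-1` A) = mu A.
Proof.
pose P := measure_function_pushforward__canonical__measure_function_Measure mu
  measurable_shift.
have H (X : set (ocitv_type R)) : ocitv X -> lebesgue_measure X = P X.
  move=> [[x y] _ <-] /=; rewrite /pushforward.
  rewrite (_ : _ @^-1` _ = (`](x - t)%R, (y - t)%R]%classic : set mT)); last first.
    by apply/seteqP; split=> z /=; rewrite !in_itv /= ltrBlDr lerBrDr.
  rewrite !lebesgue_measure_itv /= !lte_fin ltrD2r; case: ifP => // _.
  by rewrite -!EFinB; congr (_%:E); ring.
by move=> mA; rewrite (lebesgue_measure_unique H mA).
Qed.

Lemma preimage_shift_oo (p q : R) :
  (fun x : mT => (x + t : mT)) @^-1` (`](p + t)%R, (q + t)%R[%classic) =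
  `]p, q[%classic.
Proof. by apply/seteqP; split=> z /=; rewrite !in_itv /= !ltrD2r. Qed.

Let phi (x : mT) : mT := x + t.

Lemma ge0_integral_shift (D : set mT) (f : mT -> \bar R) : measurable D ->
  measurable_fun setT f -> {in D, forall x, 0 <= f x}%E ->
  (\int[mu]_(x in D) f x = \int[mu]_(x in phi @^-1` D) f (phi x))%E.
Proof.
move=> mD mf f0.
have := ge0_integral_pushforward measurable_shift mu mD (measurable_funTS mf) f0.
rewrite -/phi => <-; apply: eq_measure_integral => [|? A mA _]; first exact: measurable_shift.
exact/esym/lebesgue_measure_shift.
Qed.

Lemma integral_shift (D : set mT) (f : mT -> \bar R) : measurable D ->
  measurable_fun setT f -> mu.-integrable D f ->
  mu.-integrable (phi @^-1` D) (f \o phi) /\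
  (\int[mu]_(x in D) f x = \int[mu]_(x in phi @^-1` D) f (phi x))%E.
Proof.
move=> mD mf /integrableP[mDf fD].
have ip : mu.-integrable (phi @^-1` D) (f \o phi).
  apply/integrableP; split.
    exact: measurable_funTS (measurableT_comp mf measurable_shift).
  have := @ge0_integral_shift D (fun x => `|f x|%E) mD.
  by rewrite /= => <- //; exact: measurableT_comp.
split=> //.
have := integral_pushforward measurable_shift mf ip mD.
rewrite -/phi => <-; apply: eq_measure_integral => [|? A mA _]; first exact: measurable_shift.
exact/esym/lebesgue_measure_shift.
Qed.

Lemma square_integrable_shift (p q : R) (u : mT -> R) :
  square_integrable `](p + t)%R, (q + t)%R[%classic u ->
  square_integrable `]p, q[%classic (fun x => u (x + t)).
Proof.
move=> [mu_ iu]; have mI := measurable_oo (p + t) (q + t).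
set I : set mT := `](p + t)%R, (q + t)%R[%classic in mu_ iu mI.
(* The change of variables wants a function measurable on the whole line, hence the extension by
   [0]. *)
have mr : measurable_fun setT (u \_ I) by exact/(measurable_restrictT u mI).
split.
  have : measurable_fun `]p, q[%classic ((u \_ I) \o phi).
    exact: measurable_funTS (measurableT_comp mr measurable_shift).
  apply: eq_measurable_fun => x; rewrite inE /= in_itv /= => /andP[px xq].
  have Ix : I (x + t) by rewrite /I /= in_itv /= !ltrD2r px.
  by rewrite /= /patch mem_set.
have [||] := @integral_shift I (EFin \o (fun x => (u \_ I) x ^+ 2)) mI.
- by apply/measurable_EFinP; exact: measurable_funX.
- apply: eq_integrable iu => // x xI; rewrite /= /patch xI //.
rewrite preimage_shift_oo => + _; apply: eq_integrable; first exact: measurable_oo.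
move=> x; rewrite inE /= in_itv /= => /andP[px xq].
have Ix : I (x + t) by rewrite /I /= in_itv /= !ltrD2r px.
  by rewrite /= /patch mem_set.
Qed.

Lemma pairing_shift (p q : R) (u v : mT -> R) :
  square_integrable `](p + t)%R, (q + t)%R[%classic u ->
  square_integrable `](p + t)%R, (q + t)%R[%classic v ->
  pairing `](p + t)%R, (q + t)%R[%classic u v =
  pairing `]p, q[%classic (fun x => u (x + t)) (fun x => v (x + t)).
Proof.
move=> hu hv; have mI := measurable_oo (p + t) (q + t).
have iuv := integrableM_square_integrable mI hu hv.
set I : set mT := `](p + t)%R, (q + t)%R[%classic in hu hv mI iuv *.
have mr : measurable_fun setT ((fun x => u x * v x) \_ I).
  apply/(measurable_restrictT _ mI); apply: measurable_funM; first by case: hu.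
  by case: hv.
have [||_] := @integral_shift I (EFin \o ((fun x => u x * v x) \_ I)) mI.
- exact/measurable_EFinP.
- by apply: eq_integrable iuv => // x xI; rewrite /= /patch xI.
rewrite preimage_shift_oo => h; rewrite /pairing /Rintegral; congr fine.
transitivity (\int[mu]_(x in I) (((fun x => u x * v x) \_ I) x)%R%:E)%E.
  by apply: eq_integral => x xI; rewrite /= /patch xI.
rewrite h; apply: eq_integral => x; rewrite inE /= in_itv /= => /andP[px xq].
have Ix : I (x + t) by rewrite /I /= in_itv /= !ltrD2r px.
  by rewrite /= /patch mem_set.
Qed.

End Translation.

Section BumpOrthogonal.
Context {R : realType}.
Local Notation mT := (measurableTypeR R).
Local Notation mu := (@lebesgue_measure R).

(** A bump [v] close to [u] is orthogonal to it, so the squared norm of [u - v] is at least that of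
    [u], which is therefore arbitrarily small. *)
Lemma bump_orthogonal (a b : R) (u : mT -> R) :
  square_integrable `]a, b[%classic u ->
  (forall v dv, bump_function a b v dv -> pairing `]a, b[%classic u v = 0) ->
  ae_eq mu `]a, b[%classic u (cst 0).
Proof.
move=> hu H; have mI := measurable_oo a b.
apply: pairing_eq0 => //; apply/eqP; rewrite eq_le pairing_ge0 andbT.
apply/ler_addgt0Pr => e e0; rewrite add0r.
have [v [dv bv] uv] := bump_dense hu e0.
have hv := bump_square_integrable bv.
have huv := square_integrableB mI hu hv.
have E : pairing `]a, b[%classic (fun x => (-1) * v x + u x) u =
    pairing `]a, b[%classic u u.
  by rewrite pairingDl // (pairingC _ v) (H _ _ bv) mulr0 add0r.
have i1 := integrableM_square_integrable mI huv huv.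
apply: le_trans uv; rewrite -subr_ge0.
have : 0 <= sqnorm `]a, b[%classic v by exact: sqnorm_ge0.
have -> : sqnorm `]a, b[%classic (fun x => u x - v x) =
   pairing `]a, b[%classic u u + sqnorm `]a, b[%classic v.
  have -> : sqnorm `]a, b[%classic (fun x => u x - v x) =
     pairing `]a, b[%classic (fun x => (-1) * v x + u x) (fun x => (-1) * v x + u x).
    by apply: eq_Rintegral => x _; ring.
  have hw : square_integrable `]a, b[%classic (fun x => (-1) * v x + u x).
    by apply: square_integrableD => //; exact: square_integrableZ.
  rewrite pairingDl // (pairingC _ v) (pairingC _ u) !pairingDl // (H _ _ bv).
  rewrite (pairingC _ v u) (H _ _ bv) /sqnorm {2}/pairing.
  under [in RHS]eq_Rintegral do rewrite expr2.
  by rewrite /pairing; ring.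
by rewrite addrC addKr.
Qed.

End BumpOrthogonal.

(** * The momentum operator *)

Section TestFunctions.
Context {R : realType} {n : nat}.
Variables alpha beta : 'I_n -> R.
Hypothesis alpha_beta : forall i, alpha i < beta i.
Hypothesis beta_alpha : forall i j : 'I_n, (i < j)%N -> beta i < alpha j.
Local Notation mT := (measurableTypeR R).
Local Notation mu := (@lebesgue_measure R).
Local Notation W := (Omega alpha beta : set mT).
Local Notation Ji := (fun i => J alpha beta i : set mT).
Implicit Types (f df g dg : R -> R[i]) (u du v dv : R -> R).

Lemma JE i x : J alpha beta i x = (alpha i < x < beta i) :> Prop.
Proof. by rewrite /J /= in_itv. Qed.

Lemma J_unique i j x : J alpha beta i x -> J alpha beta j x -> i = j.
Proof.
rewrite !JE => /andP[h1 h2] /andP[h3 h4].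
have [ij|ji|/val_inj //] := ssrnat.ltngtP i j.
  by have := lt_trans (lt_trans h2 (beta_alpha ij)) h3; rewrite ltxx.
by have := lt_trans (lt_trans h4 (beta_alpha ji)) h1; rewrite ltxx.
Qed.

Lemma measurable_J i : measurable (Ji i).
Proof. exact: measurable_itv. Qed.

Lemma measurable_Omega : measurable W.
Proof.
by rewrite /Omega; apply: fin_bigcup_measurable => // i _; exact: measurable_J.
Qed.

Lemma lebesgue_Omega_fin : (mu W < +oo)%E.
Proof.
pose M := \sum_i (`|alpha i| + `|beta i|).
have sub : W `<=` (`]- M, M[%classic : set mT).
  move=> x [i _]; rewrite JE /= in_itv /= => /andP[ax xb].
  have : `|alpha i| + `|beta i| <= M.
    by rewrite /M (bigD1 i) //= lerDl sumr_ge0 // => j _; exact: addr_ge0.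
  have := ler_norm (- alpha i); have := ler_norm (beta i).
  have := normr_ge0 (alpha i); have := normr_ge0 (beta i).
  by rewrite normrN => *; apply/andP; split; lra.
apply: le_lt_trans (lebesgue_oo_fin (- M) M); apply: le_measure => //; rewrite inE.
  exact: measurable_Omega.
exact: measurable_oo.
Qed.

(** Imposed at both ends of every interval, so that all entries of both boundary vectors vanish. *)
Definition boundary_zero u : Prop := forall i, exists2 e, 0 < e &
  forall x, alpha i < x < alpha i + e \/ beta i - e < x < beta i -> u x = 0.

Definition real_test u du : Prop := (exists K, C11 K u du) /\ boundary_zero u.

Definition test f df : Prop :=
  real_test (fun x => Re (f x)) (fun x => Re (df x)) /\
  real_test (fun x => Im (f x)) (fun x => Im (df x)).

Lemma real_test_linear c u du v dv : real_test u du -> real_test v dv ->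
  real_test (fun x => c * u x + v x) (fun x => c * du x + dv x).
Proof.
move=> [[K hu] bu] [[L hv] bv]; split.
  by exists (`|c| * K + L); exact: C11_linear.
move=> i; have [e e0 ue] := bu i; have [d d0 vd] := bv i.
exists (Num.min e d); first by rewrite lt_min e0.
have m1 : Num.min e d <= e by rewrite ge_min lexx.
have m2 : Num.min e d <= d by rewrite ge_min lexx orbT.
move=> x hx; rewrite ue ?vd ?mulr0 ?addr0 //.
  by case: hx => /andP[? ?]; [left|right]; apply/andP; split; lra.
by case: hx => /andP[? ?]; [left|right]; apply/andP; split; lra.
Qed.

Lemma real_test0 : real_test (fun=> 0) (fun=> 0).
Proof. by split; [exists 0; exact: C11_0|move=> i; exists 1]. Qed.

Lemma test_linear c f df g dg : test f df -> test g dg ->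
  test (fun x => c * f x + g x) (fun x => c * df x + dg x).
Proof.
move=> [fR fI] [gR gI]; case: c => a b.
have e1 h k : (fun x => Re ((a +i* b) * h x + k x)) =
    (fun x => a * Re (h x) + ((- b) * Im (h x) + Re (k x))) :> (R -> R).
  by apply/funext => x; case: (h x) => p q; case: (k x) => ? ? /=; ring.
have e2 h k : (fun x => Im ((a +i* b) * h x + k x)) =
    (fun x => a * Im (h x) + (b * Re (h x) + Im (k x))) :> (R -> R).
  by apply/funext => x; case: (h x) => p q; case: (k x) => ? ? /=; ring.
by split; rewrite ?e1 ?e2; do ?apply: real_test_linear.
Qed.

Lemma bump_function_eq0 a b v dv : bump_function a b v dv ->
  forall x, x <= a \/ b <= x -> v x = 0.
Proof. by move=> [_ [e e0 ve]] x hx; apply: ve; case: hx => ?; [left|right]; lra. Qed.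

Lemma real_test_bump i v dv : bump_function (alpha i) (beta i) v dv ->
  real_test v dv.
Proof.
(* Capping the margin by the length of [J j] keeps both boundary strips inside [J j], where
   disjointness from [J i] applies. *)
move=> bv; have [Kv [e e0 ve]] := bv; split=> // j; exists (Num.min e (beta j - alpha j)).
  by rewrite lt_min e0 subr_gt0 alpha_beta.
have m1 : Num.min e (beta j - alpha j) <= e by rewrite ge_min lexx.
have m2 : Num.min e (beta j - alpha j) <= beta j - alpha j.
  by rewrite ge_min lexx orbT.
move=> x hx.
have Jx : alpha j < x < beta j.
  by case: hx => /andP[? ?]; apply/andP; split; lra.
have [ij|ij] := eqVneq i j.
  by subst j; apply: ve; case: hx => /andP[? ?]; [left|right]; lra.
apply: (bump_function_eq0 bv).
have [|ax] := leP x (alpha i); first by left.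
have [xb|] := ltP x (beta i); last by right.
by case/eqP: ij; apply: (@J_unique i j x); rewrite JE ?ax.
Qed.

Lemma test_real u du : real_test u du ->
  test (fun x => (u x)%:C) (fun x => (du x)%:C).
Proof. by move=> hu; split=> //; exact: real_test0. Qed.

Lemma real_test_square_integrable u du : real_test u du ->
  square_integrable W u /\ square_integrable W du.
Proof.
move=> [[K hu] _]; have [bu bdu] := C11_bounded_measurable hu.
by split; apply: bounded_square_integrable => //;
  exact: measurable_Omega || exact: lebesgue_Omega_fin.
Qed.

Lemma test_L2 f df : test f df -> L2 W f /\ L2 W df.
Proof.
move=> [/real_test_square_integrable[? ?] /real_test_square_integrable[? ?]].
by split; apply/L2P => //; exact: measurable_Omega.
Qed.

Lemma C11_derive1 K u du x : C11 K u du -> u^`()%classic x = du x.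
Proof.
by move=> hu; rewrite derive1E; have [_ ->] := C11_is_derive x hu.
Qed.

Lemma test_cderive f df : test f df -> cderive f = df.
Proof.
move=> [[[K hK] _] [[L hL] _]]; apply/funext => x.
rewrite /cderive (C11_derive1 x hK) (C11_derive1 x hL).
by case: (df x).
Qed.

Lemma normc_le (z : R[i]) : Normc.normc z <= `|Re z| + `|Im z|.
Proof.
rewrite -(@ler_pXn2r _ 2) ?nnegrE ?addr_ge0 //; last first.
  by case: z => a b; rewrite sqrtr_ge0.
rewrite sqr_normc -[Re z ^+ 2]real_normK ?num_real //.
rewrite -[Im z ^+ 2]real_normK ?num_real //.
by have := normr_ge0 (Re z); have := normr_ge0 (Im z); nra.
Qed.

Lemma test_abs_continuous A f df : test f df -> abs_continuous A f.
Proof.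
move=> [[[K hK] _] [[L hL] _]] e e0.
have K0 := C11_ge0 hK; have L0 := C11_ge0 hL.
have M0 : 0 < 2 * K + 2 * L + 1 by lra.
exists (e / (2 * K + 2 * L + 1)); first by rewrite divr_gt0.
move=> k a b hab _; rewrite ltr_pdivlMr // => hs.
apply: le_lt_trans hs; rewrite mulr_suml; apply: ler_sum => j _.
have [_ _ ab] := hab j.
rewrite (le_trans (normc_le _)) //.
have -> : Re (f (b j) - f (a j)) = Re (f (b j)) - Re (f (a j)) by rewrite ReB.
have -> : Im (f (b j) - f (a j)) = Im (f (b j)) - Im (f (a j)).
  by case: (f (b j)); case: (f (a j)).
have := C11_lipschitz (a j) (b j) hK; have := C11_lipschitz (a j) (b j) hL.
by rewrite (ger0_norm (_ : 0 <= b j - a j)) ?subr_ge0 //; nra.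
Qed.

Lemma lim_right_near0 (u : R -> R) (a e : R) : 0 < e ->
  (forall x, a < x < a + e -> u x = 0) -> lim (u x @[x --> a^'+]) = 0.
Proof.
move=> e0 ue; apply: cvg_lim => //; apply: cvg_near_cst.
near=> x; apply: ue; apply/andP; split; near: x; first exact: nbhs_right_gt.
by apply: nbhs_right_lt; rewrite ltrDl.
Unshelve. all: by end_near. Qed.

Lemma lim_left_near0 (u : R -> R) (b e : R) : 0 < e ->
  (forall x, b - e < x < b -> u x = 0) -> lim (u x @[x --> b^'-]) = 0.
Proof.
move=> e0 ue; apply: cvg_lim => //; apply: cvg_near_cst.
near=> x; apply: ue; apply/andP; split; near: x; last exact: nbhs_left_lt.
by apply: nbhs_left_gt; rewrite ltrBlDr ltrDl.
Unshelve. all: by end_near. Qed.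

(** Both boundary vectors are [0], so the boundary condition holds whatever [B] is. *)
Lemma test_DB B f df : test f df -> DB alpha beta B f.
Proof.
move=> tf; split.
  split; first by move=> i; exact: test_abs_continuous tf.
  by rewrite (test_cderive tf); have [] := test_L2 tf.
have [[_ bR] [_ bI]] := tf.
have -> : at_alpha alpha f = 0.
  apply/matrixP => i j; rewrite !mxE /cright_lim.
  have [e e0 he] := bR i; have [d d0 hd] := bI i.
  rewrite (lim_right_near0 e0) ?(lim_right_near0 d0) // => x hx.
    by apply: hd; left.
  by apply: he; left.
have -> : at_beta beta f = 0.
  apply/matrixP => i j; rewrite !mxE /cleft_lim.
  have [e e0 he] := bR i; have [d d0 hd] := bI i.
  rewrite (lim_left_near0 e0) ?(lim_left_near0 d0) // => x hx.
    by apply: hd; right.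
  by apply: he; right.
by rewrite mulmx0.
Qed.

(** The function is cut along the finitely many intervals; on each piece bumps are dense, and a bump
    of one interval is a test function for all of [Omega]. *)
Lemma real_test_dense u : square_integrable W u ->
  approximable W (fun v => exists dv, real_test v dv) u.
Proof.
move=> hu; have mW := measurable_Omega.
set G := fun v => exists dv, real_test v dv.
have G_linear c p q : G p -> G q -> G (fun x => c * p x + q x).
  by move=> [dp hp] [dq hq]; exists (fun x => c * dp x + dq x); exact: real_test_linear.
have G_sq p : G p -> square_integrable W p.
  by move=> [dp hp]; have [] := real_test_square_integrable hp.
have JW i : Ji i `<=` W by move=> x Jx; exists i.
have sqJ i : square_integrable W (u \_ (Ji i)).
  have [mu_ iu] := hu.
  apply: (square_integrable_le mW _ hu).
    apply/(measurable_restrict _ (measurable_J i) mW).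
    by rewrite (setIidr (JW i)); exact: measurable_funS (JW i) mu_.
  move=> x _; rewrite /patch; case: ifP => // _.
  by rewrite normr0.
have aJ i : approximable W G (u \_ (Ji i)).
  have hJ : square_integrable (Ji i) u.
    have [mu_ iu] := hu; split; first exact: measurable_funS (JW i) mu_.
    by apply: integrableS iu => //; exact: measurable_J.
  move=> e e0; have [v [dv bv] uv] := bump_dense hJ e0.
  exists v; first by exists dv; exact: real_test_bump bv.
  apply: le_trans uv; rewrite /sqnorm Rintegral_mkcond [leRHS]Rintegral_mkcond.
  rewrite le_eqVlt; apply/orP; left; apply/eqP; apply: eq_Rintegral => x _.
  rewrite /patch; have [xJ|xJ] := boolP (x \in Ji i).
    have xW : x \in W by rewrite inE; apply: (JW i); rewrite -in_setE.
    by rewrite xW.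
  case: ifP => // _; rewrite (bump_function_eq0 bv) ?subrr ?expr0n //.
  move: xJ; rewrite notin_setE JE => /negP; rewrite negb_and -!leNgt => /orP[].
    by left.
  by right.
have aS (s : seq 'I_n) : square_integrable W (fun x => \sum_(i <- s) (u \_ (Ji i)) x) /\
    approximable W G (fun x => \sum_(i <- s) (u \_ (Ji i)) x).
  elim: s => [|i s [IH1 IH2]].
    have -> : (fun x => \sum_(i <- [::]) (u \_ (Ji i)) x) = (fun=> 0).
      by apply/funext => x; rewrite big_nil.
    split; first exact: square_integrable0.
    move=> e e0; exists (fun=> 0); first by exists (fun=> 0); exact: real_test0.
    rewrite /sqnorm (@eq_Rintegral _ _ _ _ _ (cst 0)).
      by rewrite Rintegral_cst // mul0r ltW.
    by move=> x _; rewrite subr0 expr0n.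
  have -> : (fun x => \sum_(j <- i :: s) (u \_ (Ji j)) x) =
      (fun x => 1 * (u \_ (Ji i)) x + \sum_(j <- s) (u \_ (Ji j)) x).
    by apply/funext => x; rewrite big_cons mul1r.
  split; last exact: (approximable_linear mW G_linear G_sq).
  by apply: square_integrableD => //; exact: square_integrableZ.
have [s1 s2] := aS (enum 'I_n).
apply: (approximable_ae mW G_sq hu s1 _ s2) => x [i _ Jx].
rewrite big_enum /= (bigD1 i) //= big1 ?addr0.
  by rewrite /patch mem_set.
move=> j ji; rewrite /patch memNset // => Jjx.
by case/eqP: ji; exact: J_unique Jjx Jx.
Qed.

End TestFunctions.

(** * The group of the momentum operator on [Omega] *)

Section MomentumGroup.
Context {R : realType} {n : nat}.
Variables (alpha beta : 'I_n -> R).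
Hypothesis alpha_beta : forall i, alpha i < beta i.
Hypothesis beta_alpha : forall i j : 'I_n, (i < j)%N -> beta i < alpha j.
Variables (B : 'M[R[i]]_n) (E : set R -> (R -> R[i]) -> (R -> R[i])).
Hypothesis hE :
  spectral_measure (Omega alpha beta) (DB alpha beta B) momentum E.
Variable U : R -> (R -> R[i]) -> (R -> R[i]).
Hypothesis hU : exp_group (Omega alpha beta) E U.

Local Notation mT := (measurableTypeR R).
Local Notation mu := (@lebesgue_measure R).
Local Notation W := (Omega alpha beta : set mT).
Local Notation mW := (measurable_Omega alpha beta).
Local Notation H := (L2_space mW).
Local Notation ip := (@L2_ip R W mW).
Local Notation El S := (@lift_op R W mW (E S)).
Local Notation Ul t := (@lift_op R W mW (U t)).
Implicit Types x y z : H.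

Let hip : inner_product ip := ip_inner_product mW.

Lemma E_bounded (S : set mT) : measurable S -> bounded_operator W (E S).
Proof. by move=> mS; have [[+ _ _ _ _] _] := hE => /(_ S mS)[]. Qed.

Lemma U_bounded t : bounded_operator W (U t).
Proof. by have [] := hU t. Qed.

Lemma El_linear (S : set mT) : measurable S -> weakly_linear ip (El S).
Proof. by move=> mS; exact: lift_op_linear (E_bounded mS). Qed.

Lemma ElE (S : set mT) x : measurable S -> El S x = E S x :> (R -> R[i]).
Proof. by move=> mS; exact: bounded_operator_lift (E_bounded mS) x. Qed.

Lemma UlE t x : Ul t x = U t x :> (R -> R[i]).
Proof. exact: bounded_operator_lift (U_bounded t) x. Qed.

Lemma El_adj (S : set mT) x y : measurable S -> ip (El S x) y = ip x (El S y).
Proof.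
move=> mS; rewrite /L2_ip !ElE //.
have [[+ _ _ _ _] _] := hE => /(_ S mS)[_ _]; apply; exact: L2_space_L2.
Qed.

Lemma El_setI (S S' : set mT) x : measurable S -> measurable S' ->
  weakly_equal ip (El S (El S' x)) (El (S `&` S') x).
Proof.
move=> mS mS'; apply/ip_eqL2; rewrite !ElE //; last exact: measurableI.
have [[_ _ _ + _] _] := hE => /(_ S S' x mS mS' (L2_space_L2 x)).
by apply: filterS => r /[apply] ->.
Qed.

Lemma El_setT x : weakly_equal ip (El setT x) x.
Proof.
apply/ip_eqL2; rewrite ElE //.
by have [[_ _ + _ _] _] := hE => /(_ x (L2_space_L2 x)).
Qed.

Lemma El_set0 x : weakly_equal ip (El set0 x) 0.
Proof.
apply/ip_eqL2; rewrite ElE //.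
by have [[_ + _ _ _] _] := hE => /(_ x (L2_space_L2 x)).
Qed.

(** Choice assembles the measures, given vector by vector, into a family; on measurable sets each of
    them is determined by [E]. *)
Let spectral_data x : {m : {measure set (measurableTypeR R) -> \bar R} |
  [/\ diagonal_measure W E x m,
    (exists2 g, DB alpha beta B g & eqL2 W g x) <->
      (\int[m]_r (r ^+ 2)%:E < +oo)%E
    & DB alpha beta B x -> ipL2 W (momentum x) x =
       cintegral m setT (fun r => r%:C)]}.
Proof. by apply: cid; have [_ h] := hE; exact: h (L2_space_L2 x). Qed.

Definition spectral_diag x := projT1 (spectral_data x).

Local Notation m := spectral_diag.

Lemma diag_mE x (S : set mT) : measurable S -> m x S = (Re (ip (El S x) x))%:E.
Proof.
move=> mS; rewrite /m /L2_ip ElE //.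
by case: (projT2 (spectral_data x)) => + _ _; apply.
Qed.

Lemma DB_moment x : (exists2 g, DB alpha beta B g & eqL2 W g x) <->
  finite_second_moment m x.
Proof. by case: (projT2 (spectral_data x)). Qed.

Lemma DB_form x : DB alpha beta B x ->
  ipL2 W (momentum x) x = cintegral (m x) setT (fun r => r%:C).
Proof. by case: (projT2 (spectral_data x)). Qed.

Lemma Ul_spectral t : spectral_op ip m (unit_exp t) (Ul t).
Proof.
split.
- exact: lift_op_linear (U_bounded t).
- exact: lift_op_compat (U_bounded t).
- exact: bounded_cmeasurable_exp.
move=> x; have [_ /(_ x (L2_space_L2 x))[m' [hm' h]]] := hU t.
rewrite /L2_ip UlE h /cintegral /Rintegral.
(* The measure supplied with [U t] need not be the chosen one, but both are given by [E] on
   measurable sets. *)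
have mm (f : mT -> \bar R) : (\int[m']_r f r = \int[m x]_r f r)%E.
  apply: eq_measure_integral => A mA _.
  by rewrite diag_mE // hm' // /L2_ip ElE.
by rewrite !mm.
Qed.

Lemma Ul_add s t x : weakly_equal ip (Ul s (Ul t x)) (Ul (s + t) x).
Proof.
exact: (U_add hip El_linear El_adj El_setI El_set0 diag_mE Ul_spectral).
Qed.

Lemma diag_Ul t x (A : set mT) : measurable A -> m (Ul t x) A = m x A.
Proof.
exact: (diag_U hip El_linear El_adj El_setI El_setT El_set0 diag_mE Ul_spectral).
Qed.

Lemma DB_invariant t x : (exists2 g, DB alpha beta B g & eqL2 W g x) ->
  exists2 g, DB alpha beta B g & eqL2 W g (Ul t x).
Proof.
move=> /DB_moment hx; apply/DB_moment; rewrite /finite_second_moment.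
have -> : (\int[m (Ul t x)]_r (r ^+ 2)%:E = \int[m x]_r (r ^+ 2)%:E)%E.
  by apply: eq_measure_integral => A mA _; exact: diag_Ul.
exact: hx.
Qed.

Let G (x dx : H) : Prop := test alpha beta x dx.

Let G_linear c x dx y dy : G x dx -> G y dy -> G (c *: x + y) (c *: dx + dy).
Proof. exact: test_linear. Qed.

Let G_moment x dx : G x dx -> finite_second_moment m x.
Proof. by move=> Gx; apply/DB_moment; exists x; [exact: test_DB Gx|exact: ae_eq_refl]. Qed.

Let G_form x dx : G x dx -> ip dx x = 'i * (2 * pi * \int[m x]_r r)%:C.
Proof.
move=> Gx; have := DB_form (test_DB B Gx).
set c : R[i] := (0 +i* (2 * pi))^-1.
have -> : momentum x = (c *: dx : H).
  by rewrite /momentum (test_cderive Gx).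
rewrite -/(L2_ip (c *: dx) x) (ipZl hip) /cintegral /= => h.
have c0 : (0 +i* (2 * pi) : R[i]) != 0.
  by rewrite eq_complex /= eqxx /= mulf_neq0 // gt_eqF // pi_gt0.
apply: (mulfI (invr_neq0 c0)); rewrite -/c h.
rewrite (_ : 'i * _ = (0 +i* (2 * pi)) * (\int[m x]_r r)%:C); last first.
  by simpc.
rewrite mulrA /c mulVf // mul1r.
by rewrite (_ : (fun _ => 0) = cst 0) // Rintegral_cst // mul0r.

Qed.

Let G_dense z e : 0 < e -> exists x dx, G x dx /\ nrm ip (z - x) <= e.
Proof.
move=> e0; have Lz := L2_space_L2 z; have [zR zI] := (L2P mW z).1 Lz.
(* Half of [e ^+ 2] for the real part, half for the imaginary part. *)
have e2 : 0 < e ^+ 2 / 2 by rewrite divr_gt0 // exprn_gt0.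
have [v [dv tv] hv] := real_test_dense alpha_beta beta_alpha zR e2.
have [w [dw tw] hw] := real_test_dense alpha_beta beta_alpha zI e2.
pose f r : R[i] := v r +i* w r; pose df r : R[i] := dv r +i* dw r.
have tf : test alpha beta f df by [].
have [Lf Ldf] := test_L2 tf.
exists (mkL2 mW Lf), (mkL2 mW Ldf); split => //.
rewrite -(@ler_pXn2r _ 2) ?nnegrE ?nrm_ge0 ?(ltW e0) // sqr_nrm //.
set y := z - _; have Ly := L2_space_L2 y.
rewrite /L2_ip (ipL2E mW) //=.
have E1 : (fun r : mT => Re (y r)) = (fun r => Re (z r) - v r).
  by apply/funext => r; exact: (ReB (z r) (f r)).
have E2 : (fun r : mT => Im (y r)) = (fun r => Im (z r) - w r).
  by apply/funext => r; exact: (ImB (z r) (f r)).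
rewrite E1 E2; move: hv hw; rewrite /sqnorm /pairing.
under eq_Rintegral do rewrite expr2.
move=> hv; under eq_Rintegral do rewrite expr2.
by move=> hw; lra.
Qed.

Lemma path_constant (g dg : R -> H) (a b K : R) (s t : R) (k : H) :
  (forall s, a < s < b -> test alpha beta (g s) (dg s)) ->
  (forall s, a < s < b -> nrm ip (dg s) <= K) ->
  (forall s h, a < s < b -> a < s + h < b ->
     nrm ip (g (s + h) - g s - h%:C *: dg s) <= K * h ^+ 2) ->
  a < s < b -> a < t < b -> ip (g s) (Ul s k) = ip (g t) (Ul t k).
Proof.
move=> h1 h2 h3.
exact: (path_pairing_constant hip El_linear El_adj El_setI El_setT El_set0
  diag_mE Ul_spectral G_linear G_moment G_form G_dense h1 h2 h3).
Qed.

(** Turns pointwise spline estimates into norm estimates; the [2] counts the real and the imaginary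
    part. *)
Lemma nrm_bounded (y : H) (c : R) : 0 <= c ->
  (forall r, `|Re (y r)| <= c /\ `|Im (y r)| <= c) ->
  nrm ip y <= c * Num.sqrt (2 * fine (mu W)).
Proof.
move=> c0 hy; have Ly := L2_space_L2 y.
have [yR yI] := (L2P mW y).1 Ly.
have F0 : 0 <= 2 * fine (mu W) by rewrite mulr_ge0 // fine_ge0.
rewrite -(@ler_pXn2r _ 2) ?nnegrE ?mulr_ge0 ?nrm_ge0 ?sqrtr_ge0 //.
rewrite sqr_nrm // exprMn sqr_sqrtr // /L2_ip (ipL2E mW) //=.
have [_ ic] := bounded_square_integrable mW (lebesgue_Omega_fin alpha beta)
  (bounded_measurable_cst c).
have key (u : mT -> R) : square_integrable W u -> (forall r, `|u r| <= c) ->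
    pairing W u u <= c ^+ 2 * fine (mu W).
  move=> hu hc; rewrite -Rintegral_cst //; last exact: mW.
  apply: le_Rintegral => //.
  - exact: mW.
  - exact: (integrableM_square_integrable mW hu hu).
  - move=> r _; rewrite -expr2 -real_normK ?num_real //.
    by rewrite lerXn2r ?nnegrE.
have := key _ yR (fun r => (hy r).1); have := key _ yI (fun r => (hy r).2).
by lra.
Qed.

Lemma C11_L2 K v dv : C11 K v dv ->
  L2 W (fun r => (v r)%:C) /\ L2 W (fun r => (dv r)%:C).
Proof.
move=> hv; have [bv bdv] := C11_bounded_measurable hv.
have i0 := square_integrable0 W.
have fW := lebesgue_Omega_fin alpha beta.
split; apply/(L2P mW); split => //.
  exact: (bounded_square_integrable mW fW bv).
exact: (bounded_square_integrable mW fW bdv).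
Qed.

(** The path [s |-> v (. + s - t)] leads from [v (. - t)] at time [0] to [v] at time [t] with
    supports inside [J i], so its pairing with [Ul s f] is constant. *)
Lemma translation_pairing i t p q K v dv (f : H) (Lv : L2 W (fun r => (v r)%:C))
    (Lvt : L2 W (fun r => (v (r - t))%:C)) :
  alpha i <= p -> alpha i <= p + t -> q <= beta i -> q + t <= beta i ->
  C11 K v dv -> bump_function p q v dv ->
  ip (mkL2 mW Lv) (Ul t f) = ip (mkL2 mW Lvt) f.
Proof.
move=> ap apt qb qbt hK bv; have [_ [e e0 ve]] := bv.
have hs s := C11_shift (s - t) hK.
pose g s : H := mkL2 mW (C11_L2 (hs s)).1.
pose dg s : H := mkL2 mW (C11_L2 (hs s)).2.
(* For [s] strictly between these bounds the support of [g s] stays inside [J i]; thanks to the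
   margin [e] they enclose both [0] and [t]. *)
set a0 := q - e + t - beta i; set b0 := p + e + t - alpha i.
have K0 := C11_ge0 hK.
have N0 : 0 <= Num.sqrt (2 * fine (mu W)) by exact: sqrtr_ge0.
have := @path_constant g dg a0 b0 (K * Num.sqrt (2 * fine (mu W))) 0 t f.
have h1 s : a0 < s < b0 -> test alpha beta (g s) (dg s).
  move=> /andP[as_ sb]; apply: test_real.
  apply: (@real_test_bump _ _ _ _ alpha_beta beta_alpha i); split; first by exists K.
  (* The room left at [alpha i] and at [beta i]. *)
  exists (Num.min (b0 - s) (s - a0)); first by rewrite lt_min !subr_gt0 as_ sb.
  have m1 : Num.min (b0 - s) (s - a0) <= b0 - s by rewrite ge_min lexx.
  have m2 : Num.min (b0 - s) (s - a0) <= s - a0 by rewrite ge_min lexx orbT.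
  move: m1 m2; rewrite /a0 /b0 => m1 m2 x hx.
  by apply: ve; case: hx => hx; [left|right]; lra.
have h2 s : a0 < s < b0 -> nrm ip (dg s) <= K * Num.sqrt (2 * fine (mu W)).
  move=> _; apply: nrm_bounded => // r; rewrite /= normr0; split=> //.
  by have [_ + _] := hs s r; apply.
have h3 s h : a0 < s < b0 -> a0 < s + h < b0 ->
    nrm ip (g (s + h) - g s - h%:C *: dg s) <=
      K * Num.sqrt (2 * fine (mu W)) * h ^+ 2.
  move=> _ _; rewrite mulrAC; apply: nrm_bounded; first by rewrite mulr_ge0 ?sqr_ge0.
  move=> r; have [_ _ /(_ h)] := hs s r.
  have -> : (g (s + h) - g s - h%:C *: dg s) r =
      (v (r + (s + h - t)) - v (r + (s - t)) - h * dv (r + (s - t)))%:C.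
    by rewrite !rmorphB rmorphM.
  rewrite /= normr0 (_ : r + h + (s - t) = r + (s + h - t)); last by ring.
  by split=> //; rewrite mulr_ge0 ?sqr_ge0.
have h4 : a0 < 0 < b0 by rewrite /a0 /b0; apply/andP; split; lra.
have h5 : a0 < t < b0 by rewrite /a0 /b0; apply/andP; split; lra.
move=> /(_ h1 h2 h3 h4 h5).
have gt : g t = mkL2 mW Lv.
  by apply: val_inj; apply/funext => r /=; rewrite subrr addr0.
have g0 : g 0 = mkL2 mW Lvt.
  by apply: val_inj; apply/funext => r /=; rewrite sub0r.
rewrite gt g0 => <-.
have U0 := U_0 hip El_adj El_setT diag_mE Ul_spectral.
by rewrite (ip_conj hip) U0 -(ip_conj hip).
Qed.

(** [translation_pairing] puts the time on the bump, a change of variables moves it onto [f], and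
    only zero is orthogonal to all bumps on []p, q[]. *)
Lemma group_translation i t p q (f : R -> R[i]) : L2 W f ->
  alpha i <= p -> alpha i <= p + t -> q <= beta i -> q + t <= beta i ->
  ae_eq mu (`]p, q[%classic : set mT) (U t f) (fun r => f (r + t)).
Proof.
move=> Lf ap apt qb qbt.
pose x := mkL2 mW Lf; pose z := Ul t x.
have zE : z = U t f :> (R -> R[i]) by exact: (UlE t x).
have [zR zI] := (L2P mW z).1 (L2_space_L2 z); have [fR fI] := (L2P mW f).1 Lf.
have sub c d : alpha i <= c -> d <= beta i -> `]c, d[%classic `<=` W.
  move=> ac db r /=; rewrite in_itv /= => /andP[cr rd]; exists i => //.
  by rewrite JE; apply/andP; split; lra.
have sub0 := sub p q ap qb; have sub1 := sub (p + t) (q + t) apt qbt.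
have mI := measurable_oo p q; have mIt := measurable_oo (p + t) (q + t).
have key (u w : mT -> R) : square_integrable W u -> square_integrable W w ->
    (forall K v dv, C11 K v dv -> bump_function p q v dv ->
       pairing W v u = pairing W (fun r => v (r - t)) w) ->
    ae_eq mu `]p, q[%classic u (fun r => w (r + t)).
  move=> hu hw H0.
  have hu' := square_integrableS mI mW sub0 hu.
  have hw1 := square_integrableS mIt mW sub1 hw.
  have hw' := square_integrable_shift hw1.
  have orth v dv : bump_function p q v dv ->
      pairing `]p, q[%classic (fun r => u r - w (r + t)) v = 0.
    move=> bv; have [[K hK] _] := bv; have hv := bump_square_integrable bv.
    have vt0 r : ~ `](p + t), (q + t)[%classic r -> v (r - t) = 0.
      rewrite /= in_itv /= => /negP; rewrite negb_and -!leNgt => hr.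
      by apply: (bump_function_eq0 bv); case/orP: hr => hr; [left|right]; lra.
    have v0 r : ~ `]p, q[%classic r -> v r = 0.
      rewrite /= in_itv /= => /negP; rewrite negb_and -!leNgt => hr.
      by apply: (bump_function_eq0 bv); case/orP: hr => hr; [left|right]; lra.
    have hvt : square_integrable (`](p + t), (q + t)[%classic : set mT)
        (fun r => v (r - t)).
      have [bv' _] := C11_bounded_measurable (C11_shift (- t) hK).
      exact: (bounded_square_integrable mIt (lebesgue_oo_fin _ _) bv').
    have := H0 K v dv hK bv.
    rewrite (pairing_support _ sub0 v0) (pairing_support _ sub1 vt0).
    rewrite pairing_shift // => e1.
    rewrite (_ : (fun r => u r - w (r + t)) = (fun r => -1 * w (r + t) + u r)).
      rewrite pairingDl // (pairingC _ u) e1 (pairingC _ (fun r => w (r + t))).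
      rewrite (_ : (fun r => v (r + t - t)) = v) ?mulN1r ?addNr //.
      by apply/funext => r; rewrite addrK.
    by apply/funext => r; rewrite mulN1r addrC.
  have := bump_orthogonal (square_integrableB mI hu' hw') orth.
  by apply: filterS => r /[apply] /eqP; rewrite subr_eq0 => /eqP.
have pair0 (u : mT -> R) : pairing W (fun=> 0) u = 0.
  rewrite /pairing (_ : (fun _ => _) = cst 0) ?Rintegral_cst ?mul0r //.
    exact: mW.
  by apply/funext => r; rewrite mul0r.
(* Because the bump is real, the one complex identity separates into these two. *)
have tp K v dv : C11 K v dv -> bump_function p q v dv ->
  pairing W v (fun r => Re (z r)) = pairing W (fun r => v (r - t)) (fun r => Re (f r)) /\
  pairing W v (fun r => Im (z r)) = pairing W (fun r => v (r - t)) (fun r => Im (f r)).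
  move=> hK bv.
  have Lv := (C11_L2 hK).1; have Lvt := (C11_L2 (C11_shift (- t) hK)).1.
  have := translation_pairing x Lv Lvt ap apt qb qbt hK bv.
  rewrite /L2_ip !(ipL2E mW) //; last exact: L2_space_L2.
  by rewrite /= !pair0 !addr0 !sub0r => -[-> /oppr_inj ->].
have aR := key _ _ zR fR (fun K v dv hK bv => (tp K v dv hK bv).1).
have aI := key _ _ zI fI (fun K v dv hK bv => (tp K v dv hK bv).2).
apply: filterS2 aR aI => r hR hI Ir; rewrite -zE.
by apply/eqP; rewrite eq_complex (hR Ir) (hI Ir) !eqxx.
Qed.

Lemma DB_group_invariant t f : L2 W f -> DB alpha beta B f ->
  exists2 g, DB alpha beta B g & eqL2 W g (U t f).
Proof.
move=> Lf hf; rewrite -(UlE t (mkL2 mW Lf)).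
by apply: DB_invariant; exists f => //; exact: ae_eq_refl.
Qed.

(** Operators act on functions, and a regular representative [g] of [U t f] has to be fed back into
    [U s]. *)
Lemma group_add s t f g : L2 W f -> L2 W g -> eqL2 W g (U t f) ->
  eqL2 W (U s g) (U (s + t) f).
Proof.
move=> Lf Lg gU; pose x := mkL2 mW Lf; pose y := mkL2 mW Lg.
have xy : weakly_equal ip y (Ul t x) by apply/ip_eqL2; rewrite UlE.
have /ip_eqL2 : weakly_equal ip (Ul s y) (Ul (s + t) x).
  move=> w; rewrite -Ul_add; exact: (lift_op_compat (U_bounded s)).
by rewrite !UlE.
Qed.

End MomentumGroup.

(** * Uniform continuity and pointwise values of representatives *)

Section AbsolutelyContinuous.
Context {R : realType}.
Local Notation mT := (measurableTypeR R).
Local Notation mu := (@lebesgue_measure R).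
Implicit Types (f g : R -> R[i]) (a b x y : R).

Lemma normr_Re_le (z : R[i]) : `|Re z| <= Normc.normc z.
Proof. by case: z => a b /=; rewrite -sqrtr_sqr ler_wsqrtr // lerDl sqr_ge0. Qed.

Lemma normr_Im_le (z : R[i]) : `|Im z| <= Normc.normc z.
Proof. by case: z => a b /=; rewrite -sqrtr_sqr ler_wsqrtr // lerDr sqr_ge0. Qed.

Definition uniformly_continuous_on (A : set R) (u : R -> R) : Prop :=
  forall e, 0 < e -> exists2 d, 0 < d &
    forall x y, A x -> A y -> `|x - y| < d -> `|u x - u y| < e.

(** A family of one interval suffices. This is all that the pointwise arguments retain of absolute
    continuity. *)
Lemma abs_continuous_uniform A f : abs_continuous A f ->
  uniformly_continuous_on A (fun x => Re (f x)) /\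
  uniformly_continuous_on A (fun x => Im (f x)).
Proof.
move=> hf.
have key e : 0 < e -> exists2 d, 0 < d & forall x y, A x -> A y ->
    `|x - y| < d -> x <= y -> Normc.normc (f y - f x) < e.
  move=> e0; have [d d0 hd] := hf e e0; exists d => // x y Ax Ay xyd xy.
  have := hd 1%N (fun=> x) (fun=> y); rewrite !big_ord1; apply.
  - by move=> j; split.
  - by apply/trivIsetP => i j _ _; rewrite !ord1 eqxx.
  - by rewrite -(ger0_norm (_ : 0 <= y - x)) ?subr_ge0 // distrC.
split=> e e0; have [d d0 hd] := key e e0; exists d => // x y Ax Ay xyd.
  have [xy|/ltW xy] := leP x y.
    rewrite distrC -ReB (le_lt_trans (normr_Re_le _)) //; exact: hd.
  by rewrite -ReB (le_lt_trans (normr_Re_le _)) //; apply: hd; rewrite // distrC.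
have [xy|/ltW xy] := leP x y.
  rewrite distrC -ImB (le_lt_trans (normr_Im_le _)) //; exact: hd.
by rewrite -ImB (le_lt_trans (normr_Im_le _)) //; apply: hd; rewrite // distrC.
Qed.

Lemma uniformly_continuous_on_continuous a b (u : R -> R) x :
  uniformly_continuous_on `]a, b[%classic u -> a < x < b -> {for x, continuous u}.
Proof.
move=> hu xab; apply/cvgrPdist_le => e e0; have [d d0 hd] := hu e e0.
near=> y; apply/ltW/hd.
- by rewrite /= in_itv.
- by near: y; exact: (near_in_itvoo (_ : x \in `]a, b[)).
- by near: y; exists d.
Unshelve. all: by end_near. Qed.

(** Every point is reached from the midpoint by a fixed number of steps shorter than [d], each
    changing [u] by less than [1]. *)
Lemma uniformly_continuous_on_bounded a b (u : R -> R) :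
  uniformly_continuous_on `]a, b[%classic u ->
  exists M, forall x, a < x < b -> `|u x| <= M.
Proof.
move=> hu; have [d d0 hd] := hu 1 ltr01.
have step k x y : a < x < b -> a < y < b -> `|x - y| <= k%:R * (d / 2) ->
    `|u x - u y| <= k%:R.
  elim: k x y => [|k IH] x y xab yab.
    by rewrite mul0r normr_le0 subr_eq0 => /eqP ->; rewrite subrr normr0.
  (* [z] lies one [k.+1]-th of the way from [x] to [y], so [k] steps remain after it. *)
  move=> h; pose z := x + (y - x) / k.+1%:R.
  have k0 : 0 < k.+1%:R :> R by rewrite ltr0n.
  have k1 : 0 < (k.+1%:R : R)^-1 <= 1.
    by rewrite invr_gt0 k0 invf_le1 // ler1n.
  have zab : a < z < b.
    have -> : z = x * (1 - k.+1%:R^-1) + y * k.+1%:R^-1.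
      by rewrite /z; field; rewrite gt_eqF.
    move: xab yab k1; set w := _^-1 => /andP[? ?] /andP[? ?] /andP[? ?].
    by apply/andP; split; nra.
  have xz : `|x - z| < d.
    have -> : x - z = (x - y) / k.+1%:R by rewrite /z; field; rewrite gt_eqF.
    rewrite normrM normfV (gtr0_norm k0) ltr_pdivrMr //.
    rewrite (le_lt_trans h) // mulrC ltr_pM2r //; lra.
  have zy : `|z - y| <= k%:R * (d / 2).
    have -> : z - y = (x - y) * (k%:R / k.+1%:R).
      by rewrite /z -natr1; field; rewrite natr1 gt_eqF.
    rewrite normrM [X in _ * X]ger0_norm ?divr_ge0 ?ler0n //.
    have -> : k%:R * (d / 2) = k.+1%:R * (d / 2) * (k%:R / k.+1%:R).
      by field; rewrite gt_eqF.
    by rewrite ler_wpM2r // divr_ge0 ?ler0n.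
  have -> : u x - u y = (u x - u z) + (u z - u y) by ring.
  rewrite (le_trans (ler_normD _ _)) // -natr1 addrC lerD ?IH //.
  by apply/ltW/hd; rewrite //= in_itv.
have [ab|ab] := ltP a b; last first.
  by exists 0 => x /andP[h1 h2]; have := lt_le_trans (lt_trans h1 h2) ab; rewrite ltxx.
pose c := (a + b) / 2; pose N := (Num.trunc ((b - a) / (d / 2))).+1.
have d2 : 0 < d / 2 by rewrite divr_gt0.
exists (N%:R + `|u c|) => x xab.
have -> : u x = (u x - u c) + u c by rewrite subrK.
rewrite (le_trans (ler_normD _ _)) // lerD2r step //.
  by rewrite /c; apply/andP; split; lra.
have hN : (b - a) / (d / 2) <= N%:R by rewrite ltW // /N Num.Theory.truncnS_gt.
rewrite ler_pdivrMr // in hN; apply: le_trans hN.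
by move: xab => /andP[? ?]; rewrite /c ler_norml; apply/andP; split; lra.
Qed.

Lemma ae_exists (c d : R) (P : R -> Prop) : c < d ->
  {ae mu, forall x, (`]c, d[%classic : set mT) x -> P x} ->
  exists2 x, c < x < d & P x.
Proof.
move=> cd h; apply: contrapT => H0.
have : mu.-negligible (`]c, d[%classic : set mT).
  apply: negligibleS h => x; rewrite /= in_itv /= => xcd Hx; apply: H0.
  by exists x => //; exact: Hx.
have mcd : mu (`]c, d[%classic : set mT) = (d - c)%:E.
  by rewrite lebesgue_measure_itv /= lte_fin cd -EFinB.
move=> [A [mA A0 sA]].
have : (mu (`]c, d[%classic : set mT) <= mu A)%E.
  by apply: le_measure => //; rewrite inE //; exact: measurable_oo.
by rewrite A0 mcd lee_fin subr_le0 leNgt cd.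
Qed.

(* Covers both end points of the interval, where [u] has no value of its own,
   and, for [t = 0], the uniqueness of continuous representatives. *)
Lemma translated_value (a b x t : R) (u v : R -> R) :
  uniformly_continuous_on `]a, b[%classic u ->
  uniformly_continuous_on `]a, b[%classic v ->
  a < x < b ->
  {ae mu, forall y : mT, a < y < b -> a < y + t < b -> v y = u (y + t)} ->
  forall e, 0 < e -> exists2 d, 0 < d &
    forall z, a < z < b -> `|z - (x + t)| < d -> `|v x - u z| <= e.
Proof.
move=> hu hv /andP[ax xb] h e e0; have e2 : 0 < e / 2 by rewrite divr_gt0.
have [d1 d10 hd1] := hu _ e2; have [d2 d20 hd2] := hv _ e2.
(* The first entry keeps [z - t] near [x], the others keep it inside []a, b[]. *)
pose d := Num.min (d2 / 2) (Num.min (x - a) (b - x)).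
have [m1 [m2 m3]] : d <= d2 / 2 /\ d <= x - a /\ d <= b - x.
  by rewrite /d !ge_min !lexx /= ?orbT.
have d0 : 0 < d by rewrite !lt_min divr_gt0 // !subr_gt0 ax.
exists d => // z /andP[az zb]; rewrite ltr_norml => /andP[z1 z2].
(* A point [y] will be taken just left of [z - t]: it is within [d2] of [x], [y + t] is within [d1]
   of [z], and both lie in []a, b[]. *)
pose r := Num.min (Num.min d1 (d2 / 2)) (Num.min (z - t - a) (Num.min (z - a) (b - z))).
have r0 : 0 < r by rewrite !lt_min d10 divr_gt0 //=; apply/andP; split; [lra|apply/andP; split; lra].
have [r1 [r2 [r3 r4]]] : r <= d1 /\ r <= d2 / 2 /\ r <= z - t - a /\ r <= z - a.
  by rewrite /r !ge_min !lexx ?orbT; do ?split.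
have [||y /andP[y1 y2]] := @ae_exists (z - t - r) (z - t)
    (fun y => a < y < b -> a < y + t < b -> v y = u (y + t)).
- by rewrite ltrBlDr ltrDl.
- by apply: filterS h => y hy _; exact: hy.
have yab : a < y < b by apply/andP; split; lra.
have ytab : a < y + t < b by apply/andP; split; lra.
move=> /(_ yab ytab) vu.
have p1 : `|v x - v y| < e / 2.
  apply: hd2; rewrite /= ?in_itv /= ?ax //.
  by rewrite ltr_norml; apply/andP; split; lra.
have p2 : `|u (y + t) - u z| < e / 2.
  apply: hd1; rewrite /= ?in_itv /= ?az //.
  by rewrite ltr_norml; apply/andP; split; lra.
have -> : v x - u z = (v x - v y) + (u (y + t) - u z) by rewrite vu; ring.
by rewrite (le_trans (ler_normD _ _)) //; lra.
Qed.

Lemma lim_left_endpoint (a b l : R) (u : R -> R) : a < b ->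
  (forall e, 0 < e -> exists2 d, 0 < d &
    forall z, a < z < b -> `|z - b| < d -> `|l - u z| <= e) ->
  lim (u z @[z --> b^'-]) = l.
Proof.
move=> ab H; apply: cvg_lim => //; apply/cvgrPdist_le => e e0.
have [d d0 hd] := H e e0; near=> z; apply: hd.
  apply/andP; split; near: z; first exact: nbhs_left_gt.
  exact: nbhs_left_lt.
have zb : z < b by near: z; exact: nbhs_left_lt.
rewrite ltr0_norm ?subr_lt0 // opprB ltrBlDl -ltrBlDr.
by near: z; apply: nbhs_left_gt; rewrite ltrBlDr ltrDl.
Unshelve. all: by end_near. Qed.

Lemma lim_right_endpoint (a b l : R) (u : R -> R) : a < b ->
  (forall e, 0 < e -> exists2 d, 0 < d &
    forall z, a < z < b -> `|z - a| < d -> `|l - u z| <= e) ->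
  lim (u z @[z --> a^'+]) = l.
Proof.
move=> ab H; apply: cvg_lim => //; apply/cvgrPdist_le => e e0.
have [d d0 hd] := H e e0; near=> z; apply: hd.
  apply/andP; split; near: z; first exact: nbhs_right_gt.
  exact: nbhs_right_lt.
have az : a < z by near: z; exact: nbhs_right_gt.
rewrite gtr0_norm ?subr_gt0 // ltrBlDl.
by near: z; apply: nbhs_right_lt; rewrite ltrDl.
Unshelve. all: by end_near. Qed.

End AbsolutelyContinuous.

Section Representatives.
Context {R : realType} {n : nat}.
Variables (alpha beta : 'I_n -> R).
Hypothesis alpha_beta : forall i, alpha i < beta i.
Local Notation mT := (measurableTypeR R).
Local Notation mu := (@lebesgue_measure R).
Local Notation W := (Omega alpha beta : set mT).
Implicit Types f g h : R -> R[i].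

(** [Dmax] asks for square integrability of the derivative only; the function itself is bounded on
    finitely many intervals of finite length. *)
Lemma ac_L2 f : (forall i, abs_continuous (J alpha beta i) f) -> L2 W f.
Proof.
move=> hf; have mW := measurable_Omega alpha beta.
have key (u : R -> R) : (forall i, uniformly_continuous_on (J alpha beta i) u) ->
    square_integrable W u.
  move=> hu.
  have mu_ : measurable_fun W u.
    apply: subspace_continuous_measurable_fun => //.
    apply: continuous_in_subspaceT => x; rewrite inE => -[i _]; rewrite JE => xi.
    exact: uniformly_continuous_on_continuous (hu i) xi.
  split=> //.
  have /choice[M hM] i := uniformly_continuous_on_bounded (hu i).
  apply: measurable_bounded_integrable => //.
  - exact: lebesgue_Omega_fin.
  - exact: measurable_funX.
  (* The sum dominates every single bound, which avoids a maximum over the index set. *)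
  exists ((\sum_i `|M i|) ^+ 2); split; first exact: num_real.
  move=> N /ltW sN x [i _]; rewrite JE => xi; rewrite /= normrX (le_trans _ sN) //.
  have s0 : 0 <= \sum_i `|M i| by exact: sumr_ge0.
  rewrite lerXn2r ?nnegrE ?normr_ge0 // (le_trans (hM i x xi)) //.
  rewrite (le_trans (ler_norm _)) // (bigD1 i) //= lerDl sumr_ge0 //.
have hc i := abs_continuous_uniform (hf i).
by apply/(L2P mW); split; apply: key => i; have [] := hc i.
Qed.

(** Translation by [t] carries [x] exactly to an end point and the points on the inner side of [x]
    into the interval, so the one-sided limit of [f] matches the value of the continuous [g]. *)
Lemma endpoint_values i f g x t : abs_continuous (J alpha beta i) f ->
  abs_continuous (J alpha beta i) g -> J alpha beta i x ->
  {ae mu, forall y : mT, J alpha beta i y -> J alpha beta i (y + t) ->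
     g y = f (y + t)} ->
  (x + t = beta i -> cleft_lim f (beta i) = g x) /\
  (x + t = alpha i -> cright_lim f (alpha i) = g x).
Proof.
move=> /abs_continuous_uniform[fR fI] /abs_continuous_uniform[gR gI] xi h.
rewrite JE in xi.
have hR : {ae mu, forall y : mT, alpha i < y < beta i ->
    alpha i < y + t < beta i -> Re (g y) = Re (f (y + t))}.
  by apply: filterS h => y; rewrite !JE => + h1 h2 => /(_ h1 h2) ->.
have hI : {ae mu, forall y : mT, alpha i < y < beta i ->
    alpha i < y + t < beta i -> Im (g y) = Im (f (y + t))}.
  by apply: filterS h => y; rewrite !JE => + h1 h2 => /(_ h1 h2) ->.
have VR := translated_value fR gR xi hR.
have VI := translated_value fI gI xi hI.
split=> xt; rewrite xt in VR VI.
  rewrite /cleft_lim (lim_left_endpoint (alpha_beta i) VR).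
  by rewrite (lim_left_endpoint (alpha_beta i) VI); case: (g x).
rewrite /cright_lim (lim_right_endpoint (alpha_beta i) VR).
by rewrite (lim_right_endpoint (alpha_beta i) VI); case: (g x).
Qed.

Lemma ac_eq i f g x : abs_continuous (J alpha beta i) f ->
  abs_continuous (J alpha beta i) g -> eqL2 W f g -> J alpha beta i x ->
  f x = g x.
Proof.
move=> /abs_continuous_uniform[fR fI] /abs_continuous_uniform[gR gI] h xi.
rewrite JE in xi.
have h0 : {ae mu, forall y : mT, alpha i < y < beta i ->
    alpha i < y + 0 < beta i -> f y = g (y + 0)}.
  by apply: filterS h => y h1 h2 _; rewrite addr0; apply: h1; exists i; rewrite // JE.
have hR : {ae mu, forall y : mT, alpha i < y < beta i ->
    alpha i < y + 0 < beta i -> Re (f y) = Re (g (y + 0))}.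
  by apply: filterS h0 => y + h1 h2 => /(_ h1 h2) ->.
have hI : {ae mu, forall y : mT, alpha i < y < beta i ->
    alpha i < y + 0 < beta i -> Im (f y) = Im (g (y + 0))}.
  by apply: filterS h0 => y + h1 h2 => /(_ h1 h2) ->.
have key (u v : R -> R) : (forall e, 0 < e -> exists2 d, 0 < d &
    forall z, alpha i < z < beta i -> `|z - (x + 0)| < d -> `|u x - v z| <= e) ->
    u x = v x.
  move=> H; apply/eqP; rewrite -subr_eq0 -normr_le0; apply/ler_addgt0Pr => e e0.
  by rewrite add0r; have [d d0] := H e e0; apply; rewrite // addr0 subrr normr0.
apply/eqP; rewrite eq_complex.
rewrite (key _ _ (translated_value gR fR xi hR)) eqxx /=.
by rewrite (key _ _ (translated_value gI fI xi hI)).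
Qed.

(** Makes the boundary vector depend on the class in [L2] only, so that absolutely continuous
    representatives can be exchanged. *)
Lemma at_alpha_eq f g : (forall i, abs_continuous (J alpha beta i) f) ->
  (forall i, abs_continuous (J alpha beta i) g) -> eqL2 W f g ->
  at_alpha alpha f = at_alpha alpha g.
Proof.
move=> hf hg fg; apply/matrixP => i j; rewrite !mxE /cright_lim.
have near_eq : \forall y \near (alpha i)^'+, f y = g y.
  near=> y; apply: (ac_eq (hf i) (hg i) fg); rewrite JE; apply/andP; split.
    by near: y; exact: nbhs_right_gt.
  by near: y; apply: nbhs_right_lt; exact: alpha_beta.
have lim_eq (u : R[i] -> R) : lim (u (f y) @[y --> (alpha i)^'+]) =
    lim (u (g y) @[y --> (alpha i)^'+]).
  have imp (p q : R -> R[i]) : (\forall y \near (alpha i)^'+, p y = q y) ->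
      forall A : set R, (\forall y \near (alpha i)^'+, A (u (p y))) ->
      \forall y \near (alpha i)^'+, A (u (q y)).
    by move=> pq A; apply: filterS2 pq => y ->.
  congr (lim _); apply/seteqP; split=> A; first exact: imp.
  by apply: imp; apply: filterS near_eq => y ->.
by rewrite (lim_eq (@Re R)) (lim_eq (@Im R)).
Unshelve. all: by end_near. Qed.

End Representatives.

Theorem theorem5p1 (R : realType) (n : nat) (hn : (0 < n)%N)
    (alpha beta : 'I_n -> R)
    (halphabeta : forall i, alpha i < beta i)
    (hbetaalpha : forall i j : 'I_n, (i < j)%N -> beta i < alpha j)
    (B : 'M[R[i]]_n) (hB : B \is unitarymx)
    (E : set R -> (R -> R[i]) -> (R -> R[i]))
    (hE : spectral_measure (Omega alpha beta) (DB alpha beta B) momentum E)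
    (U : R -> (R -> R[i]) -> (R -> R[i]))
    (hU : exp_group (Omega alpha beta) E U) :
  (* (i) *)
  (forall (t : R) (f : R -> R[i]), DB alpha beta B f ->
     exists2 g, ac_representative alpha beta (U t f) g &
       B *m at_alpha alpha g = at_beta beta g) /\
  (* (ii) *)
  (forall i : 'I_n,
     (forall t : R,
        J alpha beta i `&` [set y - t | y in J alpha beta i] !=set0 ->
        forall f : R -> R[i], L2 (Omega alpha beta) f ->
        {ae (@lebesgue_measure R), forall x : R,
          (J alpha beta i `&` [set y - t | y in J alpha beta i]) x ->
          U t f x = f (x + t)}) /\
     (forall (f : R -> R[i]) (x : R), DB alpha beta B f -> J alpha beta i x ->
        (forall g, ac_representative alpha beta (U (beta i - x) f) g ->
           g x = cleft_lim f (beta i)) /\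
        (forall g, ac_representative alpha beta (U (alpha i - x) f) g ->
           g x = cright_lim f (alpha i)))) /\
  (* (iii) *)
  (forall (f : R -> R[i]) (i : 'I_n) (x t : R),
     DB alpha beta B f -> J alpha beta i x -> beta i - x < t ->
     forall g h, ac_representative alpha beta (U t f) g ->
       ac_representative alpha beta (U (t - (beta i - x)) f) h ->
       g x = (B *m at_alpha alpha h) i ord0).
Proof.
have DB_L2 f : DB alpha beta B f -> L2 (Omega alpha beta) f.
  by move=> [[h _] _]; exact: ac_L2.
have inv t f : DB alpha beta B f ->
    exists2 g, DB alpha beta B g & eqL2 (Omega alpha beta) g (U t f).
  by move=> hf; apply: (DB_group_invariant hE hU) => //; exact: DB_L2.
have trans i t f : L2 (Omega alpha beta) f ->
    {ae (@lebesgue_measure R), forall y : measurableTypeR R,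
      J alpha beta i y -> J alpha beta i (y + t) -> U t f y = f (y + t)}.
  move=> Lf.
  (* []p, q[] is the intersection of [J i] with its translate by [- t]; if it is empty, nothing is
     claimed. *)
  pose p := Num.max (alpha i) (alpha i - t).
  pose q := Num.min (beta i) (beta i - t).
  have p1 : alpha i <= p by rewrite le_max lexx.
  have p2 : alpha i <= p + t by rewrite -lerBlDr le_max lexx orbT.
  have q1 : q <= beta i by rewrite ge_min lexx.
  have q2 : q + t <= beta i by rewrite -lerBrDr ge_min lexx orbT.
  have := group_translation halphabeta hbetaalpha hE hU Lf p1 p2 q1 q2.
  apply: filterS => y + hy hyt; apply.
  rewrite /= in_itv /= gt_max lt_min.
  move: hy hyt; rewrite !JE => /andP[? ?] /andP[? ?].
  by apply/andP; split; apply/andP; split; lra.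
have endpoints i f x t g : DB alpha beta B f -> J alpha beta i x ->
    ac_representative alpha beta (U t f) g ->
    (x + t = beta i -> cleft_lim f (beta i) = g x) /\
    (x + t = alpha i -> cright_lim f (alpha i) = g x).
  move=> hf xi [[ag _] gU]; have [[af _] _] := hf.
  apply: (endpoint_values halphabeta (af i) (ag i) xi).
  have := trans i t f (DB_L2 f hf); move: gU.
  apply: filterS2 => y gU h yi yti; rewrite gU ?h //; by exists i.
split=> [t f hf|].
  by have [g [Dg Bg] gU] := inv t f hf; exists g.
split=> [i|f i x t hf xi xt g h hg hh].
  split=> [t _ f Lf|f x hf xi].
    apply: filterS (trans i t f Lf) => y h [yi [z zi zy]].
    by apply: h => //; rewrite -zy subrK.
  split=> g hg.
    by have [-> //] := endpoints i f x _ g hf xi hg; rewrite addrC subrK.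
  by have [_ -> //] := endpoints i f x _ g hf xi hg; rewrite addrC subrK.
set s := t - (beta i - x) in hh *.
(* [h] is only known to lie in [Dmax]; the representative [g'] obtained from invariance also
   satisfies the boundary condition. *)
have [g' hg' gU'] := inv s f hf.
have [[ag' dg'] Bg'] := hg'.
have [[ah _] hU'] := hh.
have -> : at_alpha alpha h = at_alpha alpha g'.
  apply: at_alpha_eq => //.
  by apply: ae_eq_trans hU' _; exact: ae_eq_sym.
(* By the group law [U t f] is [U (beta i - x)] applied to [g'], so [g x] is the left limit of [g']
   at [beta i], which the boundary condition expresses through [at_alpha]. *)
have hgg : ac_representative alpha beta (U (beta i - x) g') g.
  have [Dg gU] := hg; split=> //; apply: ae_eq_trans gU _; apply: ae_eq_sym.
  have := group_add hE hU (beta i - x) (DB_L2 f hf) (DB_L2 g' hg') gU'.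
  by rewrite /s [_ + (t - _)]addrC subrK.
have [+ _] := endpoints i g' x (beta i - x) g hg' xi hgg.
by rewrite addrC subrK => /(_ erefl) <-; rewrite Bg' mxE.
Qed.
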